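(* Let $\eta>0$, let $\frac32<s\le2$ and let $u_0\in H^s(\mathbb{R})$ be a (real-valued) initial datum such that, for some $\varepsilon>0$ and some $c>0$, $|u_0(x)|\le\frac{c}{1+|x|^{2+\varepsilon}}$ and $\left|\frac{d}{dx}u_0(x)\right|\le\frac{c}{1+|x|^2}$ for all $x\in\mathbb{R}$. Let $u$ be the global solution arising from $u_0$ of $$\partial_t u+u\,\partial_x u+\partial_x^3u+\eta(\mathcal{H}\partial_x u+\mathcal{H}\partial_x^3u)=0 \ \text{ on } ]0,+\infty[\times\mathbb{R},\qquad u(0,\cdot)=u_0.$$ Then $u(t,x)$ has the following asymptotic development when $|x|$ is large enough: $$u(t,x)=K_\eta(t,x)\left(\int_{\mathbb{R}}u_0(y)\,dy\right)+\int_0^tK_\eta(t-\tau,x)\left(\int_{\mathbb{R}}u(\tau,y)\,\partial_yu(\tau,y)\,dy\right)d\tau+o(t)(1/|x|^2),$$ where the quantity $o(t)(1/|x|^2)$ is such that for all $t>0$ $$\lim_{|x|\to+\infty}\frac{o(t)(1/|x|^2)}{1/|x|^2}=0.$$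
   Context: Conventions: $\widehat f(\xi)=\int_{\mathbb{R}}e^{-ix\xi}f(x)\,dx$, $\mathcal{F}^{-1}g(x)=\frac1{2\pi}\int_{\mathbb{R}}e^{ix\xi}g(\xi)\,d\xi$. $\mathcal{H}$ is the Hilbert transform with Fourier symbol $i\,\mathrm{sign}(\xi)$, i.e. $\mathcal{H}\varphi(x)=\mathrm{p.v.}\frac1\pi\int_{\mathbb{R}}\frac{\varphi(y)}{y-x}\,dy$. For $\eta>0$, $t>0$ the kernel is $K_\eta(t,x)=\mathcal{F}^{-1}\big(e^{i\xi^3t-\eta t(|\xi|^3-|\xi|)}\big)(x)$. The Cauchy problem is understood through its equivalent integral formulation $$u(t,x)=K_\eta(t,\cdot)*u_0(x)-\frac12\int_0^tK_\eta(t-\tau,\cdot)*\partial_x(u^2)(\tau,\cdot)(x)\,d\tau.$$ For $u_0\in H^s(\mathbb{R})$, $\frac32<s\le2$, with $|u_0(x)|\le\frac{c}{1+|x|^2}$, there is a unique $u\in\mathcal{C}([0,+\infty[,H^s(\mathbb{R}))$ satisfying this integral equation; it belongs to $\mathcal{C}(]0,+\infty[,\mathcal{C}^\infty(\mathbb{R}))$ and satisfies $|u(t,x)|\le C(t)/(1+|x|^2)$ for all $t>0$, $x\in\mathbb{R}$. This is ''the global solution arising from $u_0$''. *)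

(* Defs.v *)
From HB Require Import structures.
From mathcomp Require Import all_boot all_order all_algebra complex.
From mathcomp Require Import all_classical all_reals all_analysis.
From mathcomp Require Import measurable_realfun ring.
Import Order.TTheory GRing.Theory Num.Theory.
Import numFieldNormedType.Exports.

Set Implicit Arguments.
Unset Strict Implicit.
Unset Printing Implicit Defensive.

Local Open Scope classical_set_scope.
Local Open Scope ring_scope.
Local Open Scope complex_scope.

Section Defs.
Context {R : realType}.
Local Notation mu := (@lebesgue_measure R).
Implicit Types (f g : R -> R) (u : R -> R -> R) (s t x xi eta : R).

Definition cexp (z : R[i]) : R[i] :=
  (expR (complex.Re z))%:C * (cos (complex.Im z) +i* sin (complex.Im z)).

Definition cintegral (h : R -> R[i]) : R[i] :=
  (\int[mu]_(x in setT) complex.Re (h x)) +i*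
  (\int[mu]_(x in setT) complex.Im (h x)).

Definition fourier (h : R -> R[i]) xi : R[i] :=
  cintegral (fun x => cexp (- ('i * (x * xi)%:C)) * h x).

Definition inv_fourier (h : R -> R[i]) x : R[i] :=
  ((2 * pi)^-1)%:C * cintegral (fun xi => cexp ('i * (x * xi)%:C) * h xi).

Definition truncation f (n : nat) x : R[i] :=
  (f x * \1_(`[- n%:R, n%:R]) x)%:C.

(* The L2 Fourier transform, determined up to a null set: [h] is the L2 limit
   of the Fourier integrals of the truncations of [f]. *)
Definition is_L2_fourier f (h : R -> R[i]) : Prop :=
  [/\ measurable_fun setT (fun xi => complex.Re (h xi)),
      measurable_fun setT (fun xi => complex.Im (h xi)) &
      Lnorm mu 2%:E (fun xi =>
        (Normc.normc (fourier (truncation f n) xi - h xi))%:E)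
      @[n --> \oo] --> 0%E].

Definition L2_fourier f : R -> R[i] := xget (fun=> 0) (is_L2_fourier f).

(* Independent of the transform picked by [L2_fourier], since two of them agree
   almost everywhere. *)
Definition Hs_norm s f : \bar R :=
  Lnorm mu 2%:E (fun xi =>
    ((1 + xi ^+ 2) `^ (s / 2) * Normc.normc (L2_fourier f xi))%:E).

(* The second clause always holds, by Plancherel; it makes [L2_fourier f]
   meaningful without appeal to that theorem. *)
Definition Hs s f : Prop :=
  [/\ f \in Lfun mu 2%:E,
      (exists h, is_L2_fourier f h) &
      (Hs_norm s f < +oo)%E].

(* u \in C([0, +oo[, H^s); the values of u at negative times are irrelevant. *)
Definition continuous_Hs s u : Prop :=
  (forall t, 0 <= t -> Hs s (u t)) /\
  (forall t, 0 <= t ->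
     Hs_norm s (u t' \- u t) @[t' --> within [set t' | 0 <= t'] (nbhs t)]
       --> 0%E).

Definition convolution f g x : R := \int[mu]_(y in setT) (f (x - y) * g y).

Definition K_etaC eta t : R -> R[i] :=
  inv_fourier (fun xi =>
    cexp ('i * (xi ^+ 3 * t)%:C - (eta * t * (`|xi| ^+ 3 - `|xi|))%:C)).

(* The inverse Fourier transform is real: see [K_etaC_real] below. *)
Definition K_eta eta t x : R := complex.Re (K_etaC eta t x).

(* The equation and its datum are imposed pointwise, hence the continuous
   representative of each u(t, .); for s > 3/2 it is C^1 by Sobolev embedding,
   so that the classical derivative of u^2 makes sense. *)
Definition global_solution eta s (u0 : R -> R) u : Prop :=
  [/\ continuous_Hs s u,
      (forall t, 0 <= t -> continuous (u t)),
      u 0 = u0 &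
      forall t x, 0 < t ->
        u t x = convolution (K_eta eta t) u0 x
          - 2^-1 * \int[mu]_(tau in `[0, t])
              convolution (K_eta eta (t - tau))
                          (derive1 (fun y => u tau y ^+ 2)) x].

Lemma ge0_integral_opp (G : R -> R) : continuous G -> (forall x, 0 <= G x) ->
  (\int[mu]_x (G (- x))%:E = \int[mu]_x (G x)%:E)%E.
Proof.
move=> cG G0.
have split_int (H : R -> R) : continuous H -> (forall x, 0 <= H x) ->
  (\int[mu]_x (H x)%:E = \int[mu]_(x in `]-oo, 0%R]) (H x)%:E + \int[mu]_(x in `[0%R, +oo[) (H x)%:E)%E.
  move=> cH H0.
  have mH : measurable_fun [set: R] H by exact: continuous_measurable_fun.
  rewrite -(setUv (`]-oo, 0]%classic : set R)) ge0_integral_setU//=; last 4 first.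
  - exact: measurableC.
  - by apply/measurable_EFinP; rewrite setUv.
  - by move=> x _; rewrite lee_fin.
  - exact/disj_setPCl.
  congr (_ + _)%E.
  rewrite setCitvl integral_itv_obnd_cbnd//.
  exact/measurable_EFinP/measurable_funTS.
have cGo : continuous (G \o -%R).
  by move=> x; apply: continuous_comp; [exact: opp_continuous|exact: cG].
have := split_int (G \o -%R) cGo (fun x => G0 _) => /= ->.
rewrite (split_int _ cG G0) addeC; congr (_ + _)%E.
- have := @ge0_integration_by_substitutionNy R (G \o -%R) 0.
  rewrite oppr0 /= => -> //; last exact: continuous_subspaceT.
  by apply: eq_integral => x _ /=; rewrite opprK.
- have := @ge0_integration_by_substitutionNy R G 0; rewrite oppr0 => -> //.
  exact: continuous_subspaceT.
Qed.

Lemma Rintegral_odd (F : R -> R) : continuous F ->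
  (forall x, F (- x) = - F x) -> \int[mu]_(x in setT) F x = 0.
Proof.
move=> cF oF; rewrite /Rintegral integralE.
have -> : (\int[mu]_x ((fun x => (F x)%:E)^\- x) =
   \int[mu]_x ((fun x => (F x)%:E)^\+ x))%E.
  pose G x := Num.max (F x) 0.
  transitivity (\int[mu]_x (G (- x))%:E)%E.
    by apply: eq_integral => x _; rewrite funenegE /G oF EFin_max.
  rewrite ge0_integral_opp//.
  - by apply: eq_integral => x _; rewrite funeposE /G EFin_max.
  - by move=> x; apply: (@continuous_max R R F (cst 0)); [exact: cF|exact: cvg_cst].
  - by move=> x; rewrite /G le_max lexx orbT.
case: (\int[mu]_x _)%E => [r||] //=; exact: subrr.
Qed.

Lemma K_etaC_real (eta t x : R) : complex.Im (K_etaC eta t x) = 0.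
Proof.
pose F (xi : R) :=
  expR (- (eta * t * (`|xi| ^+ 3 - `|xi|))) * sin (x * xi + xi ^+ 3 * t).
have cF : continuous F.
  move=> y; apply: cvgM; last first.
    apply: (@continuous_comp _ _ _ (fun xi : R => x * xi + xi ^+ 3 * t) sin);
      last exact: continuous_sin.
    apply: cvgD; first by apply: cvgMl_tmp; exact: cvg_id.
    by apply: cvgMr_tmp; exact: exprn_continuous.
  apply: (@continuous_comp _ _ _
    (fun xi : R => - (eta * t * (`|xi| ^+ 3 - `|xi|))) expR);
    last exact: continuous_expR.
  apply: cvgN; apply: cvgMl_tmp; apply: cvgB.
    apply: (@continuous_comp R R R (fun z : R => `|z|) (fun z : R => z ^+ 3)).
      by apply: cvg_norm; exact: cvg_id.
    exact: exprn_continuous.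
  by apply: cvg_norm; exact: cvg_id.
transitivity ((2 * pi)^-1 * \int[mu]_(xi in setT) F xi).
  rewrite /K_etaC /inv_fourier /cintegral /=.
  rewrite [0 * Rintegral _ _ _]mul0r [LHS]addr0; congr (_ * _).
  apply: eq_Rintegral => xi _; rewrite /F /=.
  rewrite !(mul0r, mul1r, mulr0, addr0, add0r, subr0, sub0r, oppr0, expR0).
  rewrite sinD; ring.
rewrite Rintegral_odd ?mulr0// => xi.
by rewrite /F normrN -[RHS]mulrN -sinN; congr (_ * sin _); ring.
Qed.

End Defs.

(* Main.v *)
Require Import Defs.
From mathcomp Require Import all_boot all_order all_algebra complex.
From mathcomp Require Import all_classical all_reals all_analysis.
From mathcomp Require Import measurable_realfun ring lra.
Import Order.TTheory GRing.Theory Num.Theory.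
Import numFieldNormedType.Exports.

(** The second term of the expansion vanishes: [u * u_y = (u^2 / 2)_y] and
    [u] is [O(1 / y^2)], so its integral over the line is zero at every time
    ([momentum_flux_eq0]). What has to be shown is therefore
    [u(t,x) = K(t,x) * int u0 + o(1 / x^2)]. By the integral equation,
    [u - K * u0] is a Duhamel term in [u^2], and two estimates suffice: this
    term is [O(1 / |x|^3)] ([nonlinear_decay]), and [K * u0 - K int u0] is
    [o(1 / x^2)] ([leading_term_le]).

    The kernel. Writing [t = m^3] and rescaling the frequency by [m], the kernel
    becomes [m^-1 k(x / m)], where [k] is an oscillatory integral over the half
    line with a cubic phase and a cubic damping ([K_eta_prof]). Each integration
    by parts gains a factor [1 / y] and a boundary term at frequency zero; two
    of them give [k = O(1 / y^2)], and three give [k' = O(1 / |y|^3)], because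
    the boundary terms that would spoil these rates vanish. So [K] is at most a
    constant times the Poisson kernel of width [m] ([K_eta_le]), and [K_x] is at
    most [m^-1] times it and at most [m / |x|^3] ([dK_eta_le]).

    Regularity. For [s > 3/2] the Fourier transform of a function of [H^s] is
    integrable against [1 + |xi|]; Fourier inversion, proved by Abel summation
    with the Poisson kernel, then shows that a continuous function of [H^s] is
    [C^1], bounded and with bounded derivative ([Hs_sup_bound], [Hs_C1]). Thus the derivative in
    the Duhamel term can be moved to the kernel ([convolution_derive]), and
    continuity in time with values in [H^s] bounds [u] on [[0, T] x R]
    ([uniformly_bounded]).

    Decay. Splitting a convolution with [K_x] at [|y| = |x| / 2] bounds it by
    [m^-1 sup_(|y| >= |x|/2) u^2 + m |x|^-3 int_(|y| < |x|/2) u^2]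
    ([convolution_dK_eta_le]). As [u] is bounded, [sup u^2] is at most a constant
    times [sup |u|], so that a bound for [|y| >= 2^n] yields one for
    [|y| >= 2^(n+1)]. The constant is absorbed by a weight [exp(lambda t)]:
    since [(t - tau)^(-1/3)] is integrable, the Duhamel term gains a negative
    power of [lambda], and for [lambda] large the bounds decrease by a factor 4
    at each doubling ([dyadic_decay]). This is the decay [u = O(1 / x^2)],
    uniformly on [[0, T]] ([uniform_decay]). Inserted once more in the split,
    it turns the two parts into [O(|x|^-4)] and [O(|x|^-3)].

    The integrands of the time integrals are not known to be measurable. They
    are only ever bounded by integrable majorants, and the integral of a
    function, measurable or not, is at most that of an integrable majorant of
    its absolute value ([norm_Rintegral_le]). *)

Set Implicit Arguments.
Unset Strict Implicit.
Unset Printing Implicit Defensive.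

Local Open Scope classical_set_scope.
Local Open Scope ring_scope.

(** * Integrals on the line: majorants, exhaustion, the fundamental theorem *)
Section toolbox.
Context {R : realType}.
Local Notation mu := (@lebesgue_measure R).
Implicit Types (f g F : R -> R) (D : set R) (a b x y : R).

(** The integral of a nonnegative function is a supremum over the simple functions
    below it, so its monotonicity needs no measurability. *)
Lemma le_integral_nonmeasurable D (f g : R -> \bar R) :
  (forall x, D x -> (0 <= f x)%E) -> (forall x, D x -> (f x <= g x)%E) ->
  (\int[mu]_(x in D) f x <= \int[mu]_(x in D) g x)%E.
Proof.
move=> f0 fg; rewrite integral_mkcond [leRHS]integral_mkcond.
have h1 x : (0 <= (f \_ D) x)%E by apply: erestrict_ge0.
have h12 x : ((f \_ D) x <= (g \_ D) x)%E by apply: lee_restrict.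
rewrite !ge0_integralTE//; last by move=> x; exact: le_trans (h12 x).
apply: ge_ereal_sup => _ /= [h hf <-].
apply: ereal_sup_ubound => /=; exists h => // x.
exact: le_trans (hf x) (h12 x).
Qed.

(** The positive and the negative parts of [f] both integrate to at most
    [int g], whether or not [f] is measurable. *)
Lemma norm_Rintegral_le D f g : measurable D ->
  (forall x, D x -> `|f x| <= g x) -> mu.-integrable D (EFin \o g) ->
  `|\int[mu]_(x in D) f x| <= \int[mu]_(x in D) g x.
Proof.
move=> mD fg ig.
have g0 x : D x -> 0 <= g x by move=> Dx; exact: le_trans (fg _ Dx).
rewrite /Rintegral.
have gE : (0 <= \int[mu]_(x in D) (g x)%:E)%E by apply: integral_ge0 => x Dx; rewrite lee_fin g0.
rewrite [X in fine X](_ : _ = \int[mu]_(x in D) (fun x => (f x)%:E)^\+ x - \int[mu]_(x in D) (fun x => (f x)%:E)^\- x)%E; last by rewrite integralE.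
set p := (\int[mu]_(x in D) (_^\+ x))%E; set n := (\int[mu]_(x in D) (_^\- x))%E.
have p0 : (0 <= p)%E by apply: integral_ge0 => x _; exact: funepos_ge0.
have n0 : (0 <= n)%E by apply: integral_ge0 => x _; exact: funeneg_ge0.
have pg : (p <= \int[mu]_(x in D) (g x)%:E)%E.
  apply: le_integral_nonmeasurable => x Dx; first exact: funepos_ge0.
  rewrite funeposE -EFin_max lee_fin ge_max g0// andbT.
  exact: le_trans (ler_norm _) (fg _ Dx).
have ng : (n <= \int[mu]_(x in D) (g x)%:E)%E.
  apply: le_integral_nonmeasurable => x Dx; first exact: funeneg_ge0.
  rewrite funenegE -EFinN -EFin_max lee_fin ge_max g0// andbT.
  by apply: le_trans (fg _ Dx); rewrite -normrN ler_norm.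
have : (\int[mu]_(x in D) (g x)%:E < +oo)%E by exact: integrable_lty.
move: p n (\int[mu]_(x in D) (g x)%:E)%E p0 n0 pg ng gE => [p||] [n||] [r||] //=.
rewrite !lee_fin => p0 n0 pr nr r0 _.
by rewrite ler_norml; apply/andP; split; lra.
Qed.

Lemma integrable_le D f g : measurable D -> measurable_fun D f ->
  (forall x, D x -> `|f x| <= g x) -> mu.-integrable D (EFin \o g) ->
  mu.-integrable D (EFin \o f).
Proof.
move=> mD mf fg ig; apply: le_integrable ig => //; first exact/measurable_EFinP.
by move=> x Dx; rewrite lee_fin; exact: le_trans (fg _ Dx) (ler_norm _).
Qed.

Lemma integrable_scale D f (k : R) : measurable D -> mu.-integrable D (EFin \o f) ->
  mu.-integrable D (EFin \o (fun x => k * f x)).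
Proof. by move=> mD fi; exact: integrableZl fi. Qed.

Lemma integrable_add D f g : measurable D -> mu.-integrable D (EFin \o f) ->
  mu.-integrable D (EFin \o g) -> mu.-integrable D (EFin \o (fun x => f x + g x)).
Proof. by move=> mD fi gi; exact: integrableD fi gi. Qed.

Lemma integrable_sub D f g : measurable D -> mu.-integrable D (EFin \o f) ->
  mu.-integrable D (EFin \o g) -> mu.-integrable D (EFin \o (fun x => f x - g x)).
Proof. by move=> mD fi gi; exact: integrableB fi gi. Qed.

Lemma integrable_abs D f : measurable D -> mu.-integrable D (EFin \o f) ->
  mu.-integrable D (EFin \o (fun x => `|f x|)).
Proof. by move=> mD fi; exact: integrable_norm fi. Qed.

(** Monotone convergence applied separately to the positive and negative parts. *)
Lemma cvg_integral_exhaust (A : (set R)^nat) D f :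
  nondecreasing_seq A -> (forall n, measurable (A n)) -> \bigcup_n A n = D ->
  mu.-integrable D (EFin \o f) ->
  \int[mu]_(x in A n) f x @[n --> \oo] --> \int[mu]_(x in D) f x.
Proof.
move=> ndA mA AD fi.
have mD : measurable D by rewrite -AD; exact: bigcupT_measurable.
have AsubD n : A n `<=` D by rewrite -AD; exact: bigcup_sup.
have mf : measurable_fun D (EFin \o f) by exact: measurable_int fi.
have fiA n : mu.-integrable (A n) (EFin \o f). { apply: integrableS fi. exact: mD. exact: mA. exact: AsubD. }
have cvgp : (\int[mu]_(x in A n) (EFin \o f)^\+ x @[n --> \oo] --> \int[mu]_(x in D) (EFin \o f)^\+ x)%E.
  rewrite -AD; apply: ge0_nondecreasing_set_cvg_integral => // n.
  by apply: measurable_funS (measurable_funepos mf) => //; exact: AsubD.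
have cvgn : (\int[mu]_(x in A n) (EFin \o f)^\- x @[n --> \oo] --> \int[mu]_(x in D) (EFin \o f)^\- x)%E.
  rewrite -AD; apply: ge0_nondecreasing_set_cvg_integral => // n.
  by apply: measurable_funS (measurable_funeneg mf) => //; exact: AsubD.
have fp : (\int[mu]_(x in D) (EFin \o f)^\+ x)%E \is a fin_num by exact: integrable_pos_fin_num.
have fn : (\int[mu]_(x in D) (EFin \o f)^\- x)%E \is a fin_num by exact: integrable_neg_fin_num.
apply: fine_cvg.
rewrite fineK; last exact: integrable_fin_num.
rewrite integralE.
under eq_fun do rewrite integralE.
apply: (cvgeB _ cvgp cvgn); exact: fin_num_adde_defr.
Qed.

Lemma continuous_integrable_cc f a b : continuous f ->
  mu.-integrable `[a, b] (EFin \o f).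
Proof.
move=> cf; apply: continuous_compact_integrable; first exact: segment_compact.
exact: continuous_subspaceT.
Qed.

Lemma bigcup_sym_itv : \bigcup_n `[- n%:R, n%:R]%classic = [set: R].
Proof.
apply/seteqP; split => // x _.
have [n xn] : exists n : nat, `|x| < n%:R.
  by exists (Num.truncn `|x|).+1; exact: truncnS_gt.
by exists n => //=; rewrite in_itv/= -ler_norml ltW.
Qed.

Lemma bigcup_right_itv a : \bigcup_n `[a, a + n%:R]%classic = `[a, +oo[%classic.
Proof.
apply/seteqP; split => x.
  by move=> [n _] /=; rewrite !in_itv/= andbT => /andP[].
rewrite /= in_itv/= andbT => ax.
have [n xn] : exists n : nat, x - a < n%:R.
  by exists (Num.truncn (x - a)).+1; exact: truncnS_gt.
by exists n => //=; rewrite in_itv/= ax; lra.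
Qed.

Lemma nondecreasing_sym_itv : nondecreasing_seq (fun n => `[- n%:R, n%:R]%classic : set R).
Proof.
move=> m n mn; rewrite subsetEset => x /=; rewrite !in_itv/= => /andP[h1 h2].
have : m%:R <= n%:R :> R by rewrite ler_nat.
by move=> h; apply/andP; split; lra.
Qed.

Lemma nondecreasing_right_itv a : nondecreasing_seq (fun n => `[a, a + n%:R]%classic : set R).
Proof.
move=> m n mn; rewrite subsetEset => x /=; rewrite !in_itv/= => /andP[h1 h2].
have : m%:R <= n%:R :> R by rewrite ler_nat.
by move=> h; apply/andP; split; lra.
Qed.

Lemma FTC_cc f F a b : a <= b -> continuous f ->
  (forall x, is_derive x (1:R) F (f x)) ->
  \int[mu]_(x in `[a, b]) f x = F b - F a.
Proof.
move=> + cf dF; rewrite le_eqVlt => /predU1P[->|ab].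
  by rewrite set_itv1 Rintegral_set1 subrr.
have dvF x : derivable F x 1 by have [] := dF x.
have cF : continuous F.
  by move=> x; apply: differentiable_continuous; exact/derivable1_diffP.
rewrite /Rintegral (@continuous_FTC2 _ f F)//.
- exact: continuous_subspaceT.
- split => //; [exact: cvg_at_right_filter (cF _)|exact: cvg_at_left_filter (cF _)].
- by move=> x _; rewrite derive1E derive_val.
Qed.

Lemma FTC_R_cvg f F (l k : R) : continuous f ->
  (forall x, is_derive x (1:R) F (f x)) ->
  F x @[x --> +oo] --> l -> F x @[x --> -oo] --> k ->
  \int[mu]_(x in `[- n%:R, n%:R]) f x @[n --> \oo] --> l - k.
Proof.
move=> cf dF Fl Fk.
rewrite (_ : (fun n : nat => _) = (fun n : nat => F n%:R - F (- n%:R))); last first.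
  by apply/funext => n; rewrite (@FTC_cc f F)// ge0_cp// ler0n.
apply: cvgB; first exact: (cvg_comp _ _ cvgr_idn Fl).
have Fk' : F (- x) @[x --> +oo] --> k by apply/cvgNy_compNP.
exact: (cvg_comp _ _ cvgr_idn Fk').
Qed.

Lemma FTC_right_cvg f F a (l : R) : continuous f ->
  (forall x, is_derive x (1:R) F (f x)) ->
  F x @[x --> +oo] --> l ->
  \int[mu]_(x in `[a, a + n%:R]) f x @[n --> \oo] --> l - F a.
Proof.
move=> cf dF Fl.
rewrite (_ : (fun n : nat => _) = (fun n : nat => F (a + n%:R) - F a)); last first.
  by apply/funext => n; rewrite (@FTC_cc f F)// lerDl ler0n.
apply: cvgB; last exact: cvg_cst.
apply: (cvg_comp _ _ _ Fl).
apply/cvgryPge => A; near=> n; rewrite -lerBlDl.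
by near: n; exact: nbhs_infty_ger.
Unshelve. all: by end_near.
Qed.

(** For a nonnegative function, convergence of the integrals over an exhaustion
    already yields integrability; this is how explicit primitives are used below. *)
Lemma ge0_integrable_exhaust (A : (set R)^nat) D f (l : R) :
  nondecreasing_seq A -> (forall n, measurable (A n)) -> \bigcup_n A n = D ->
  (forall n, mu.-integrable (A n) (EFin \o f)) ->
  (forall x, 0 <= f x) -> measurable_fun D f ->
  \int[mu]_(x in A n) f x @[n --> \oo] --> l ->
  mu.-integrable D (EFin \o f) /\ \int[mu]_(x in D) f x = l.
Proof.
move=> ndA mA AD fiA f0 mf fl.
have mD : measurable D by rewrite -AD; exact: bigcupT_measurable.
have mfE : measurable_fun D (EFin \o f) by exact/measurable_EFinP.
have fi : mu.-integrable D (EFin \o f).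
  apply/integrableP; split => //.
  under eq_integral do rewrite gee0_abs ?lee_fin//.
  have h : (\int[mu]_(x in A n) (f x)%:E @[n --> \oo] --> \int[mu]_(x in D) (f x)%:E)%E.
    rewrite -AD; apply: ge0_nondecreasing_set_cvg_integral => //.
    - by move=> n; apply: measurable_int (fiA n).
    - by move=> n x _; rewrite lee_fin.
  have h2 : (\int[mu]_(x in A n) (f x)%:E @[n --> \oo] --> l%:E)%E.
    apply/fine_cvgP; split => //.
    by apply: nearW => n; apply: (integrable_fin_num _ (fiA n)); exact: mA.
  by have /= -> := cvg_unique (@ereal_hausdorff R) h h2; rewrite ltry.
split => //.
have h := cvg_integral_exhaust ndA mA AD fi.
by rewrite -(cvg_lim _ h)//; exact: cvg_lim fl.
Qed.

Lemma ge0_FTC_R f F (l k : R) : continuous f -> (forall x, 0 <= f x) ->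
  (forall x, is_derive x (1:R) F (f x)) ->
  F x @[x --> +oo] --> l -> F x @[x --> -oo] --> k ->
  mu.-integrable setT (EFin \o f) /\ \int[mu]_x f x = l - k.
Proof.
move=> cf f0 dF Fl Fk.
apply: (ge0_integrable_exhaust nondecreasing_sym_itv _ bigcup_sym_itv) => //.
- by move=> n; exact: continuous_integrable_cc.
- exact: continuous_measurable_fun.
- exact: FTC_R_cvg.
Qed.

Lemma ge0_FTC_right f F a (l : R) : continuous f -> (forall x, 0 <= f x) ->
  (forall x, is_derive x (1:R) F (f x)) ->
  F x @[x --> +oo] --> l ->
  mu.-integrable `[a, +oo[ (EFin \o f) /\ \int[mu]_(x in `[a, +oo[) f x = l - F a.
Proof.
move=> cf f0 dF Fl.
apply: (ge0_integrable_exhaust (@nondecreasing_right_itv a) _ (@bigcup_right_itv a)) => //.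
- by move=> n; exact: continuous_integrable_cc.
- by apply: measurable_funTS; exact: continuous_measurable_fun.
- exact: FTC_right_cvg.
Qed.

Lemma FTC_R f F (l k : R) : continuous f -> mu.-integrable setT (EFin \o f) ->
  (forall x, is_derive x (1:R) F (f x)) ->
  F x @[x --> +oo] --> l -> F x @[x --> -oo] --> k ->
  \int[mu]_x f x = l - k.
Proof.
move=> cf fi dF Fl Fk.
have /= h := cvg_integral_exhaust nondecreasing_sym_itv (fun=> measurable_itv _) bigcup_sym_itv fi.
by rewrite -(cvg_lim _ h)//; apply: cvg_lim => //; exact: FTC_R_cvg Fl Fk.
Qed.

Lemma FTC_right f F a (l : R) : continuous f -> mu.-integrable `[a, +oo[ (EFin \o f) ->
  (forall x, is_derive x (1:R) F (f x)) ->
  F x @[x --> +oo] --> l ->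
  \int[mu]_(x in `[a, +oo[) f x = l - F a.
Proof.
move=> cf fi dF Fl.
have /= h := cvg_integral_exhaust (@nondecreasing_right_itv a) (fun=> measurable_itv _) (@bigcup_right_itv a) fi.
by rewrite -(cvg_lim _ h)//; apply: cvg_lim => //; exact: FTC_right_cvg Fl.
Qed.

End toolbox.

(** * The Poisson kernel and integrable powers *)

Section elementary_integrals.
Context {R : realType}.
Local Notation mu := (@lebesgue_measure R).
Implicit Types (f g F : R -> R) (D : set R) (a b x y z l : R).

Lemma derivable_continuous f : (forall x, derivable f x 1) -> continuous f.
Proof.
by move=> df x; apply: differentiable_continuous; exact/derivable1_diffP.
Qed.

Lemma cvg_affine_pinfty a b : 0 < a -> a * x + b @[x --> +oo] --> +oo.
Proof.
move=> a0; apply/cvgryPge => A; near=> x.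
by rewrite -lerBlDr -ler_pdivrMl//; near: x; exact: nbhs_pinfty_ge.
Unshelve. all: by end_near. Qed.

(** [pi] times the Poisson kernel of the half plane at height [l]. *)
Definition poisson l z := l / (l ^+ 2 + z ^+ 2).

Lemma poisson_ge0 l z : 0 <= l -> 0 <= poisson l z.
Proof. by move=> l0; rewrite divr_ge0// addr_ge0// sqr_ge0. Qed.

Lemma poisson_den_gt0 l z : 0 < l -> 0 < l ^+ 2 + z ^+ 2.
Proof. by move=> l0; rewrite ltr_pwDl ?exprn_gt0// sqr_ge0. Qed.

Lemma poisson_sym l x y : poisson l (x - y) = poisson l (y - x).
Proof. by rewrite /poisson -(sqrrN (x - y)) opprB. Qed.

Lemma continuous_poisson l x : 0 < l -> continuous (fun y => poisson l (x - y)).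
Proof.
move=> l0; apply: derivable_continuous => y.
apply: derivableM => //; apply: derivableV => //.
by rewrite gt_eqF// poisson_den_gt0.
Qed.

Lemma is_derive_atan_poisson l x y : 0 < l ->
  is_derive y (1:R) (fun y => atan ((y - x) / l)) (poisson l (x - y)).
Proof.
move=> l0; apply: is_derive_eq; rewrite /GRing.scale/=.
rewrite mulr0 add0r subr0 mulr1 /poisson.
have l2 := poisson_den_gt0 (x - y) l0.
have l2' : 0 < 1 + ((y - x) / l) ^+ 2 by rewrite ltr_pwDl// sqr_ge0.
by rewrite -(sqrrN (x - y)) opprB in l2 *; field; rewrite !gt_eqF.
Qed.

Lemma poisson_integral l x : 0 < l ->
  mu.-integrable setT (EFin \o (fun y => poisson l (x - y))) /\
  \int[mu]_y poisson l (x - y) = pi.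
Proof.
move=> l0.
have -> : pi = pi / 2 - - (pi / 2) :> R by lra.
apply: (@ge0_FTC_R R _ (fun y => atan ((y - x) / l))).
- exact: continuous_poisson.
- by move=> y; rewrite poisson_ge0// ltW.
- by move=> y; exact: is_derive_atan_poisson.
- apply: (cvg_comp _ _ _ (@cvgy_atan R)).
  have := @cvg_affine_pinfty l^-1 (- x / l); rewrite invr_gt0 => /(_ l0).
  by apply: cvg_trans; apply: near_eq_cvg; apply: nearW => y /=; ring.
- apply/cvgNy_compNP.
  rewrite (_ : _ \o _ = fun y => - atan (y / l + x / l)); last first.
    by apply/funext => y /=; rewrite -atanN; congr atan; ring.
  apply: cvgN; apply: (cvg_comp _ _ _ (@cvgy_atan R)).
  have := @cvg_affine_pinfty l^-1 (x / l); rewrite invr_gt0 => /(_ l0).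
  by apply: cvg_trans; apply: near_eq_cvg; apply: nearW => y /=; ring.
Qed.

Lemma integrable_poisson l x : 0 < l ->
  mu.-integrable setT (EFin \o (fun y => poisson l (x - y))).
Proof. by move=> /(@poisson_integral _ x)[]. Qed.

Lemma integral_poisson l x : 0 < l -> \int[mu]_y poisson l (x - y) = pi.
Proof. by move=> /(@poisson_integral _ x)[]. Qed.

(** The Cauchy density, the common majorant of all functions of order
    [O(1 / z^2)] below. *)
Lemma poisson1E z : poisson 1 (0 - z) = (1 + z ^+ 2)^-1.
Proof. by rewrite /poisson sub0r sqrrN expr1n div1r. Qed.

Lemma integrable_cauchy : mu.-integrable setT (EFin \o (fun z => (1 + z ^+ 2)^-1)).
Proof.
have := integrable_poisson 0 (@ltr01 R); apply: eq_integrable => // z _ /=.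
by rewrite poisson1E.
Qed.

Lemma integral_cauchy : \int[mu]_z (1 + z ^+ 2)^-1 = pi.
Proof.
rewrite -(integral_poisson 0 (@ltr01 R)).
by apply: eq_Rintegral => z _; rewrite poisson1E.
Qed.

Lemma integrable_tail p : 1 < p ->
  mu.-integrable setT (EFin \o (fun z => (1 + `|z|) `^ (- p))).
Proof.
move=> p1.
pose f z := (1 + `|z|) `^ (- p).
have f0 z : 0 <= f z by exact: powR_ge0.
have cpow q y : 0 < y -> {for y, continuous (fun z : R => z `^ q)}.
  move=> y0; apply: differentiable_continuous; apply/derivable1_diffP.
  by have [] := is_derive1_powR q y0.
have cf : continuous f.
  move=> z; apply: (@continuous_comp _ _ _ (fun z : R => 1 + `|z|) (fun w => w `^ (- p))); last first.
    by apply: cpow; rewrite ltr_pwDl.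
  apply: cvgD; first exact: cvg_cst.
  by apply: cvg_norm; exact: cvg_id.
have mf : measurable_fun setT (EFin \o f).
  by apply/measurable_EFinP; exact: continuous_measurable_fun.
apply/integrableP; split => //.
under eq_integral do rewrite gee0_abs ?lee_fin//.
rewrite ge0_symfun_integralT//; last by move=> z /=; rewrite /f normrN.
rewrite [X in (integral _ X _)](_ : _ = `[0, +oo[%classic); last first.
  by apply/seteqP; split => z /=; rewrite in_itv/= andbT.
(* a primitive only on [0 <= z], hence the reduction by symmetry *)
pose F z := (1 + z) `^ (1 - p) / (1 - p).
have dF z : 0 <= z -> is_derive z (1:R) F (f z).
  move=> z0.
  have z1 : 0 < 1 + z by lra.
  have h1 := is_derive1_powR (1 - p) z1.
  have h2 : is_derive z (1:R) (fun z => 1 + z) 1.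
    by under eq_fun do rewrite addrC; apply: is_derive_eq; rewrite addr0.
  have h3 : is_derive z (1:R) (fun z => (1 + z) `^ (1 - p)) ((1 - p) * (1 + z) `^ (1 - p - 1) * 1).
    exact: is_derive1_comp h1 h2.
  rewrite /F; apply: is_derive_eq; rewrite /GRing.scale/= mulr0 add0r /f ger0_norm//.
  rewrite (_ : 1 - p - 1 = - p); last by ring.
  by field; rewrite lt_eqF// subr_lt0.
rewrite (@ge0_continuous_FTC2y R f F 0 0).
- by rewrite -EFinB -EFinM ltry.
- by move=> z _.
- exact: continuous_subspaceT.
- rewrite /F -[X in _ --> X](mul0r (1 - p)^-1); apply: cvgMr_tmp.
  apply/cvgrPdist_lt => e e0; near=> z; rewrite sub0r normrN ger0_norm ?powR_ge0//.
  have z0 : 0 <= z by near: z; exact: nbhs_pinfty_ge.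
  rewrite -(opprB p 1) powRN invf_plt ?posrE ?powR_gt0 ?ltr_pwDl//.
  have p10 : 0 < p - 1 by rewrite subr_gt0.
  rewrite -[ltLHS]powRr1 ?invr_ge0 ?ltW// -[X in _ `^ X < _](mulVf (lt0r_neq0 p10)) powRrM.
  apply: gt0_ltr_powR; rewrite ?nnegrE ?powR_ge0//; first by lra.
  have : e^-1 `^ (p - 1)^-1 <= z by near: z; exact: nbhs_pinfty_ge.
  by lra.
- by move=> z z0; have [] := dF z (ltW z0).
- apply: cvg_at_right_filter; apply: differentiable_continuous; apply/derivable1_diffP.
  by have [] := dF 0 (lexx _).
- by move=> z; rewrite in_itv/= andbT => z0; rewrite derive1E; have [_ ->] := dF z (ltW z0).
Unshelve. all: by end_near. Qed.

End elementary_integrals.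
Section time_singularity.
Context {R : realType}.
Local Notation mu := (@lebesgue_measure R).

Lemma bigcup_left_itv (t : R) : 0 < t ->
  \bigcup_n `[0, t - t * n.+1%:R^-1]%classic = `[0, t[%classic.
Proof.
move=> t0; apply/seteqP; split => x.
  move=> [n _] /=; rewrite !in_itv/= => /andP[-> h]/=.
  by rewrite (le_lt_trans h)// ltrBlDr ltrDl mulr_gt0// invr_gt0.
rewrite /= in_itv/= => /andP[x0 xt].
have [n xn] : exists n : nat, t / (t - x) < n%:R.
  by exists (Num.truncn (t / (t - x))).+1; exact: truncnS_gt.
exists n => //=; rewrite in_itv/= x0/=.
have tx : 0 < t - x by rewrite subr_gt0.
rewrite lerBrDr -lerBrDl ler_pdivrMr//.
move: xn; rewrite ltr_pdivrMr// => xn.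
rewrite (le_trans (ltW xn))// mulrC; apply: ler_wpM2l; first exact: ltW.
by rewrite ler_nat.
Qed.

(** Integrability of the singularity that the Duhamel integrals have at the final
    time; the point [t], where the kernel degenerates, is excluded. *)
Lemma time_integral (t r : R) : 0 < t -> 0 < r ->
  mu.-integrable `[0, t[ (EFin \o (fun tau => (t - tau) `^ (r - 1))) /\
  \int[mu]_(tau in `[0, t[) ((t - tau) `^ (r - 1)) = t `^ r / r.
Proof.
move=> t0 r0.
pose F tau := - ((t - tau) `^ r / r).
pose f tau := (t - tau) `^ (r - 1).
have dF tau : tau < t -> is_derive tau (1:R) F (f tau).
  move=> taut; have tt : 0 < t - tau by rewrite subr_gt0.
  have h1 := is_derive1_powR r tt.
  have h2 : is_derive tau (1:R) (fun w : R => t - w) (-1).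
    apply: is_derive_eq. rewrite /GRing.scale/=; ring.
  have h3 : is_derive tau (1:R) (fun z => (t - z) `^ r) (r * (t - tau) `^ (r - 1) * (-1)).
    exact: (@is_derive1_comp _ (fun w : R => w `^ r) (fun w : R => t - w) _ _ _ h1 h2).
  rewrite /F; apply: is_derive_eq; rewrite /GRing.scale/= mulr0 add0r /f.
  by field; rewrite gt_eqF.
have cf tau : tau < t -> {for tau, continuous f}.
  move=> taut; apply: (@continuous_comp _ _ _ (fun w : R => t - w) (fun w => w `^ (r - 1))).
    by apply: cvgB; [exact: cvg_cst|exact: cvg_id].
  apply: differentiable_continuous; apply/derivable1_diffP.
  have tt : 0 < t - tau by rewrite subr_gt0.
  by have [] := is_derive1_powR (r - 1) tt.
have cF tau : tau < t -> {for tau, continuous F}.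
  move=> taut; apply: differentiable_continuous; apply/derivable1_diffP.
  by have [] := dF _ taut.
have tn n : t - t * n.+1%:R^-1 < t by rewrite ltrBlDr ltrDl mulr_gt0// invr_gt0.
have tn0 n : 0 <= t - t * n.+1%:R^-1.
  by rewrite subr_ge0 ler_piMr ?(ltW t0)// invf_le1 ?ler1n.
have wcf n : {within `[0, t - t * n.+1%:R^-1], continuous f}.
  apply: continuous_in_subspaceT => x; rewrite inE/= in_itv/= => /andP[_ xn].
  by apply: cf; exact: le_lt_trans xn (tn n).
have fi n : mu.-integrable `[0, t - t * n.+1%:R^-1] (EFin \o f).
  by apply: continuous_compact_integrable => //; exact: segment_compact.
apply: (ge0_integrable_exhaust _ _ (bigcup_left_itv t0)) => //.
- move=> m n mn; rewrite subsetEset => x /=; rewrite !in_itv/= => /andP[-> h]/=.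
  apply: (le_trans h); rewrite lerD2l lerN2 ler_wpM2l ?(ltW t0)//.
  by rewrite lef_pV2 ?posrE// ler_nat ltnS.
- by move=> x; exact: powR_ge0.
- apply: (@measurableT_comp _ _ _ _ _ _ (fun w : R => w `^ (r - 1))); first exact: measurable_powR.
  exact: measurable_funB.
- rewrite (_ : (fun n : nat => _) = fun n => t `^ r / r - (t * n.+1%:R^-1) `^ r / r); last first.
    apply/funext => n; have := tn0 n; rewrite le_eqVlt => /predU1P[E|tn0'].
      rewrite -E set_itv1 Rintegral_set1.
      have -> : t * n.+1%:R^-1 = t by move/eqP : E; rewrite eq_sym subr_eq0 => /eqP.
      by rewrite subrr.
    rewrite /Rintegral (@continuous_FTC2 _ f F)//=.
    - by rewrite /F subr0 opprB addrCA subrr addr0 opprK addrC.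
    - split.
      + by move=> x; rewrite in_itv/= => /andP[_ xn]; have [] := dF x (lt_trans xn (tn n)).
      + by apply: cvg_at_right_filter; exact: cF.
      + by apply: cvg_at_left_filter; exact: cF.
    - move=> x; rewrite in_itv/= => /andP[_ xn]; rewrite derive1E.
      by have [_ ->] := dF x (lt_trans xn (tn n)).
  rewrite -[X in _ --> X]subr0; apply: cvgB; first exact: cvg_cst.
  rewrite -[X in _ --> X](mul0r r^-1); apply: cvgMr_tmp.
  have /cvg_at_rightP := powR_cvg0 r0; apply; split.
    by move=> n; rewrite mulr_gt0// invr_gt0.
  by rewrite -[X in _ --> X](mulr0 t); apply: cvgMl_tmp; exact: cvg_harmonic.
Qed.

End time_singularity.

Lemma is_derive_Rintegral {R : realType} (D : set R) (f df : R -> R -> R) (G : R -> R) (x : R) :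
  measurable D ->
  (forall y, (@lebesgue_measure R).-integrable D (EFin \o f y)) ->
  (forall y z, D z -> is_derive y (1:R) (f ^~ z) (df y z)) ->
  (forall z, 0 <= G z) -> (@lebesgue_measure R).-integrable D (EFin \o G) ->
  (forall y z, D z -> `|df y z| <= G z) ->
  is_derive x (1:R) (fun y => \int[@lebesgue_measure R]_(z in D) f y z)
    (\int[@lebesgue_measure R]_(z in D) df x z).
Proof.
move=> mD fi fd G0 iG dfG.
have d1 y z : D z -> partial1of2 f y z = df y z.
  by move=> Dz; rewrite partial1of2E; have [_ <-] := fd y z Dz.
have xI : `](x - 1), (x + 1)[%classic x.
  by rewrite /= in_itv/=; apply/andP; split; lra.
have intf y : `](x - 1), (x + 1)[%classic y -> (@lebesgue_measure R).-integrable D (EFin \o f y).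
  by move=> _; exact: fi.
have der y z : `](x - 1), (x + 1)[%classic y -> D z -> derivable (f ^~ z) y 1.
  by move=> _ Dz; have [] := fd y z Dz.
have Gub y z : `](x - 1), (x + 1)[%classic y -> D z -> `|partial1of2 f y z| <= G z.
  by move=> _ Dz; rewrite d1//; exact: dfG.
apply: DeriveDef.
  by apply: (derivable_under_integral _ xI intf der G0 iG Gub).
rewrite -derive1E (differentiation_under_integral _ xI intf der G0 iG Gub)//.
by apply: eq_Rintegral => z /set_mem; exact: d1.
Qed.

(** * Oscillatory integrals with cubic phase and damping *)

Section oscillatory_integrals.
Context {R : realType}.
Local Notation mu := (@lebesgue_measure R).
Variable eta : R.
Hypothesis eta_gt0 : 0 < eta.
Implicit Types (p q : {poly {poly R}}) (a y z A : R).

(** Bivariate polynomials, evaluated first at the parameter [a] and then at the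
    frequency [z]. As amplitudes they form a class that contains 1 and is
    stable under the integrations by parts below, where differentiating the damping
    brings down factors [a - 3 eta z^2]. *)
Definition ev p a z : R := (map_poly (horner_eval a) p).[z].

Lemma evD p q a z : ev (p + q) a z = ev p a z + ev q a z.
Proof. by rewrite /ev rmorphD hornerD. Qed.

Lemma evN p a z : ev (- p) a z = - ev p a z.
Proof. by rewrite /ev rmorphN hornerN. Qed.

Lemma evM p q a z : ev (p * q) a z = ev p a z * ev q a z.
Proof. by rewrite /ev rmorphM hornerM. Qed.

Lemma evX a z : ev 'X a z = z.
Proof. by rewrite /ev map_polyX hornerX. Qed.

Lemma evC (c : {poly R}) a z : ev c%:P a z = c.[a].
Proof. by rewrite /ev map_polyC hornerC. Qed.

Lemma is_derive_ev p a z : is_derive z (1:R) (ev p a) (ev p^`() a z).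
Proof. by rewrite /ev -deriv_map; apply: is_derive_eq; rewrite mulr1. Qed.

Definition damp a z : R := expR (- (eta * z ^+ 3) + a * z).
Definition phase y z : R := y * z + z ^+ 3.

(** Real part of [damp * (p + i q) * exp(i phase)]: the amplitude is kept as a pair
    of real polynomials. *)
Definition osc p q a y z : R :=
  damp a z * (ev p a z * cos (phase y z) - ev q a z * sin (phase y z)).

(** [Dre + i Dim] is the operator on amplitudes [r = p + i q] which gives the
    [z]-derivative of [damp * r * exp(i z^3)]; the linear part [y z] of the phase is
    left out, because its derivative is the factor [y] that is to be gained. *)
Definition Dre p q : {poly {poly R}} :=
  p^`() + ('X%:P - 3 * eta%:P%:P * 'X * 'X) * p - 3 * 'X * 'X * q.
Definition Dim p q : {poly {poly R}} :=
  q^`() + ('X%:P - 3 * eta%:P%:P * 'X * 'X) * q + 3 * 'X * 'X * p.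

Lemma ev3 a z : ev 3 a z = 3.
Proof. by rewrite /ev rmorph_nat -[in LHS]polyC_natr hornerC. Qed.

(** The amplitude [q - i p] is [- i (p + i q)], so that the last term is the
    contribution of the linear phase. *)
Lemma is_derive_osc p q a y z :
  is_derive z (1:R) (osc p q a y)
    (osc (Dre p q) (Dim p q) a y z - y * osc q (- p) a y z).
Proof.
rewrite /osc /damp /phase.
have h1 := is_derive_ev p a z; have h2 := is_derive_ev q a z.
apply: is_derive_eq; rewrite /GRing.scale/= /Dre /Dim.
rewrite !(evD, evM, evN, evX, evC, ev3, hornerX, hornerC).
ring.
Qed.

Lemma is_derive_osc_param p q a y z :
  is_derive y (1:R) (fun y => osc p q a y z) (osc (- (q * 'X)) (p * 'X) a y z).
Proof.
rewrite /osc /damp /phase.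
apply: is_derive_eq; rewrite /GRing.scale/=.
rewrite !(evM, evN, evX).
ring.
Qed.

Lemma poly_bounded (c : {poly R}) A : exists2 C : R, 0 <= C & forall a, 0 <= a <= A -> `|c.[a]| <= C.
Proof.
elim/poly_ind: c => [|c d [C C0 IH]].
  by exists 0 => // a _; rewrite horner0 normr0.
exists (C * `|A| + `|d|).
  by rewrite addr_ge0// mulr_ge0.
move=> a /andP[a0 aA]; rewrite hornerMXaddC.
rewrite (le_trans (ler_normD _ _))// lerD2r normrM ler_pM//.
  by apply: IH; rewrite a0.
by rewrite ger0_norm// (le_trans aA)// ler_norm.
Qed.

(** The cubic damping wins over [(a + 1) z]: [(A + 1) z - eta z^3] is bounded,
    uniformly for [a <= A]. *)
Lemma damp_le A a z : 0 <= a <= A -> 0 <= z ->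
  damp a z <= expR ((A + 1) * (1 + (A + 1) / eta)) * expR (- z).
Proof.
move=> /andP[a0 aA] z0; rewrite -expRD ler_expR.
set B := (A + 1) / eta.
have B0 : 0 < B by rewrite divr_gt0//; lra.
have AE : A + 1 = B * eta by rewrite /B divfK// gt_eqF.
have h : (A + 1) * z - eta * z ^+ 3 <= (A + 1) * (1 + B).
  rewrite AE.
  have -> : B * eta * z - eta * z ^+ 3 = eta * (z * (B - z ^+ 2)) by ring.
  have -> : B * eta * (1 + B) = eta * (B * (1 + B)) by ring.
  rewrite ler_pM2l//.
  have [zB|zB] := leP (z ^+ 2) B.
    have : z <= 1 + B by nra.
    move=> h; have : 0 <= z ^+ 2 by rewrite sqr_ge0. nra.
  by nra.
have : a * z <= A * z by rewrite ler_wpM2r.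
lra.
Qed.

Lemma powM_expRN_le (m : nat) z : 0 <= z -> z ^+ m * expR (- z) <= m`!%:R.
Proof.
move=> z0; rewrite expRN ler_pdivrMr ?expR_gt0//.
have : z ^+ m / m`!%:R <= expR z.
  case: m => [|m].
    by rewrite expr0 fact0 divr1 (le_trans _ (expR_ge1Dx z))// lerDl.
  by rewrite (le_trans _ (expR_ge1Dxn m z0))// lerDr.
by rewrite ler_pdivrMr ?ltr0n ?fact_gt0// mulrC.
Qed.

(** Every polynomial amplitude is dominated by the exponential decay of the damping,
    uniformly in [a], by induction on the polynomial; the extra power [z^m] is what
    makes the induction go through. *)
Lemma damp_ev_bounded A p (m : nat) : exists2 C : R, 0 <= C &
  forall a z, 0 <= a <= A -> 0 <= z -> z ^+ m * (damp a z * `|ev p a z|) <= C.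
Proof.
elim/poly_ind: p m => [|p c IH] m.
  by exists 0 => // a z _ _; rewrite /ev rmorph0 horner0 normr0 !mulr0.
have [C1 C10 h1] := IH m.+1.
have [C2 C20 h2] := poly_bounded c A.
set B := expR ((A + 1) * (1 + (A + 1) / eta)).
exists (C1 + C2 * (B * m`!%:R)).
  by rewrite addr_ge0// mulr_ge0// mulr_ge0// ?expR_ge0.
move=> a z aA z0.
rewrite evD evM evX evC.
have d0 : 0 <= damp a z by exact: expR_ge0.
have zm0 : 0 <= z ^+ m by exact: exprn_ge0.
apply: (@le_trans _ _ (z ^+ m * (damp a z * (`|ev p a z| * z + `|c.[a]|)))).
  rewrite ler_wpM2l// ler_wpM2l// (le_trans (ler_normD _ _))// normrM.
  by rewrite (ger0_norm z0).
have -> : z ^+ m * (damp a z * (`|ev p a z| * z + `|c.[a]|)) =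
  z ^+ m.+1 * (damp a z * `|ev p a z|) + `|c.[a]| * (z ^+ m * damp a z).
  by rewrite exprS; ring.
apply: lerD; first exact: h1.
apply: ler_pM => //; [exact: mulr_ge0|exact: h2|].
apply: (@le_trans _ _ (z ^+ m * (B * expR (- z)))).
  by rewrite ler_wpM2l//; exact: damp_le.
rewrite mulrCA ler_wpM2l ?expR_ge0//; exact: powM_expRN_le.
Qed.

Lemma damp_ev_decay A p : exists2 C : R, 0 <= C &
  forall a z, 0 <= a <= A -> 0 <= z -> damp a z * `|ev p a z| <= C * (1 + z ^+ 2)^-1.
Proof.
have [C0 C00 h0] := damp_ev_bounded A p 0.
have [C2 C20 h2] := damp_ev_bounded A p 2.
exists (C0 + C2); first exact: addr_ge0.
move=> a z aA z0.
rewrite ler_pdivlMr; last by rewrite ltr_pwDl// sqr_ge0.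
rewrite mulrDr mulr1; apply: lerD.
  by have := h0 a z aA z0; rewrite expr0 mul1r.
by rewrite mulrC; exact: h2.
Qed.

Lemma osc_le p q a y z : `|osc p q a y z| <= damp a z * `|ev p a z| + damp a z * `|ev q a z|.
Proof.
rewrite /osc normrM ger0_norm ?expR_ge0// -mulrDr ler_wpM2l ?expR_ge0//.
rewrite (le_trans (ler_normB _ _))// lerD// normrM ler_piMr//.
  by rewrite ler_norml cos_geN1 cos_le1.
by rewrite ler_norml sin_geN1 sin_le1.
Qed.

Lemma osc_decay A p q : exists2 C : R, 0 <= C &
  forall a y z, 0 <= a <= A -> 0 <= z -> `|osc p q a y z| <= C * (1 + z ^+ 2)^-1.
Proof.
have [C1 C10 h1] := damp_ev_decay A p.
have [C2 C20 h2] := damp_ev_decay A q.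
exists (C1 + C2); first exact: addr_ge0.
move=> a y z aA z0; rewrite (le_trans (osc_le _ _ _ _ _))// mulrDl.
by apply: lerD; [exact: h1|exact: h2].
Qed.

Lemma continuous_osc p q a y : continuous (osc p q a y).
Proof.
by apply: derivable_continuous => z; have [] := is_derive_osc p q a y z.
Qed.

Lemma integrable_cauchy_right C :
  mu.-integrable `[0, +oo[ (EFin \o (fun z => C * (1 + z ^+ 2)^-1)).
Proof.
apply: (@integrableS _ _ _ _ setT) => //.
exact: integrableZl integrable_cauchy.
Qed.

Lemma integrable_osc p q a y : 0 <= a -> mu.-integrable `[0, +oo[ (EFin \o osc p q a y).
Proof.
move=> a0; have [C C0 h] := osc_decay a p q.
apply: (integrable_le _ _ _ (integrable_cauchy_right C)) => //.
  apply: measurable_funTS; apply: continuous_measurable_fun; exact: continuous_osc.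
by move=> z; rewrite /= in_itv/= andbT => z0; apply: h => //; rewrite a0 lexx.
Qed.

Definition oscint p q a y : R := \int[mu]_(z in `[0, +oo[) osc p q a y z.

Lemma oscint_bounded A p q : exists2 C : R, 0 <= C &
  forall a y, 0 <= a <= A -> `|oscint p q a y| <= C.
Proof.
have [C C0 h] := osc_decay A p q.
exists (\int[mu]_(z in `[0, +oo[) (C * (1 + z ^+ 2)^-1)).
  by apply: Rintegral_ge0 => z _; rewrite mulr_ge0// invr_ge0 addr_ge0// sqr_ge0.
move=> a y aA; apply: norm_Rintegral_le; [by []| |exact: integrable_cauchy_right].
by move=> z; rewrite /= in_itv/= andbT => z0; exact: h.
Qed.

Lemma osc_cvg0 p q a y : 0 <= a -> osc p q a y z @[z --> +oo] --> 0.
Proof.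
move=> a0; have [C C0 h] := osc_decay a p q.
apply/cvgrPdist_le => /= e e0; near=> z; rewrite sub0r normrN.
have z0 : 1 <= z by near: z; exact: nbhs_pinfty_ge.
have zC : C / e <= z by near: z; apply: nbhs_pinfty_ge; exact: num_real.
apply: (le_trans (h a y z _ _)); [by rewrite a0 lexx|by lra|].
rewrite ler_pdivrMr; last by rewrite ltr_pwDl// sqr_ge0.
rewrite ler_pdivrMr// in zC; apply: (le_trans zC); rewrite mulrC ler_wpM2l ?ltW//; nra.
Unshelve. all: by end_near. Qed.

(** One integration by parts trades a factor [y] for the operator [Dre + i Dim],
    at the price of the boundary term at frequency zero, where the damping and the
    phase factor are 1. *)
Lemma oscint_by_parts p q a y : 0 <= a ->
  y * oscint p q a y = - ev q a 0 - oscint (Dre q (- p)) (Dim q (- p)) a y.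
Proof.
move=> a0.
have d := is_derive_osc q (- p) a y.
pose f z := osc (Dre q (- p)) (Dim q (- p)) a y z - y * osc (- p) (- q) a y z.
have E z : osc (- p) (- q) a y z = - osc p q a y z.
  by rewrite /osc !evN; ring.
have i1 := @integrable_osc (Dre q (- p)) (Dim q (- p)) a y a0.
have i2 : mu.-integrable `[0, +oo[ (EFin \o (fun z => y * osc (- p) (- q) a y z)).
  exact: integrableZl (integrable_osc _ _ _ a0).
have : \int[mu]_(z in `[0, +oo[) f z = 0 - osc q (- p) a y 0.
  apply: (@FTC_right _ f (osc q (- p) a y)).
  - move=> z; apply: cvgB; first exact: continuous_osc.
    by apply: cvgMl_tmp; exact: continuous_osc.
  - by apply: (integrableB _ i1 i2).
  - exact: osc_cvg0.
rewrite /f RintegralB// RintegralZl//; last exact: integrable_osc.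
under [X in y * X]eq_Rintegral do rewrite E -mulN1r.
rewrite RintegralZl//; last exact: integrable_osc.
rewrite /osc /damp /phase !expr0n/= !mulr0 !addr0 oppr0 expR0 cos0 sin0 mulr0 subr0 mulr1 mul1r.
rewrite -/(oscint _ _ _ _) -/(oscint _ _ _ _); lra.
Qed.

Lemma oscint_mul_bounded A p q : exists2 C : R, 0 <= C &
  forall a y, 0 <= a <= A -> `|y * oscint p q a y| <= C.
Proof.
have [C1 C10 h1] := damp_ev_bounded A q 0.
have [C2 C20 h2] := oscint_bounded A (Dre q (- p)) (Dim q (- p)).
exists (C1 + C2); first exact: addr_ge0.
move=> a y aA; have /andP[a0 _] := aA.
rewrite oscint_by_parts// (le_trans (ler_normB _ _))// normrN lerD//; last exact: h2.
have := h1 a 0 aA (lexx _).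
by rewrite expr0 mul1r /damp expr0n/= !mulr0 addr0 oppr0 expR0 mul1r.
Qed.

Lemma is_derive_oscint p q a y : 0 <= a ->
  is_derive y (1:R) (oscint p q a) (oscint (- (q * 'X)) (p * 'X) a y).
Proof.
move=> a0.
have [C C0 h] := osc_decay a (- (q * 'X)) (p * 'X).
apply: (@is_derive_Rintegral _ `[0, +oo[ (fun y => osc p q a y) (fun y => osc (- (q * 'X)) (p * 'X) a y) (fun z => C * (1 + z ^+ 2)^-1)) => //.
- by move=> y'; exact: integrable_osc.
- by move=> y' z _; exact: is_derive_osc_param.
- by move=> z; rewrite mulr_ge0// invr_ge0 addr_ge0// sqr_ge0.
- exact: integrable_cauchy_right.
- by move=> y' z; rewrite /= in_itv/= andbT => z0; apply: h => //; rewrite a0 lexx.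
Qed.

(** The kernel at time [m^3], after rescaling frequencies and positions by [m], with
    [a = eta m^2] the rescaled coefficient of the growing part of the symbol. *)
Definition prof a y : R := pi^-1 * oscint 1 0 a y.
Definition dprof a y : R := pi^-1 * oscint 0 'X a y.

Lemma is_derive_prof a y : 0 <= a -> is_derive y (1:R) (prof a) (dprof a y).
Proof.
move=> a0; have := @is_derive_oscint 1 0 a y a0.
rewrite mul0r oppr0 mul1r => h.
by rewrite /prof; apply: is_derive_eq; rewrite /GRing.scale/=.
Qed.

Lemma continuous_dprof a : 0 <= a -> continuous (dprof a).
Proof.
move=> a0; apply: derivable_continuous => y.
have h := @is_derive_oscint 0 'X a y a0.
by rewrite /dprof; apply: ex_derive.
Qed.

(** Amplitude 1: the boundary term of the first integration by parts is the
    imaginary part of the amplitude at 0, which vanishes. The second one contributes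
    the slope [a] of the symbol at 0, which limits the rate to [1 / y^2]. *)
Lemma prof_decay A : exists2 C : R, 0 <= C &
  forall a y, 0 <= a <= A -> `|prof a y| <= C / (1 + y ^+ 2).
Proof.
have [C1 C10 h1] := oscint_bounded A 1 0.
have [C2 C20 h2] := oscint_mul_bounded A (Dre 0 (- 1)) (Dim 0 (- 1)).
exists (pi^-1 * (C1 + C2)).
  by rewrite mulr_ge0 ?addr_ge0// invr_ge0 pi_ge0.
move=> a y aA; have /andP[a0 _] := aA.
rewrite /prof normrM ger0_norm ?invr_ge0 ?pi_ge0// -mulrA ler_wpM2l ?invr_ge0 ?pi_ge0//.
rewrite ler_pdivlMr; last by rewrite ltr_pwDl// sqr_ge0.
rewrite mulrDr mulr1 lerD//; first exact: h1.
have := h2 a y aA.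
have E := @oscint_by_parts 1 0 a y a0; rewrite /ev rmorph0 horner0 oppr0 sub0r in E.
have -> : oscint (Dre 0 (- 1)) (Dim 0 (- 1)) a y = - (y * oscint 1 0 a y) by rewrite E opprK.
by rewrite mulrN normrN mulrA -expr2 normrM [X in X * _]ger0_norm ?sqr_ge0// mulrC.
Qed.

(** Amplitude [i z]: it vanishes at 0, so the boundary terms of the first two
    integrations by parts vanish, and a third power of [y] is gained. *)
Lemma dprof_decay A : exists2 C : R, 0 <= C &
  forall a y, 0 <= a <= A -> `|dprof a y| <= C / (1 + `|y| ^+ 3).
Proof.
(* amplitudes after one and two integrations by parts *)
pose p1 := Dre 'X (- 0); pose q1 := Dim 'X (- 0).
pose p2 := Dre q1 (- p1); pose q2 := Dim q1 (- p1).
have [C1 C10 h1] := oscint_bounded A 0 'X.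
have [C2 C20 h2] := oscint_mul_bounded A p2 q2.
exists (pi^-1 * (C1 + C2)).
  by rewrite mulr_ge0 ?addr_ge0// invr_ge0 pi_ge0.
move=> a y aA; have /andP[a0 _] := aA.
rewrite /dprof normrM ger0_norm ?invr_ge0 ?pi_ge0// -mulrA ler_wpM2l ?invr_ge0 ?pi_ge0//.
rewrite ler_pdivlMr; last by rewrite ltr_pwDl// exprn_ge0.
rewrite mulrDr mulr1 lerD//; first exact: h1.
have := h2 a y aA.
have E1 := @oscint_by_parts 0 'X a y a0; rewrite evX oppr0 sub0r -/p1 -/q1 in E1.
have q10 : ev q1 a 0 = 0.
  rewrite /q1 /Dim oppr0 !(evD, evM, evN, evX, evC, ev3, hornerX, hornerC).
  by rewrite /ev deriv0 rmorph0 horner0; ring.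
have E2 := @oscint_by_parts p1 q1 a y a0; rewrite q10 oppr0 sub0r -/p2 -/q2 in E2.
have -> : oscint p2 q2 a y = y * (y * oscint 0 'X a y).
  by rewrite E1 mulrN E2 opprK.
by rewrite !normrM mulrC; congr (_ <= _); ring.
Qed.

End oscillatory_integrals.

(** * Scaling and decay of the kernel *)

Section kernel.
Context {R : realType}.
Local Notation mu := (@lebesgue_measure R).

(** An even integrand is folded onto the half line, and the frequency is rescaled
    by [m]. *)
Lemma ge0_integral_fold_scale (g : R -> R) (m : R) : 0 < m ->
  continuous g -> (forall x, 0 <= g x) ->
  (\int[mu]_xi (g (m * `|xi|))%:E = (2 / m)%:E * \int[mu]_(z in `[0%R, +oo[) (g z)%:E)%E.
Proof.
move=> m0 cg g0.
rewrite (@ge0_symfun_integralT R (fun xi => g (m * `|xi|)))//; last 2 first.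
- move=> xi; apply: (@continuous_comp _ _ _ (fun xi : R => m * `|xi|) g); last exact: cg.
  by apply: cvgMl_tmp; apply: cvg_norm; exact: cvg_id.
- by move=> xi /=; rewrite normrN.
rewrite [X in (integral _ X _)](_ : _ = `[0, +oo[%classic); last first.
  by apply/seteqP; split => z /=; rewrite in_itv/= andbT.
have dm : derive1 (fun x : R => m * x) = cst m.
  apply/funext => x; rewrite derive1E.
  have [_ ->] : is_derive x (1:R) (fun x : R => m * x) m; last by [].
  by apply: is_derive_eq; rewrite /GRing.scale/= mulr1.
have := @increasing_ge0_integration_by_substitutiony R (fun x => m * x) g 0.
rewrite mulr0 dm => ->.
- rewrite EFinM -muleA; congr (_ * _)%E.
  have cgm : continuous (g \o (fun x => m * x)).
    move=> x; apply: continuous_comp; last exact: cg.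
    by apply: cvgMl_tmp; exact: cvg_id.
  under [in RHS]eq_integral do rewrite fctE /= EFinM.
  rewrite ge0_integralZr//; last 3 first.
  + apply/measurable_EFinP; apply: measurable_funTS; exact: continuous_measurable_fun.
  + by move=> x _; rewrite lee_fin.
  + by rewrite lee_fin ltW.
  rewrite muleC -muleA -EFinM divff ?gt_eqF// mule1.
  by apply: eq_integral => x; rewrite inE/= in_itv/= andbT => x0; rewrite ger0_norm.
- by move=> x y _ _ xy; rewrite ltr_pM2l.
- by move=> x _; exact: cst_continuous.
- exact: is_cvg_cst.
- exact: is_cvg_cst.
- split.
    by move=> x _; apply: ex_derive.
  by apply: cvg_at_right_filter; apply: cvgMl_tmp; exact: cvg_id.
- by have := @cvg_affine_pinfty R m 0 m0; under eq_fun do rewrite addr0.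
- exact: continuous_subspaceT.
- by move=> x _.
Qed.

(** Reduction of [ge0_integral_fold_scale] to positive and negative parts. *)
Lemma Rintegral_fold_scale (g : R -> R) (m : R) : 0 < m ->
  continuous g -> mu.-integrable `[0, +oo[ (EFin \o g) ->
  \int[mu]_xi g (m * `|xi|) = 2 / m * \int[mu]_(z in `[0, +oo[) g z.
Proof.
move=> m0 cg ig.
have cp : continuous (fun x => Num.max (g x) 0).
  by move=> x; apply: (@continuous_max R R g (cst 0)); [exact: cg|exact: cvg_cst].
have cn : continuous (fun x => Num.max (- g x) 0).
  move=> x; apply: (@continuous_max R R (fun x => - g x) (cst 0)); last exact: cvg_cst.
  by apply: cvgN; exact: cg.
have p0 x : 0 <= Num.max (g x) 0 by rewrite le_max lexx orbT.
have n0 x : 0 <= Num.max (- g x) 0 by rewrite le_max lexx orbT.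
have ep := ge0_integral_fold_scale m0 cp p0.
have en := ge0_integral_fold_scale m0 cn n0.
rewrite /Rintegral integralE [in RHS]integralE.
have -> : (\int[mu]_x (fun x => (g (m * `|x|))%:E)^\+ x = \int[mu]_x (Num.max (g (m * `|x|)) 0)%:E)%E.
  by apply: eq_integral => x _; rewrite funeposE -EFin_max.
have -> : (\int[mu]_x (fun x => (g (m * `|x|))%:E)^\- x = \int[mu]_x (Num.max (- g (m * `|x|)) 0)%:E)%E.
  by apply: eq_integral => x _; rewrite funenegE -EFinN -EFin_max.
have fp := integrable_pos_fin_num _ ig.
have fn := integrable_neg_fin_num _ ig.
have Ep : (\int[mu]_(x in `[0%R, +oo[) (fun x => (g x)%:E)^\+ x = \int[mu]_(x in `[0%R, +oo[) (Num.max (g x) 0)%:E)%E.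
  by apply: eq_integral => x _; rewrite funeposE -EFin_max.
have En : (\int[mu]_(x in `[0%R, +oo[) (fun x => (g x)%:E)^\- x = \int[mu]_(x in `[0%R, +oo[) (Num.max (- g x) 0)%:E)%E.
  by apply: eq_integral => x _; rewrite funenegE -EFinN -EFin_max.
rewrite ep en Ep En.
have {}fp : (\int[mu]_(x in `[0%R, +oo[) (Num.max (g x) 0)%:E \is a fin_num)%E.
  by rewrite -Ep; exact: fp.
have {}fn : (\int[mu]_(x in `[0%R, +oo[) (Num.max (- g x) 0)%:E \is a fin_num)%E.
  by rewrite -En; exact: fn.
rewrite -(fineK fp) -(fineK fn) -!EFinM -!EFinB /=; ring.
Qed.

Variable eta : R.
Hypothesis eta_gt0 : 0 < eta.

Lemma K_eta_integral (t x : R) : K_eta eta t x =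
  (2 * pi)^-1 * \int[mu]_xi
   (expR (- (eta * t * (`|xi| ^+ 3 - `|xi|))) * cos (x * xi + xi ^+ 3 * t)).
Proof.
rewrite /K_eta /K_etaC /inv_fourier /cintegral /=.
rewrite [0 * Rintegral _ _ _]mul0r [LHS]subr0; congr (_ * _).
apply: eq_Rintegral => xi _ /=.
rewrite !(mul0r, mul1r, mulr0, addr0, add0r, subr0, sub0r, oppr0, expR0).
rewrite cosD; ring.
Qed.

Lemma cos_norm_phase (b t xi : R) : cos (b * `|xi| + `|xi| ^+ 3 * t) = cos (b * xi + xi ^+ 3 * t).
Proof.
have [x0|x0] := leP 0 xi; first by rewrite ger0_norm.
by rewrite ltr0_norm// -cosN; congr cos; ring.
Qed.

Lemma K_eta_prof (m x : R) : 0 < m ->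
  K_eta eta (m ^+ 3) x = m^-1 * prof eta (eta * m ^+ 2) (x / m).
Proof.
move=> m0; rewrite K_eta_integral /prof /oscint.
have a0 : 0 <= eta * m ^+ 2 by rewrite mulr_ge0 ?exprn_ge0 ?ltW.
have := @Rintegral_fold_scale (osc eta 1 0 (eta * m ^+ 2) (x / m)) m m0
  (@continuous_osc _ _ _ _ _ _) (integrable_osc eta_gt0 _ _ _ a0).
set J := (\int[mu]_(z in `[0, +oo[) _) => E.
transitivity ((2 * pi)^-1 * (2 / m * J)).
  rewrite -E; congr (_ * _); apply: eq_Rintegral => xi _.
  rewrite /osc /damp /phase /ev rmorph0 rmorph1 horner0 hornerC mul0r subr0 mul1r.
  congr (expR _ * _); first ring.
  rewrite -cos_norm_phase; congr cos.
  by field; rewrite gt_eqF.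
by move: (@pi R) (pi_gt0 R) => p p0; field; rewrite (gt_eqF p0) (gt_eqF m0).
Qed.

(** The [x]-derivative of [K_eta eta (m ^+ 3)]. *)
Definition dK_eta (m x : R) : R := m ^- 2 * dprof eta (eta * m ^+ 2) (x / m).

Lemma is_derive_K_eta (m x : R) : 0 < m ->
  is_derive x (1:R) (K_eta eta (m ^+ 3)) (dK_eta m x).
Proof.
move=> m0.
have a0 : 0 <= eta * m ^+ 2 by rewrite mulr_ge0 ?exprn_ge0 ?ltW.
rewrite (_ : K_eta eta (m ^+ 3) = fun x => m^-1 * prof eta (eta * m ^+ 2) (x / m)); last first.
  by apply/funext => y; exact: K_eta_prof.
have h1 := is_derive_prof eta_gt0 (x / m) a0.
have h2 : is_derive x (1:R) (fun x : R => x / m) m^-1.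
  by apply: is_derive_eq; rewrite /GRing.scale/=; ring.
have h3 := @is_derive1_comp _ (prof eta (eta * m ^+ 2)) (fun x : R => x / m) _ _ _ h1 h2.
rewrite /comp in h3.
apply: is_derive_eq; rewrite /GRing.scale/= /dK_eta; field; by rewrite gt_eqF.
Qed.

Lemma continuous_dK_eta (m : R) : 0 < m -> continuous (dK_eta m).
Proof.
move=> m0 x; apply: cvgMl_tmp.
have a0 : 0 <= eta * m ^+ 2 by rewrite mulr_ge0 ?exprn_ge0 ?ltW.
apply: (@continuous_comp _ _ _ (fun x : R => x / m)); last exact: continuous_dprof.
by apply: cvgMr_tmp; exact: cvg_id.
Qed.

(** The parameter of the profile stays bounded for bounded times, which makes the
    kernel bounds uniform. *)
Lemma damping_range (m M : R) : 0 < m -> m <= M -> 0 <= eta * m ^+ 2 <= eta * M ^+ 2.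
Proof.
move=> m0 mM; apply/andP; split; first by rewrite mulr_ge0 ?exprn_ge0 ?ltW.
rewrite ler_pM2l//; nra.
Qed.

Lemma K_eta_le (M : R) : exists2 C : R, 0 <= C &
  forall m x : R, 0 < m <= M -> `|K_eta eta (m ^+ 3) x| <= C * poisson m x.
Proof.
have [C C0 h] := prof_decay eta_gt0 (eta * M ^+ 2).
exists C => // m x /andP[m0 mM].
have aA := damping_range m0 mM.
rewrite K_eta_prof// normrM gtr0_norm ?invr_gt0//.
apply: (@le_trans _ _ (m^-1 * (C / (1 + (x / m) ^+ 2)))).
  by rewrite ler_wpM2l ?invr_ge0 ?(ltW m0)//; exact: h.
rewrite /poisson le_eqVlt; apply/orP; left; apply/eqP.
have := poisson_den_gt0 x m0 => d0.
by field; rewrite !gt_eqF.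
Qed.

Lemma dK_eta_le (M : R) : exists2 C : R, 0 <= C &
  forall m x : R, 0 < m <= M ->
    `|dK_eta m x| <= C * m^-1 * poisson m x /\ `|dK_eta m x| * `|x| ^+ 3 <= C * m.
Proof.
have [C C0 h] := dprof_decay eta_gt0 (eta * M ^+ 2).
exists (2 * C); first by rewrite mulr_ge0.
move=> m x /andP[m0 mM].
have aA := damping_range m0 mM.
have {h}h : `|dK_eta m x| <= m ^- 2 * (C / (1 + (`|x| / m) ^+ 3)).
  rewrite /dK_eta normrM gtr0_norm ?invr_gt0 ?exprn_gt0//.
  rewrite ler_wpM2l ?invr_ge0 ?exprn_ge0 ?(ltW m0)//.
  by have := h _ (x / m) aA; rewrite [`|x / m|]normrM normfV (gtr0_norm m0).
have w0 : 0 <= `|x| / m by rewrite divr_ge0// ltW.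
split.
  apply: (le_trans h).
  have -> : 2 * C * m^-1 * poisson m x = m ^- 2 * (C * (2 / (1 + (`|x| / m) ^+ 2))).
    rewrite /poisson -(real_normK (num_real x)).
    have := poisson_den_gt0 `|x| m0 => d0.
    by field; rewrite !gt_eqF.
  rewrite ler_wpM2l ?invr_ge0 ?exprn_ge0 ?(ltW m0)// ler_wpM2l//.
  set w := `|x| / m in w0 *.
  rewrite -[leLHS]mul1r ler_pdivlMr; last by rewrite ltr_pwDl// sqr_ge0.
  rewrite mulrAC ler_pdivrMr; last by rewrite ltr_pwDl// exprn_ge0.
  rewrite mul1r.
  have [w1|w1] := leP w 1; nra.
set w := `|x| / m in w0 h.
have -> : `|x| = w * m by rewrite /w divfK// gt_eqF.
apply: (@le_trans _ _ (m ^- 2 * (C / (1 + w ^+ 3)) * (w * m) ^+ 3)).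
  by rewrite ler_wpM2r// exprn_ge0// mulr_ge0// ltW.
have w3 : 0 <= w ^+ 3 by exact: exprn_ge0.
have -> : m ^- 2 * (C / (1 + w ^+ 3)) * (w * m) ^+ 3 = C * m * (w ^+ 3 / (1 + w ^+ 3)).
  by field; rewrite !gt_eqF// ltr_pwDl.
rewrite (_ : 2 * C * m = C * m * 2); last by ring.
rewrite ler_wpM2l ?mulr_ge0 ?(ltW m0)// ler_pdivrMr ?ltr_pwDl//; lra.
Qed.

End kernel.

(** * The Poisson kernel as a Fourier transform *)

Section fourier_poisson.
Context {R : realType}.
Local Notation mu := (@lebesgue_measure R).
Implicit Types (f g : R -> R) (l x y z xi : R).

(** The Abel summation factor. *)
Definition expabs l xi : R := expR (- (l * `|xi|)).

Lemma continuous_expabs l : continuous (expabs l).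
Proof.
move=> xi; apply: (@continuous_comp _ _ _ (fun xi : R => - (l * `|xi|)) expR).
  by apply: cvgN; apply: cvgMl_tmp; apply: cvg_norm; exact: cvg_id.
exact: continuous_expR.
Qed.

Lemma expabs_ge0 l xi : 0 <= expabs l xi. Proof. exact: expR_ge0. Qed.

Lemma expabs_le1 l xi : 0 <= l -> expabs l xi <= 1.
Proof. by move=> l0; rewrite -expR0 ler_expR oppr_le0 mulr_ge0. Qed.

Lemma continuous_cosM z : continuous (fun xi : R => cos (z * xi)).
Proof. by apply: derivable_continuous => xi; apply: ex_derive. Qed.

Lemma continuous_sinM z : continuous (fun xi : R => sin (z * xi)).
Proof. by apply: derivable_continuous => xi; apply: ex_derive. Qed.

Lemma cvg_expR_scale l : 0 < l -> expR (- (l * z)) @[z --> +oo] --> (0:R).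
Proof.
move=> l0; apply: (cvg_comp (fun z : R => l * z) (fun w : R => expR (- w)) _ (@cvgr_expR R)).
by have := @cvg_affine_pinfty R l 0 l0; under eq_fun do rewrite addr0.
Qed.

Lemma norm_cos_le1 x : `|cos x| <= 1 :> R.
Proof. by rewrite ler_norml cos_geN1 cos_le1. Qed.

Lemma norm_sin_le1 x : `|sin x| <= 1 :> R.
Proof. by rewrite ler_norml sin_geN1 sin_le1. Qed.

(** [F] in the proof is the real part of the primitive of [exp((- l + i z) xi)]. *)
Lemma laplace_cos l z : 0 < l ->
  mu.-integrable `[0, +oo[ (EFin \o (fun xi => expR (- (l * xi)) * cos (z * xi))) /\
  \int[mu]_(xi in `[0, +oo[) (expR (- (l * xi)) * cos (z * xi)) = poisson l z.
Proof.
move=> l0.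
have cf : continuous (fun xi : R => expR (- (l * xi)) * cos (z * xi)).
  by apply: derivable_continuous => xi; apply: ex_derive.
have i0 : mu.-integrable `[0, +oo[ (EFin \o (fun xi => expR (- (l * xi)))).
  have := @ge0_FTC_right R (fun xi => expR (- (l * xi))) (fun xi => - (expR (- (l * xi)) / l)) 0 (- (0 / l)).
  case => //.
  - by apply: derivable_continuous => xi; apply: ex_derive.
  - by move=> xi; apply: is_derive_eq; rewrite /GRing.scale/=; field; rewrite gt_eqF.
  - by apply: cvgN; apply: cvgMr_tmp; exact: cvg_expR_scale.
have fi : mu.-integrable `[0, +oo[ (EFin \o (fun xi => expR (- (l * xi)) * cos (z * xi))).
  apply: (integrable_le _ _ _ i0) => //.
    by apply: measurable_funTS; exact: continuous_measurable_fun.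
  by move=> xi _; rewrite normrM ger0_norm ?expR_ge0// ler_piMr ?expR_ge0 ?norm_cos_le1.
split => //.
have d0 := poisson_den_gt0 z l0.
pose F xi := expR (- (l * xi)) * (z * sin (z * xi) - l * cos (z * xi)) / (l ^+ 2 + z ^+ 2).
have dF xi : is_derive xi (1:R) F (expR (- (l * xi)) * cos (z * xi)).
  by apply: is_derive_eq; rewrite /GRing.scale/=; field; rewrite gt_eqF.
have F0 : F xi @[xi --> +oo] --> (0:R); last first.
  rewrite (FTC_right cf fi dF F0) /F.
  by rewrite !mulr0 oppr0 expR0 sin0 cos0 /poisson; field; rewrite gt_eqF.
- apply/cvgrPdist_le => /= e e0.
  have /cvgrPdist_le/(_ ((l ^+ 2 + z ^+ 2) / (`|z| + l) * e)) := cvg_expR_scale l0.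
  have zl : 0 < `|z| + l by rewrite ltr_wpDl.
  move=> /(_ _)[]; first by rewrite mulr_gt0// divr_gt0.
  move=> M [Mr HM]; exists M; split => // xi Mxi.
  have := HM xi Mxi; rewrite /= !sub0r !normrN ger0_norm ?expR_ge0// => h.
  rewrite !normrM (ger0_norm (expR_ge0 _)) normfV (gtr0_norm d0) ler_pdivrMr//.
  have h2 : `|z * sin (z * xi) - l * cos (z * xi)| <= `|z| + l.
    rewrite (le_trans (ler_normB _ _))// !normrM lerD//.
      by rewrite ler_piMr// norm_sin_le1.
    by rewrite (gtr0_norm l0) ler_piMr ?norm_cos_le1// ltW.
  apply: (le_trans (ler_wpM2l (expR_ge0 _) h2)).
  apply: (le_trans (ler_wpM2r (ltW zl) h)).
  by rewrite mulrAC divfK ?gt_eqF// mulrC.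
Qed.

Lemma integral_expabs_cos l z : 0 < l ->
  \int[mu]_xi (expabs l xi * cos (z * xi)) = 2 * poisson l z.
Proof.
move=> l0; have [fi fE] := laplace_cos z l0.
have := @Rintegral_fold_scale R (fun xi => expR (- (l * xi)) * cos (z * xi)) 1 ltr01 _ fi.
rewrite fE divr1 => <-.
  apply: eq_Rintegral => xi _; rewrite /expabs mul1r; congr (_ * _).
  have [x0|x0] := leP 0 xi; first by rewrite ger0_norm.
  by rewrite ltr0_norm// mulrN cosN.
by apply: derivable_continuous => xi; apply: ex_derive.
Qed.

Lemma expabs_le_cauchy l xi : 0 < l -> expabs l xi <= (1 + 2 / l ^+ 2) * (1 + xi ^+ 2)^-1.
Proof.
move=> l0; rewrite ler_pdivlMr; last by rewrite ltr_pwDl// sqr_ge0.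
have := @powM_expRN_le R 2 (l * `|xi|) (mulr_ge0 (ltW l0) (normr_ge0 _)).
rewrite -/(expabs l xi) exprMn real_normK ?num_real// => h.
have e1 := expabs_le1 xi (ltW l0).
rewrite mulrDr mulr1 lerD// ler_pdivlMr ?exprn_gt0//.
by apply: le_trans h; rewrite le_eqVlt; apply/orP; left; apply/eqP; ring.
Qed.

Lemma integrable_expabs l : 0 < l -> mu.-integrable setT (EFin \o expabs l).
Proof.
move=> l0; apply: (@integrable_le _ _ _ (fun xi => (1 + 2 / l ^+ 2) * (1 + xi ^+ 2)^-1)) => //.
- by apply: continuous_measurable_fun; exact: continuous_expabs.
- by move=> xi _; rewrite ger0_norm ?expabs_ge0//; exact: expabs_le_cauchy.
- exact: integrableZl integrable_cauchy.
Qed.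

Lemma integrable_mul_bounded g (w : R -> R) : mu.-integrable setT (EFin \o g) -> measurable_fun setT w ->
  (forall x, `|w x| <= 1) -> mu.-integrable setT (EFin \o (fun x => g x * w x)).
Proof.
move=> gi mw w1.
have mg : measurable_fun setT g by apply/measurable_EFinP; exact: measurable_int gi.
apply: (@integrable_le _ _ _ (fun x => `|g x|)) => //.
- exact: measurable_funM.
- by move=> x _; rewrite normrM ler_piMr.
- exact: integrable_norm.
Qed.

(** Fubini: inserting the factor [expabs l] in the inversion integral turns it into
    a convolution with its Fourier transform, the Poisson kernel. The sum of
    products of cosines and sines is the real part of
    [exp(i x xi) * int g(y) exp(- i y xi) dy]. *)
Lemma fourier_poisson g l x : 0 < l -> mu.-integrable setT (EFin \o g) ->
  \int[mu]_xi (expabs l xi *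
     ((\int[mu]_y (g y * cos (y * xi))) * cos (x * xi) +
      (\int[mu]_y (g y * sin (y * xi))) * sin (x * xi))) =
  \int[mu]_y (g y * (2 * poisson l (x - y))).
Proof.
move=> l0 gi.
have mg : measurable_fun setT g by apply/measurable_EFinP; exact: measurable_int gi.
have me : measurable_fun setT (expabs l) by apply: continuous_measurable_fun; exact: continuous_expabs.
pose F (p : R * R) : R := g p.1 * (expabs l p.2 * cos ((x - p.1) * p.2)).
have mF : measurable_fun setT F.
  apply: measurable_funM; first exact: measurableT_comp.
  apply: measurable_funM; first exact: measurableT_comp.
  apply: measurableT_comp; first by apply: continuous_measurable_fun; exact: continuous_cos.
  apply: measurable_funM => //.
  by apply: measurable_funB.
have iF : (mu \x mu)%E.-integrable setT (EFin \o F).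
  apply/integrable12ltyP; first exact/measurable_EFinP.
  apply: (@le_lt_trans _ _ (\int[mu]_y (`|g y|%:E * (\int[mu]_xi (expabs l xi)%:E)))%E).
    apply: le_integral_nonmeasurable => y _; first exact: integral_ge0.
    rewrite -ge0_integralZl//; last 2 first.
    - by apply/measurable_EFinP.
    - by move=> xi _; rewrite lee_fin expabs_ge0.
    apply: le_integral_nonmeasurable => xi _ //.
    rewrite /= lee_fin /F/= !normrM ler_wpM2l// ger0_norm ?expabs_ge0//.
    by rewrite ler_piMr ?expabs_ge0 ?norm_cos_le1.
  have ei := integrable_expabs l0.
  rewrite -[(\int[mu]_xi (expabs l xi)%:E)%E]fineK; last exact: (integrable_fin_num _ ei).
  under eq_integral do rewrite -EFinM.
  apply: integrable_lty => //.
  under eq_fun do rewrite EFinM.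
  apply: integrableZr => //.
  exact: integrable_norm.
have ei := integrable_expabs l0.
have E1 y : (\int[mu]_xi (F (y, xi))%:E = (g y * (2 * poisson l (x - y)))%:E)%E.
  have i1 : mu.-integrable setT (EFin \o (fun xi => expabs l xi * cos ((x - y) * xi))).
    apply: integrable_mul_bounded => //; last by move=> xi; exact: norm_cos_le1.
    by apply: continuous_measurable_fun; exact: continuous_cosM.
  have i2 : mu.-integrable setT (EFin \o (fun xi => g y * (expabs l xi * cos ((x - y) * xi)))).
    exact: integrableZl i1.
  rewrite -[LHS]fineK; last exact: (integrable_fin_num _ i2).
  congr EFin; rewrite -integral_expabs_cos// -RintegralZl//.
have E2 xi : (\int[mu]_y (F (y, xi))%:E = (expabs l xi *
     ((\int[mu]_y (g y * cos (y * xi))) * cos (x * xi) +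
      (\int[mu]_y (g y * sin (y * xi))) * sin (x * xi)))%:E)%E.
  have i1 : mu.-integrable setT (EFin \o (fun y => g y * cos (y * xi))).
    apply: integrable_mul_bounded => //; last by move=> y; exact: norm_cos_le1.
    by apply: continuous_measurable_fun => //; apply: derivable_continuous => y; apply: ex_derive.
  have i2 : mu.-integrable setT (EFin \o (fun y => g y * sin (y * xi))).
    apply: integrable_mul_bounded => //; last by move=> y; exact: norm_sin_le1.
    by apply: continuous_measurable_fun => //; apply: derivable_continuous => y; apply: ex_derive.
  have i3 : mu.-integrable setT (EFin \o (fun y => (expabs l xi * cos (x * xi)) * (g y * cos (y * xi)))).
    exact: integrableZl i1.
  have i4 : mu.-integrable setT (EFin \o (fun y => (expabs l xi * sin (x * xi)) * (g y * sin (y * xi)))).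
    exact: integrableZl i2.
  have FE y : F (y, xi) = (expabs l xi * cos (x * xi)) * (g y * cos (y * xi)) +
      (expabs l xi * sin (x * xi)) * (g y * sin (y * xi)).
    by rewrite /F /= mulrBl cosB; ring.
  under eq_integral do rewrite FE.
  have i5 := integrableD measurableT i3 i4.
  rewrite -[LHS]fineK; last exact: (integrable_fin_num _ i5).
  congr EFin.
  transitivity (\int[mu]_y ((expabs l xi * cos (x * xi)) * (g y * cos (y * xi)) +
      (expabs l xi * sin (x * xi)) * (g y * sin (y * xi)))); first by [].
  rewrite RintegralD// RintegralZl// RintegralZl//; ring.
congr fine.
transitivity (\int[mu]_xi \int[mu]_y (EFin \o F) (y, xi))%E.
  by apply: eq_integral => xi _; rewrite -E2.
rewrite -(Fubini iF); apply: eq_integral => y _; exact: E1.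
Qed.

End fourier_poisson.

(** * Abel summation of the inverse Fourier transform *)

Section inversion.
Context {R : realType}.
Local Notation mu := (@lebesgue_measure R).
Implicit Types (f g : R -> R) (l x y z xi : R).

(** Real form of [truncation]. *)
Definition trunc f (n : nat) y : R := f y * \1_(`[- n%:R, n%:R]) y.

Lemma truncE f n : trunc f n = f \_ `[- n%:R, n%:R].
Proof.
apply/funext => y; rewrite /trunc patchE indicE.
by case: ifPn => h; rewrite ?mulr1 ?mulr0.
Qed.

Lemma integrable_trunc f n : continuous f -> mu.-integrable setT (EFin \o trunc f n).
Proof.
move=> cf; rewrite truncE -restrict_EFin.
have /integrable_mkcond := @continuous_integrable_cc R f (- n%:R) n%:R cf.
by apply.
Qed.

Lemma Rintegral_trunc f n (w : R -> R) :
  \int[mu]_y (trunc f n y * w y) = \int[mu]_(y in `[- n%:R, n%:R]) (f y * w y).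
Proof.
rewrite [RHS]Rintegral_mkcond; apply: eq_Rintegral => y _.
by rewrite truncE !patchE; case: ifPn => // _; rewrite mul0r.
Qed.

(** The transform of a compactly supported function is even differentiable, since
    its derivative only brings down the bounded factor [y]. *)
Lemma continuous_trig_transform g (M : R) : mu.-integrable setT (EFin \o g) ->
  (forall y, M < `|y| -> g y = 0) ->
  continuous (fun xi => \int[mu]_y (g y * cos (y * xi))) /\
  continuous (fun xi => \int[mu]_y (g y * sin (y * xi))).
Proof.
move=> gi gM.
have iG : mu.-integrable setT (EFin \o (fun y => `|M| * `|g y|)).
  by apply: integrable_scale => //; exact: integrable_abs.
have G0 y : 0 <= `|M| * `|g y| by rewrite mulr_ge0.
have bound y (c : R) : `|c| <= 1 -> `|g y * (y * c)| <= `|M| * `|g y|.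
  move=> c1; have [yM|/gM ->] := leP `|y| M; last by rewrite mul0r normr0 mulr0.
  rewrite normrM mulrC ler_wpM2r// normrM.
  apply: (@le_trans _ _ `|y|); first by rewrite ler_piMr.
  exact: le_trans yM (ler_norm _).
split; apply: derivable_continuous => xi.
- have [] // := @is_derive_Rintegral R setT (fun xi y => g y * cos (y * xi))
    (fun xi y => g y * (y * - sin (y * xi))) (fun y => `|M| * `|g y|) xi
    measurableT _ _ G0 iG _.
  + move=> z; apply: integrable_mul_bounded => //; last by move=> y; exact: norm_cos_le1.
    by apply: continuous_measurable_fun => //; apply: derivable_continuous => y; apply: ex_derive.
  + by move=> z y _; apply: is_derive_eq; rewrite /GRing.scale/=; ring.
  + by move=> z y _; apply: bound; rewrite normrN norm_sin_le1.
- have [] // := @is_derive_Rintegral R setT (fun xi y => g y * sin (y * xi))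
    (fun xi y => g y * (y * cos (y * xi))) (fun y => `|M| * `|g y|) xi
    measurableT _ _ G0 iG _.
  + move=> z; apply: integrable_mul_bounded => //; last by move=> y; exact: norm_sin_le1.
    by apply: continuous_measurable_fun => //; apply: derivable_continuous => y; apply: ex_derive.
  + by move=> z y _; apply: is_derive_eq; rewrite /GRing.scale/=; ring.
  + by move=> z y _; apply: bound; exact: norm_cos_le1.
Qed.

(** Cosine and sine transforms of the truncations: real part and opposite of the
    imaginary part of their Fourier integrals, see [fourier_truncationE]. *)
Definition cos_transform f n xi := \int[mu]_y (trunc f n y * cos (y * xi)).
Definition sin_transform f n xi := \int[mu]_y (trunc f n y * sin (y * xi)).

Lemma fourier_truncationE f n xi : continuous f ->
  fourier (truncation f n) xi = Complex (cos_transform f n xi) (- sin_transform f n xi).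
Proof.
move=> cf; rewrite /fourier /cintegral; congr Complex.
- apply: eq_Rintegral => y _ /=.
  rewrite !(mul0r, mul1r, mulr0, addr0, add0r, subr0, sub0r, oppr0, expR0, mulN1r) cosN -/(trunc f n y).
  by rewrite mulrC.
- have i : mu.-integrable setT (EFin \o (fun y => trunc f n y * sin (y * xi))).
    apply: integrable_mul_bounded => //; [exact: integrable_trunc| |by move=> y; exact: norm_sin_le1].
    by apply: continuous_measurable_fun => //; apply: derivable_continuous => y; apply: ex_derive.
  rewrite /sin_transform -mulN1r -RintegralZl//.
  apply: eq_Rintegral => y _ /=.
  rewrite !(mul0r, mul1r, mulr0, addr0, add0r, subr0, sub0r, oppr0, expR0, mulN1r) sinN -/(trunc f n y).
  by rewrite mulrC mulrN.
Qed.

Lemma trunc_support f n y : n%:R < `|y| -> trunc f n y = 0.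
Proof.
move=> ny; rewrite truncE patchE; case: ifPn => //.
by rewrite inE/= in_itv/= -ler_norml leNgt ny.
Qed.

Lemma continuous_cos_transform f n : continuous f -> continuous (cos_transform f n).
Proof.
move=> cf.
by have [] := continuous_trig_transform (integrable_trunc n cf) (@trunc_support f n).
Qed.

Lemma continuous_sin_transform f n : continuous f -> continuous (sin_transform f n).
Proof.
move=> cf.
by have [] := continuous_trig_transform (integrable_trunc n cf) (@trunc_support f n).
Qed.

Lemma cos_transform_le f n xi : continuous f -> `|cos_transform f n xi| <= \int[mu]_y `|trunc f n y|.
Proof.
move=> cf; apply: norm_Rintegral_le => //.
  by move=> y _; rewrite normrM ler_piMr ?norm_cos_le1.
apply: integrable_norm; exact: integrable_trunc.
Qed.

Lemma sin_transform_le f n xi : continuous f -> `|sin_transform f n xi| <= \int[mu]_y `|trunc f n y|.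
Proof.
move=> cf; apply: norm_Rintegral_le => //.
  by move=> y _; rewrite normrM ler_piMr ?norm_sin_le1.
apply: integrable_norm; exact: integrable_trunc.
Qed.

Lemma abs_Re_le_normc (p q : R) : `|p| <= Normc.normc (Complex p q).
Proof.
rewrite /= -[X in X <= _]sqrtr_sqr ler_wsqrtr// lerDl sqr_ge0//.
Qed.

Lemma abs_Im_le_normc (p q : R) : `|q| <= Normc.normc (Complex p q).
Proof.
rewrite /= -[X in X <= _]sqrtr_sqr ler_wsqrtr// lerDr sqr_ge0//.
Qed.

Lemma normc_le_add (p q : R) : Normc.normc (Complex p q) <= `|p| + `|q|.
Proof.
rewrite /= -[X in _ <= X]ger0_norm ?addr_ge0// -[X in _ <= X]sqrtr_sqr ler_wsqrtr//.
rewrite sqrrD !real_normK ?num_real// -addrA lerD2l lerDr mulrn_wge0// mulr_ge0//.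
Qed.

Lemma Lnorm2_expabs_lty l : 0 < l -> (Lnorm mu 2%:E (EFin \o expabs l) < +oo)%E.
Proof.
move=> l0; rewrite unlock /=; apply: poweR_lty.
apply: le_lt_trans (integrable_lty _ (integrable_expabs l0)) => //.
apply: le_integral_nonmeasurable => xi _; first by rewrite lee_fin powR_ge0.
rewrite /= lee_fin (ger0_norm (expabs_ge0 _ _)) powR_mulrn ?expabs_ge0// expr2.
by rewrite ler_piMr ?expabs_ge0// expabs_le1// ltW.
Qed.

Lemma measurable_normc (p q : R -> R) : measurable_fun setT p -> measurable_fun setT q ->
  measurable_fun setT (fun xi => Normc.normc (Complex (p xi) (q xi))).
Proof.
move=> mp mq /=; apply: (@measurableT_comp _ _ _ _ _ _ (@Num.sqrt R)).
  by apply: continuous_measurable_fun; exact: sqrt_continuous.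
by apply: measurable_funD; exact: measurable_funX.
Qed.

Lemma integrable_bounded_mul (w g : R -> R) : mu.-integrable setT (EFin \o g) -> measurable_fun setT w ->
  (forall x, `|w x| <= 1) -> mu.-integrable setT (EFin \o (fun x => w x * g x)).
Proof.
move=> gi mw w1; have := integrable_mul_bounded gi mw w1.
by apply: eq_integrable => // x _ /=; rewrite mulrC.
Qed.

(** The function whose L2 norm tends to 0 in [is_L2_fourier]. *)
Definition L2_error f (h : R -> R[i]) n xi : R := Normc.normc (fourier (truncation f n) xi - h xi).

Lemma L2_errorE f h n xi : continuous f ->
  L2_error f h n xi =
  Normc.normc (Complex (cos_transform f n xi - complex.Re (h xi)) (- sin_transform f n xi - complex.Im (h xi))).
Proof. by move=> cf; rewrite /L2_error fourier_truncationE//; case: (h xi). Qed.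

Lemma measurable_L2_error f h n : continuous f -> is_L2_fourier f h ->
  measurable_fun setT (L2_error f h n).
Proof.
move=> cf [ma mb _].
rewrite (_ : L2_error f h n = fun xi => Normc.normc (Complex (cos_transform f n xi - complex.Re (h xi)) (- sin_transform f n xi - complex.Im (h xi)))); last first.
  by apply/funext => xi; exact: L2_errorE.
apply: measurable_normc; apply: measurable_funB => //.
  by apply: continuous_measurable_fun; exact: continuous_cos_transform.
apply: measurableT_comp => //.
by apply: continuous_measurable_fun; exact: continuous_sin_transform.
Qed.

(** [fourier_poisson] holds for the truncations of [f]. On the left, their
    transforms tend to [h] in L2, and [expabs l] is in L2, so Hoelder's inequality
    allows the passage to the limit. On the right, the integrals over [[-n, n]]
    exhaust that of [f] against the Poisson kernel. *)
Lemma abel_inversion f (h : R -> R[i]) l x : 0 < l -> continuous f ->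
  mu.-integrable setT (EFin \o (fun y => f y * (2 * poisson l (x - y)))) ->
  is_L2_fourier f h ->
  mu.-integrable setT (EFin \o (fun xi => complex.Re (h xi))) ->
  mu.-integrable setT (EFin \o (fun xi => complex.Im (h xi))) ->
  \int[mu]_xi (expabs l xi * (complex.Re (h xi) * cos (x * xi) - complex.Im (h xi) * sin (x * xi)))
  = \int[mu]_y (f y * (2 * poisson l (x - y))).
Proof.
move=> l0 cf ifP fh ia ib; have [ma mb hcvg] := fh.
set a := fun xi => complex.Re (h xi) in ma ia *; set b := fun xi => complex.Im (h xi) in mb ib *.
pose I n := \int[mu]_xi (expabs l xi * (cos_transform f n xi * cos (x * xi) + sin_transform f n xi * sin (x * xi))).
(* [I n] is the regularized inversion integral of the truncation of [f]; it has
   two limits *)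
have I_cvg : I n @[n --> \oo] --> \int[mu]_y (f y * (2 * poisson l (x - y))).
  rewrite (_ : I = fun n => \int[mu]_(y in `[- n%:R, n%:R]) (f y * (2 * poisson l (x - y)))).
    apply: cvg_integral_exhaust => //; [exact: nondecreasing_sym_itv|exact: bigcup_sym_itv].
  apply/funext => n; rewrite -Rintegral_trunc -fourier_poisson//; exact: integrable_trunc.
suff : I n @[n --> \oo] --> \int[mu]_xi (expabs l xi * (a xi * cos (x * xi) - b xi * sin (x * xi))).
  by move=> Ic; rewrite -(cvg_lim _ Ic)// -(cvg_lim _ I_cvg).
have me : measurable_fun setT (expabs l) by apply: continuous_measurable_fun; exact: continuous_expabs.
have mcx : measurable_fun setT (fun xi : R => cos (x * xi)) by apply: continuous_measurable_fun; exact: continuous_cosM.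
have msx : measurable_fun setT (fun xi : R => sin (x * xi)) by apply: continuous_measurable_fun; exact: continuous_sinM.
have mc n : measurable_fun setT (cos_transform f n) by apply: continuous_measurable_fun; exact: continuous_cos_transform.
have ms n : measurable_fun setT (sin_transform f n) by apply: continuous_measurable_fun; exact: continuous_sin_transform.
pose D n xi := L2_error f h n xi.
have DE n xi : D n xi = Normc.normc (Complex (cos_transform f n xi - a xi) (- sin_transform f n xi - b xi)).
  exact: L2_errorE.
have mD n : measurable_fun setT (D n) := measurable_L2_error n cf fh.
have D0 n xi : 0 <= D n xi by rewrite DE (le_trans _ (abs_Re_le_normc _ _)).
have ie := integrable_expabs l0.
pose N n := \int[mu]_y `|trunc f n y|.
have ieD n : mu.-integrable setT (EFin \o (fun xi => expabs l xi * D n xi)).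
  apply: (@integrable_le _ _ _ (fun xi => 2 * N n * expabs l xi + (`|a xi| + `|b xi|))) => //.
  - exact: measurable_funM.
  - move=> xi _; rewrite normrM (ger0_norm (expabs_ge0 _ _)) (ger0_norm (D0 _ _)).
    have h1 := normc_le_add (cos_transform f n xi - a xi) (- sin_transform f n xi - b xi).
    rewrite -DE in h1.
    have h2 := ler_normB (cos_transform f n xi) (a xi); have h3 := ler_normB (- sin_transform f n xi) (b xi).
    have h4 := cos_transform_le n xi cf; have h5 := sin_transform_le n xi cf; rewrite normrN in h3.
    have e1 := expabs_le1 xi (ltW l0); have e0 := expabs_ge0 l xi.
    rewrite -/(N n) in h4 h5.
    apply: (@le_trans _ _ (expabs l xi * (2 * N n + (`|a xi| + `|b xi|)))).
      by rewrite ler_wpM2l//; lra.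
    rewrite mulrDr; apply: lerD; first by rewrite mulrC.
    by rewrite ler_piMl ?addr_ge0.
  - apply: integrable_add => //; first exact: integrable_scale.
    by apply: integrable_add => //; exact: integrable_abs.
have iI : mu.-integrable setT (EFin \o (fun xi => expabs l xi * (a xi * cos (x * xi) - b xi * sin (x * xi)))).
  apply: integrable_bounded_mul => //; last by move=> xi; rewrite ger0_norm ?expabs_ge0 ?expabs_le1// ltW.
  apply: integrable_sub => //; apply: integrable_mul_bounded => // xi; [exact: norm_cos_le1|exact: norm_sin_le1].
have iIn n : mu.-integrable setT (EFin \o (fun xi => expabs l xi * (cos_transform f n xi * cos (x * xi) + sin_transform f n xi * sin (x * xi)))).
  apply: (@integrable_le _ _ _ (fun xi => 2 * N n * expabs l xi)) => //; last exact: integrable_scale.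
  - apply: measurable_funM => //; apply: measurable_funD; exact: measurable_funM.
  - move=> xi _; rewrite normrM ger0_norm ?expabs_ge0// mulrC ler_wpM2r ?expabs_ge0//.
    rewrite (le_trans (ler_normD _ _))// !normrM mulrDl mul1r lerD//.
      by rewrite (le_trans _ (cos_transform_le n xi cf))// ler_piMr// norm_cos_le1.
    by rewrite (le_trans _ (sin_transform_le n xi cf))// ler_piMr// norm_sin_le1.
have ID n : `|I n - \int[mu]_xi (expabs l xi * (a xi * cos (x * xi) - b xi * sin (x * xi)))| <= 2 * \int[mu]_xi (expabs l xi * D n xi).
  rewrite /I -RintegralB// -RintegralZl//.
  apply: norm_Rintegral_le => //; last exact: integrable_scale.
  move=> xi _; rewrite -mulrBr normrM ger0_norm ?expabs_ge0// mulrCA ler_wpM2l ?expabs_ge0//.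
  have -> : cos_transform f n xi * cos (x * xi) + sin_transform f n xi * sin (x * xi) - (a xi * cos (x * xi) - b xi * sin (x * xi)) =
    (cos_transform f n xi - a xi) * cos (x * xi) - (- sin_transform f n xi - b xi) * sin (x * xi) by ring.
  rewrite (le_trans (ler_normB _ _))// !normrM mulrDl mul1r lerD// DE.
    by rewrite (le_trans _ (abs_Re_le_normc _ _))// ler_piMr// norm_cos_le1.
  by rewrite (le_trans _ (abs_Im_le_normc _ _))// ler_piMr// norm_sin_le1.
have EDcvg : (\int[mu]_xi (expabs l xi * D n xi)%:E)%E @[n --> \oo] --> 0%E.
  have e2fin : Lnorm mu 2%:E (EFin \o expabs l) \is a fin_num.
    by rewrite ge0_fin_numE ?Lnorm_ge0//; exact: Lnorm2_expabs_lty.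
  have := cvgeZl e2fin hcvg; rewrite mule0 => hc.
  apply: (squeeze_cvge _ (cvg_cst 0%E) hc); apply: nearW => n; apply/andP; split.
    by apply: integral_ge0 => xi _; rewrite lee_fin mulr_ge0 ?expabs_ge0.
  have := @hoelder _ _ _ mu (expabs l) (D n) 2 2 me (mD n).
  rewrite ltr0n => /(_ isT isT).
  have -> : 2^-1 + 2^-1 = 1 :> R by lra.
  move=> /(_ erefl); rewrite Lnorm1.
  by under eq_integral do rewrite /= ger0_norm ?mulr_ge0 ?expabs_ge0//.
have Ecvg : 2 * \int[mu]_xi (expabs l xi * D n xi) @[n --> \oo] --> (0:R).
  rewrite -[X in _ --> X](mulr0 2); apply: cvgMl_tmp.
  exact: fine_cvg EDcvg.
apply/subr_cvg0; apply/norm_cvg0P; apply: (squeeze_cvgr _ (cvg_cst 0) Ecvg).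
by apply: nearW => n; rewrite normr_ge0 ID.
Qed.

End inversion.

(** * Fourier inversion in L2 *)

Section sobolev.
Context {R : realType}.
Local Notation mu := (@lebesgue_measure R).
Implicit Types (f g : R -> R) (l x y z xi : R).

Lemma poisson_le_inv l z : 0 < l -> poisson l z <= l^-1.
Proof.
move=> l0; rewrite /poisson ler_pdivrMr ?poisson_den_gt0// mulrDr expr2 mulrA mulVf ?gt_eqF// mul1r.
by rewrite lerDl mulr_ge0 ?sqr_ge0// invr_ge0 ltW.
Qed.

(** Young's inequality [|f| P <= f^2 + P^2], and [P^2 <= P / l]. *)
Lemma integrable_l2_poisson f l x : 0 < l -> continuous f ->
  mu.-integrable setT (EFin \o (fun y => f y ^+ 2)) ->
  mu.-integrable setT (EFin \o (fun y => f y * poisson l (x - y))).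
Proof.
move=> l0 cf f2.
apply: (@integrable_le _ _ _ (fun y => f y ^+ 2 + l^-1 * poisson l (x - y))) => //.
- apply: continuous_measurable_fun => y; apply: cvgM; first exact: cf.
  exact: continuous_poisson.
- move=> y _; rewrite normrM.
  have P0 := poisson_ge0 (x - y) (ltW l0); have Pl := poisson_le_inv (x - y) l0.
  rewrite (ger0_norm P0) -(real_normK (num_real (f y))).
  have h : poisson l (x - y) ^+ 2 <= l^-1 * poisson l (x - y) by rewrite expr2 ler_wpM2r.
  have : 0 <= (`|f y| - poisson l (x - y)) ^+ 2 by exact: sqr_ge0.
  have : 0 <= `|f y| * poisson l (x - y) by rewrite mulr_ge0.
  by rewrite sqrrB; lra.
- by apply: integrable_add => //; apply: integrable_scale => //; exact: integrable_poisson.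
Qed.

(** Away from the origin the Poisson kernel of height [l] is [O(l)] times that of
    height 1, so that its tail is integrable and vanishes with [l]. *)
Lemma poisson_le_tail l (d : R) z : 0 < l -> 0 < d <= 1 -> d <= `|z| ->
  poisson l z <= l * (2 / d ^+ 2) * poisson 1 z.
Proof.
move=> l0 /andP[d0 d1] dz.
have dz2 : d ^+ 2 <= z ^+ 2 by rewrite -(real_normK (num_real z)); nra.
have z2 : 0 < z ^+ 2 by rewrite (lt_le_trans _ dz2)// exprn_gt0.
rewrite /poisson expr1n div1r -!mulrA ler_pM2l//.
apply: (@le_trans _ _ (z ^+ 2)^-1).
  by rewrite lef_pV2 ?posrE ?poisson_den_gt0// lerDr sqr_ge0.
have d2 : 0 < d ^+ 2 by rewrite exprn_gt0.
have d21 : d ^+ 2 <= 1 by nra.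
move: (d ^+ 2) (z ^+ 2) dz2 z2 d2 d21 => D Z DZ Z0 D0 D1.
have Z1 : 0 < 1 + Z by lra.
have -> : 2 * (D^-1 / (1 + Z)) = 2 / (D * (1 + Z)) by field; rewrite !gt_eqF.
rewrite -[leLHS]mul1r ler_pdivrMr// mulrAC ler_pdivlMr; last by rewrite mulr_gt0.
nra.
Qed.

(** Approximate identity: near [x] continuity controls [f - f x], and the rest
    is [O(l)] by [poisson_le_tail]. *)
Lemma poisson_approx_identity f x : continuous f ->
  mu.-integrable setT (EFin \o (fun y => f y ^+ 2)) ->
  \int[mu]_y (f y * poisson (harmonic k) (x - y)) @[k --> \oo] --> f x * pi.
Proof.
move=> cf f2.
have h0 k : 0 < harmonic k :> R by rewrite /= invr_gt0.
apply/cvgrPdist_le => /= e e0.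
have /cvgrPdist_lt/(_ (e / 2 / pi)) := cf x.
have e2 : 0 < e / 2 / pi by rewrite divr_gt0 ?pi_gt0 ?divr_gt0.
move=> /(_ e2)[d0 d00 hd0].
pose d := Num.min d0 1.
have d01 : 0 < d <= 1 by rewrite lt_min d00 ltr01/= ge_min lexx orbT.
have hd y : `|x - y| < d -> `|f x - f y| < e / 2 / pi.
  by move=> xy; apply: hd0; rewrite /ball_/= (lt_le_trans xy)// ge_min lexx.
(* majorant of the far part, up to the factor [l]; integrable as [f] is in L2 *)
pose G y := (`|f y| + `|f x|) * poisson 1 (x - y).
have iG : mu.-integrable setT (EFin \o G).
  have i1 := integrable_abs measurableT (integrable_l2_poisson x (@ltr01 R) cf f2).
  have i2 := integrable_scale `|f x| measurableT (integrable_poisson x (@ltr01 R)).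
  apply: eq_integrable (integrable_add measurableT i1 i2) => // y _ /=.
  by rewrite normrM (ger0_norm (poisson_ge0 _ ler01)) /G mulrDl.
pose C := 2 / d ^+ 2 * \int[mu]_y G y.
near=> k.
set l : R := k.+1%:R^-1.
have l0 : 0 < l := h0 k.
have P0 y := poisson_ge0 (x - y) (ltW l0).
have iP := integrable_poisson x l0.
have ifP := integrable_l2_poisson x l0 cf f2.
have -> : f x * pi = \int[mu]_y (f x * poisson l (x - y)).
  by rewrite RintegralZl// integral_poisson.
have icP := integrable_scale (f x) measurableT iP.
rewrite -RintegralB//.
apply: (@le_trans _ _ (\int[mu]_y (e / 2 / pi * poisson l (x - y) + l * (2 / d ^+ 2) * G y))).
  apply: norm_Rintegral_le => //; last first.
    by apply: integrable_add => //; exact: integrable_scale.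
  move=> y _; rewrite -mulrBl normrM (ger0_norm (P0 y)).
  have G0 : 0 <= G y by rewrite mulr_ge0 ?addr_ge0 ?poisson_ge0.
  have [xyd|dxy] := ltP `|x - y| d.
    rewrite -[leLHS]addr0 lerD//.
      by rewrite ler_wpM2r// ltW// hd.
    rewrite mulr_ge0// mulr_ge0 ?(ltW l0)// divr_ge0// exprn_ge0//.
    by have /andP[/ltW] := d01.
  rewrite -[leLHS]add0r lerD//; first by rewrite mulr_ge0// ltW.
  have := poisson_le_tail l0 d01 dxy => h.
  apply: (@le_trans _ _ ((`|f y| + `|f x|) * (l * (2 / d ^+ 2) * poisson 1 (x - y)))).
    by apply: ler_pM => //; rewrite [leRHS]addrC ler_normB.
  by rewrite /G le_eqVlt; apply/orP; left; apply/eqP; ring.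
rewrite RintegralD//; [|exact: integrable_scale|exact: integrable_scale].
rewrite (RintegralZl _ measurableT iP) (RintegralZl _ measurableT iG) integral_poisson//.
rewrite divfK ?gt_eqF ?pi_gt0//.
have : l * C <= e / 2.
  have : l * `|C| <= e / 2.
    rewrite mulrC ler_pdivrMr; last exact: ltr0Sn.
    rewrite -ler_pdivrMl ?divr_gt0//.
    have : (e / 2)^-1 * `|C| <= k%:R by near: k; apply: nbhs_infty_ger.
    by move=> /le_trans; apply; rewrite ler_nat.
  by apply: le_trans; rewrite ler_wpM2l ?(ltW l0)// ler_norm.
by rewrite /C mulrA => h; lra.
Unshelve. all: by end_near. Qed.

(** [abel_inversion] with [l] tending to 0: the Poisson means of [f] tend to its
    values by continuity, and the Abel factor disappears by dominated convergence
    since [h] is integrable. *)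
Lemma L2_fourier_inversion f (h : R -> R[i]) x : continuous f ->
  mu.-integrable setT (EFin \o (fun y => f y ^+ 2)) ->
  is_L2_fourier f h ->
  mu.-integrable setT (EFin \o (fun xi => complex.Re (h xi))) ->
  mu.-integrable setT (EFin \o (fun xi => complex.Im (h xi))) ->
  2 * pi * f x = \int[mu]_xi (complex.Re (h xi) * cos (x * xi) - complex.Im (h xi) * sin (x * xi)).
Proof.
move=> cf f2 fh ia ib.
have h0 k : 0 < harmonic k :> R by rewrite /= invr_gt0.
set a := fun xi => complex.Re (h xi) in ia *; set b := fun xi => complex.Im (h xi) in ib *.
pose w xi := a xi * cos (x * xi) - b xi * sin (x * xi).
have mcx : measurable_fun setT (fun xi : R => cos (x * xi)) by apply: continuous_measurable_fun; exact: continuous_cosM.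
have msx : measurable_fun setT (fun xi : R => sin (x * xi)) by apply: continuous_measurable_fun; exact: continuous_sinM.
have iw : mu.-integrable setT (EFin \o w).
  by apply: integrable_sub => //; apply: integrable_mul_bounded => // xi; [exact: norm_cos_le1|exact: norm_sin_le1].
have mw : measurable_fun setT w by apply/measurable_EFinP; exact: measurable_int iw.
have E k : \int[mu]_xi (expabs (harmonic k) xi * w xi) = 2 * \int[mu]_y (f y * poisson (harmonic k) (x - y)).
  have ifP := integrable_l2_poisson x (h0 k) cf f2.
  have E y : f y * (2 * poisson (harmonic k) (x - y)) = 2 * (f y * poisson (harmonic k) (x - y)) by rewrite mulrCA.
  rewrite /w (abel_inversion (h0 k) cf _ fh ia ib).
    by rewrite -RintegralZl//; apply: eq_Rintegral => y _; rewrite E.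
  by apply: eq_integrable (integrable_scale 2 measurableT ifP) => // y _ /=; rewrite -E.
have c1 : \int[mu]_xi (expabs (harmonic k) xi * w xi) @[k --> \oo] --> 2 * pi * f x.
  under eq_fun do rewrite E.
  rewrite -mulrA [pi * _]mulrC; apply: cvgMl_tmp.
  exact: poisson_approx_identity.
suff c2 : \int[mu]_xi (expabs (harmonic k) xi * w xi) @[k --> \oo] --> \int[mu]_xi w xi.
  by rewrite -(cvg_lim _ c1)// -(cvg_lim _ c2).
apply: fine_cvg; rewrite fineK; last exact: (integrable_fin_num _ iw).
have me k : measurable_fun setT (expabs (harmonic k) : R -> R) by apply: continuous_measurable_fun; exact: continuous_expabs.
have [] // := @dominated_convergence _ _ _ mu setT measurableT
  (fun k xi => (expabs (harmonic k) xi * w xi)%:E) (EFin \o w) (EFin \o (fun xi => `|w xi|)).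
- by move=> k; apply/measurable_EFinP; apply: measurable_funM; [exact: me|exact: mw].
- exact/measurable_EFinP.
- apply: aeW => xi _; apply: cvg_EFin; first exact: nearW.
  rewrite -[X in _ --> X]mul1r; apply: cvgMr_tmp.
  have c0 : - (harmonic k * `|xi|) @[k --> \oo] --> (0:R).
    rewrite -[X in _ --> X]oppr0; apply: cvgN; rewrite -[X in _ --> X](mul0r `|xi|).
    by apply: cvgMr_tmp; exact: cvg_harmonic.
  rewrite -(@expR0 R); exact: (cvg_comp _ _ c0 (@continuous_expR R 0)).
- exact: integrable_abs.
- apply: aeW => xi k _; rewrite /= lee_fin normrM ger0_norm ?expabs_ge0// ler_piMl//.
  by rewrite expabs_le1// ltW.
Qed.

End sobolev.

(** * Sobolev embedding above 3/2 *)

Section sobolev_embedding.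
Context {R : realType}.
Local Notation mu := (@lebesgue_measure R).
Implicit Types (f g : R -> R) (l x y z xi s : R).

Lemma Lnorm2_integrable (F : R -> R) : measurable_fun setT F ->
  (Lnorm mu 2%:E (EFin \o F) < +oo)%E ->
  mu.-integrable setT (EFin \o (fun x => F x ^+ 2)).
Proof.
move=> mF Ffin.
have : F \in Lfun mu 2%:E.
  by rewrite inE; apply/andP; split; rewrite inE.
have r1 : 1 <= 2 :> R by lra.
move=> /(Lfun_integrable r1); apply: eq_integrable => // x _ /=.
by rewrite powR_mulrn// real_normK ?num_real.
Qed.

Lemma Lnorm2_le1 (F : R -> R) : measurable_fun setT F ->
  (Lnorm mu 2%:E (EFin \o F) <= 1)%E -> \int[mu]_x (F x ^+ 2) <= 1.
Proof.
move=> mF F1.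
have Ffin : (Lnorm mu 2%:E (EFin \o F) < +oo)%E by rewrite (le_lt_trans F1)// ltry.
have iF := Lnorm2_integrable mF Ffin.
have := @poweR_Lnorm _ _ _ mu (EFin \o F) 2.
rewrite pnatr_eq0 => /(_ isT) H.
rewrite -lee_fin fineK; last exact: (integrable_fin_num _ iF).
have -> : (\int[mu]_x (F x ^+ 2)%:E = \int[mu]_x `|(EFin \o F) x| `^ 2)%E.
  by apply: eq_integral => x _ /=; rewrite powR_mulrn// real_normK ?num_real.
have e1 : (1%:E `^ 2 = 1 :> \bar R)%E by rewrite poweR_EFin powR1.
rewrite -H -e1.
have in1 (w : \bar R) : (0 <= w)%E -> w \in `[0%E, +oo%E] by move=> w0; rewrite in_itv/= w0 leey.
by apply: gt0_ler_poweR => //; apply: in1 => //; exact: Lnorm_ge0.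
Qed.

(** Up to a constant, [(1 + |xi|)^2 / (1 + xi^2)^s]: the square of the factor that
    separates [(1 + |xi|) |h|] from [(1 + xi^2)^(s/2) |h|]. It is integrable exactly
    when [2 s - 2 > 1]. *)
Definition sobolev_weight s xi : R := 2 `^ s * (1 + `|xi|) `^ (- (2 * s - 2)).

Lemma integrable_sobolev_weight s : 3 / 2 < s ->
  mu.-integrable setT (EFin \o sobolev_weight s).
Proof.
move=> s32; apply: integrable_scale => //; apply: integrable_tail; lra.
Qed.

(** The inequality [u b <= u^2 + b^2] with [u = (1 + xi^2)^(s/2) r] and
    [b = (1 + |xi|) / (1 + xi^2)^(s/2)], used in place of the Cauchy-Schwarz
    inequality. *)
Lemma sobolev_weight_le s xi (r : R) : 0 <= s ->
  (1 + `|xi|) * r <= ((1 + xi ^+ 2) `^ (s / 2) * r) ^+ 2 + sobolev_weight s xi.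
Proof.
move=> s0.
set A := (1 + xi ^+ 2) `^ (s / 2).
have x0 : 0 < 1 + xi ^+ 2 by rewrite ltr_pwDl// sqr_ge0.
have A0 : 0 < A by rewrite powR_gt0.
have u0 : 0 < 1 + `|xi| by rewrite ltr_pwDl.
set b := (1 + `|xi|) / A.
have -> : (1 + `|xi|) * r = A * r * b by rewrite /b; field; rewrite gt_eqF.
have : b ^+ 2 <= sobolev_weight s xi.
  rewrite /b expr_div_n ler_pdivrMr ?exprn_gt0//.
  have -> : A ^+ 2 = (1 + xi ^+ 2) `^ s.
    by rewrite /A -powR_mulrn ?powR_ge0// -powRrM divfK.
  rewrite /sobolev_weight powRN mulrAC -powRM ?(ltW x0)//.
  rewrite ler_pdivlMr ?powR_gt0//.
  rewrite -(powR_mulrn 2 (ltW u0)) -powRD; last by rewrite (gt_eqF u0) implybT.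
  have -> : 2 + (2 * s - 2) = 2 * s by ring.
  rewrite powRrM; apply: ge0_ler_powR => //; rewrite ?nnegrE ?powR_ge0//.
    by rewrite mulr_ge0// ltW.
  rewrite powR_mulrn ?(ltW u0)// -(real_normK (num_real xi)).
  have : 0 <= (1 - `|xi|) ^+ 2 by exact: sqr_ge0.
  lra.
have : 0 <= (A * r - b) ^+ 2 by exact: sqr_ge0.
have : 0 <= (A * r + b) ^+ 2 by exact: sqr_ge0.
rewrite sqrrB sqrrD; lra.
Qed.

Lemma continuous_Rintegral (D : set R) (f : R -> R -> R) (G : R -> R) :
  measurable D ->
  (forall y, mu.-integrable D (EFin \o f y)) ->
  (forall z, D z -> continuous (f ^~ z)) ->
  mu.-integrable D (EFin \o G) ->
  (forall y z, D z -> `|f y z| <= G z) ->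
  continuous (fun y => \int[mu]_(z in D) f y z).
Proof.
move=> mD fi fc iG fG x.
have := @continuity_under_integral R _ _ mu f D _ (x - 1) (x + 1) _ _ G iG.
move=> /(_ mD (fun y _ => fi y)).
have h1 : \forall y \ae mu, D y -> {in `](x - 1), (x + 1)[%classic, continuous (f ^~ y)}.
  by apply: aeW => z Dz y _; exact: fc.
have h2 y : `](x - 1), (x + 1)[%classic y -> \forall z \ae mu, D z -> `|f y z| <= G z.
  by move=> _; apply: aeW => z; exact: fG.
move=> /(_ h1 h2); apply.
by rewrite inE/= in_itv/=; apply/andP; split; lra.
Qed.

(** The function whose L2 norm is [Hs_norm s f]. *)
Definition fourier_weighted s f xi : R :=
  (1 + xi ^+ 2) `^ (s / 2) * Normc.normc (L2_fourier f xi).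

(** Integrable majorant of [(1 + |xi|) |h|], where [h] is the transform of [f]. *)
Definition sobolev_bound s f xi : R := fourier_weighted s f xi ^+ 2 + sobolev_weight s xi.

Section embedding.
Variables (s : R) (f : R -> R).
Hypotheses (s32 : 3 / 2 < s) (cf : continuous f) (Hf : Hs s f).

Let h := L2_fourier f.

(** [L2_fourier] is a choice of a transform, and one exists for functions of [Hs]. *)
Lemma L2_fourierP : is_L2_fourier f h.
Proof. by case: Hf => _ [h' fh'] _; exact: (xgetI _ fh'). Qed.

Let ma : measurable_fun setT (fun xi => complex.Re (h xi)).
Proof. by case: L2_fourierP. Qed.

Let mb : measurable_fun setT (fun xi => complex.Im (h xi)).
Proof. by case: L2_fourierP. Qed.

Lemma measurable_fourier_weighted : measurable_fun setT (fourier_weighted s f).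
Proof.
apply: measurable_funM.
  apply: (@measurableT_comp _ _ _ _ _ _ (fun w : R => w `^ (s / 2))); first exact: measurable_powR.
  by apply: measurable_funD => //; exact: measurable_funX.
have := measurable_normc ma mb.
rewrite (_ : (fun xi => Normc.normc (complex.Re (h xi) +i* complex.Im (h xi))%C) = fun xi => Normc.normc (L2_fourier f xi))//.
by apply/funext => xi; rewrite /h; case: (L2_fourier f xi).
Qed.

Lemma integrable_sobolev_bound : mu.-integrable setT (EFin \o sobolev_bound s f).
Proof.
apply: integrable_add => //; last exact: integrable_sobolev_weight.
apply: Lnorm2_integrable; first exact: measurable_fourier_weighted.
by case: Hf.
Qed.

Let s0 : 0 <= s.
Proof. by apply/ltW/(lt_trans _ s32); rewrite divr_gt0. Qed.

Lemma fourier_Re_le xi : (1 + `|xi|) * `|complex.Re (h xi)| <= sobolev_bound s f xi.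
Proof.
apply: (le_trans _ (sobolev_weight_le xi (Normc.normc (h xi)) s0)).
rewrite ler_wpM2l ?addr_ge0//.
by case: (h xi) => a b; exact: (abs_Re_le_normc a b).
Qed.

Lemma fourier_Im_le xi : (1 + `|xi|) * `|complex.Im (h xi)| <= sobolev_bound s f xi.
Proof.
apply: (le_trans _ (sobolev_weight_le xi (Normc.normc (h xi)) s0)).
rewrite ler_wpM2l ?addr_ge0//.
by case: (h xi) => a b; exact: (abs_Im_le_normc a b).
Qed.

Let Re_le xi : `|complex.Re (h xi)| <= sobolev_bound s f xi.
Proof.
by apply: le_trans (fourier_Re_le xi); rewrite mulrDl mul1r lerDl mulr_ge0.
Qed.

Let Im_le xi : `|complex.Im (h xi)| <= sobolev_bound s f xi.
Proof.
by apply: le_trans (fourier_Im_le xi); rewrite mulrDl mul1r lerDl mulr_ge0.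
Qed.

Let xiRe_le xi : `|xi * complex.Re (h xi)| <= sobolev_bound s f xi.
Proof.
by apply: le_trans (fourier_Re_le xi); rewrite normrM mulrDl mul1r lerDr.
Qed.

Let xiIm_le xi : `|xi * complex.Im (h xi)| <= sobolev_bound s f xi.
Proof.
by apply: le_trans (fourier_Im_le xi); rewrite normrM mulrDl mul1r lerDr.
Qed.

Let isb := integrable_sobolev_bound.

Let ia : mu.-integrable setT (EFin \o (fun xi => complex.Re (h xi))).
Proof. by apply: (integrable_le _ _ _ isb). Qed.

Let ib : mu.-integrable setT (EFin \o (fun xi => complex.Im (h xi))).
Proof. by apply: (integrable_le _ _ _ isb). Qed.

Lemma Hs_integrable_sqr : mu.-integrable setT (EFin \o (fun y => f y ^+ 2)).
Proof.
case: Hf => + _ _; rewrite inE => /andP[/[!inE] mf fin].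
exact: Lnorm2_integrable.
Qed.

(** Real part of [h(xi) exp(i x xi)], and its derivative in [x]. *)
Definition inv_integrand x xi :=
  complex.Re (h xi) * cos (x * xi) - complex.Im (h xi) * sin (x * xi).
Definition inv_dintegrand x xi :=
  - (xi * complex.Re (h xi)) * sin (x * xi) - (xi * complex.Im (h xi)) * cos (x * xi).

Lemma Hs_inversion x : f x = (2 * pi)^-1 * \int[mu]_xi inv_integrand x xi.
Proof.
rewrite /inv_integrand -(L2_fourier_inversion x cf Hs_integrable_sqr L2_fourierP ia ib).
by rewrite mulKf// gt_eqF// mulr_gt0// pi_gt0.
Qed.

Let inv_le x xi : `|inv_integrand x xi| <= 2 * sobolev_bound s f xi.
Proof.
rewrite (le_trans (ler_normB _ _))// !normrM mulrDl mul1r lerD//.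
  by rewrite (le_trans _ (Re_le xi))// ler_piMr// norm_cos_le1.
by rewrite (le_trans _ (Im_le xi))// ler_piMr// norm_sin_le1.
Qed.

Let dinv_le x xi : `|inv_dintegrand x xi| <= 2 * sobolev_bound s f xi.
Proof.
rewrite (le_trans (ler_normB _ _))// normrM normrN [X in _ + X]normrM mulrDl mul1r lerD//.
  by rewrite (le_trans _ (xiRe_le xi))// ler_piMr// norm_sin_le1.
by rewrite (le_trans _ (xiIm_le xi))// ler_piMr// norm_cos_le1.
Qed.

Let i2sb := integrable_scale 2 measurableT isb.

Let mcx x : measurable_fun setT (fun xi : R => cos (x * xi)).
Proof. by apply: continuous_measurable_fun; exact: continuous_cosM. Qed.

Let msx x : measurable_fun setT (fun xi : R => sin (x * xi)).
Proof. by apply: continuous_measurable_fun; exact: continuous_sinM. Qed.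

Let iinv x : mu.-integrable setT (EFin \o inv_integrand x).
Proof.
apply: (integrable_le _ _ _ i2sb) => //.
by apply: measurable_funB; exact: measurable_funM.
Qed.

Let idinv x : mu.-integrable setT (EFin \o inv_dintegrand x).
Proof.
apply: (integrable_le _ _ _ i2sb) => //.
apply: measurable_funB; apply: measurable_funM => //.
  by apply: measurableT_comp => //; exact: measurable_funM.
exact: measurable_funM.
Qed.

Lemma Hs_sup_bound x : `|f x| <= \int[mu]_xi (2 * sobolev_bound s f xi).
Proof.
rewrite Hs_inversion normrM.
apply: (@le_trans _ _ (1 * `|\int[mu]_xi inv_integrand x xi|)).
  rewrite ler_wpM2r// ger0_norm ?invr_ge0 ?mulr_ge0 ?pi_ge0//.
  rewrite invf_le1 ?mulr_gt0 ?pi_gt0//.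
  have := @pi_ge2 R; lra.
rewrite mul1r; exact: norm_Rintegral_le.
Qed.

(** Differentiation under the inversion integral: one factor [xi] is absorbed by
    [sobolev_bound]. *)
Lemma Hs_C1 : exists df : R -> R,
  [/\ forall x, is_derive x (1:R) f (df x), continuous df &
      exists M : R, forall x, `|df x| <= M].
Proof.
pose df x := (2 * pi)^-1 * \int[mu]_xi inv_dintegrand x xi.
have G0 xi : 0 <= 2 * sobolev_bound s f xi.
  exact: le_trans (normr_ge0 _) (inv_le 0 xi).
exists df; split.
- move=> x.
  rewrite (_ : f = fun x => (2 * pi)^-1 * \int[mu]_xi inv_integrand x xi); last first.
    by apply/funext => y; exact: Hs_inversion.
  have H : is_derive x (1:R) (fun x => \int[mu]_xi inv_integrand x xi) (\int[mu]_xi inv_dintegrand x xi).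
    apply: (@is_derive_Rintegral R setT inv_integrand inv_dintegrand
      (fun xi => 2 * sobolev_bound s f xi) x measurableT iinv _ G0 i2sb) => //.
    by move=> y xi _; rewrite /inv_integrand /inv_dintegrand; apply: is_derive_eq; rewrite /GRing.scale/=; ring.
  by apply: is_derive_eq; rewrite /GRing.scale/= /df; ring.
- move=> x; apply: cvgMl_tmp.
  apply: (@continuous_Rintegral setT inv_dintegrand
    (fun xi => 2 * sobolev_bound s f xi) measurableT idinv _ i2sb) => //.
  move=> xi _; apply: derivable_continuous => y; rewrite /inv_dintegrand; exact: ex_derive.
- exists ((2 * pi)^-1 * \int[mu]_xi (2 * sobolev_bound s f xi)) => x.
  rewrite normrM ger0_norm ?invr_ge0 ?mulr_ge0 ?pi_ge0// ler_wpM2l ?invr_ge0 ?mulr_ge0 ?pi_ge0//.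
  exact: norm_Rintegral_le.
Qed.

End embedding.
End sobolev_embedding.

(** * Boundedness on compact time intervals *)

Section time_continuity.
Context {R : realType}.
Local Notation mu := (@lebesgue_measure R).
Implicit Types (f g : R -> R) (s t x y xi : R).

Lemma le_Lnorm2 (F G : R -> R) : (forall x, `|F x| <= `|G x|) ->
  (Lnorm mu 2%:E (EFin \o F) <= Lnorm mu 2%:E (EFin \o G))%E.
Proof.
move=> FG; rewrite unlock /=.
have in1 (w : \bar R) : (0 <= w)%E -> w \in `[0%E, +oo%E] by move=> w0; rewrite in_itv/= w0 leey.
apply: gt0_ler_poweR; rewrite ?invr_ge0//.
- by apply: in1; apply: integral_ge0 => x _; rewrite lee_fin powR_ge0.
- by apply: in1; apply: integral_ge0 => x _; rewrite lee_fin powR_ge0.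
apply: le_integral_nonmeasurable => x _; first by rewrite lee_fin powR_ge0.
by rewrite /= lee_fin ge0_ler_powR// nnegrE.
Qed.

Lemma cos_transformB f g n xi : continuous f -> continuous g ->
  cos_transform (f \- g) n xi = cos_transform f n xi - cos_transform g n xi.
Proof.
move=> cf cg.
have i h : continuous h -> mu.-integrable setT (EFin \o (fun y => trunc h n y * cos (y * xi))).
  move=> ch; apply: integrable_mul_bounded => //; [exact: integrable_trunc| |by move=> y; exact: norm_cos_le1].
  by apply: continuous_measurable_fun => //; apply: derivable_continuous => y; apply: ex_derive.
rewrite /cos_transform -RintegralB//; [|exact: i|exact: i].
by apply: eq_Rintegral => y _; rewrite /trunc /=; ring.
Qed.

Lemma sin_transformB f g n xi : continuous f -> continuous g ->
  sin_transform (f \- g) n xi = sin_transform f n xi - sin_transform g n xi.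
Proof.
move=> cf cg.
have i h : continuous h -> mu.-integrable setT (EFin \o (fun y => trunc h n y * sin (y * xi))).
  move=> ch; apply: integrable_mul_bounded => //; [exact: integrable_trunc| |by move=> y; exact: norm_sin_le1].
  by apply: continuous_measurable_fun => //; apply: derivable_continuous => y; apply: ex_derive.
rewrite /sin_transform -RintegralB//; [|exact: i|exact: i].
by apply: eq_Rintegral => y _; rewrite /trunc /=; ring.
Qed.

(** By Minkowski's inequality. Continuity in time is expressed by the transform of
    a difference. *)
Lemma is_L2_fourierB f g hf hg : continuous f -> continuous g ->
  is_L2_fourier f hf -> is_L2_fourier g hg ->
  is_L2_fourier (f \- g) (fun xi => hf xi - hg xi).
Proof.
move=> cf cg fh gh.
have cfg : continuous (f \- g) by move=> y; apply: cvgB; [exact: cf|exact: cg].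
have [maf mbf cvf] := fh; have [mag mbg cvg_g] := gh.
have E (z w : R[i]) : complex.Re (z - w) = complex.Re z - complex.Re w /\
  complex.Im (z - w) = complex.Im z - complex.Im w by case: z; case: w.
split.
- rewrite (_ : (fun xi => _) = fun xi => complex.Re (hf xi) - complex.Re (hg xi)).
    exact: measurable_funB.
  by apply/funext => xi; have [-> _] := E (hf xi) (hg xi).
- rewrite (_ : (fun xi => _) = fun xi => complex.Im (hf xi) - complex.Im (hg xi)).
    exact: measurable_funB.
  by apply/funext => xi; have [_ ->] := E (hf xi) (hg xi).
have c := cvgeD (fin_num_adde_defr 0%E (isT : 0%E \is a fin_num)) cvf cvg_g.
rewrite adde0 in c.
apply: (squeeze_cvge _ (cvg_cst 0%E) (c _)); apply: nearW => n; rewrite Lnorm_ge0/=.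
apply: (@le_trans _ _ (Lnorm mu 2%:E (EFin \o (fun xi => L2_error f hf n xi + L2_error g hg n xi)))).
  apply: le_Lnorm2 => xi.
  rewrite -/(L2_error (f \- g) (fun xi => hf xi - hg xi) n xi) !L2_errorE//.
  have [-> ->] := E (hf xi) (hg xi).
  rewrite cos_transformB// sin_transformB//.
  rewrite (_ : Complex _ _ = Complex (cos_transform f n xi - complex.Re (hf xi)) (- sin_transform f n xi - complex.Im (hf xi)) -
     Complex (cos_transform g n xi - complex.Re (hg xi)) (- sin_transform g n xi - complex.Im (hg xi))); last first.
    by congr Complex; ring.
  have n0 (z : R[i]) : 0 <= Normc.normc z.
    by case: z => p q; rewrite (le_trans _ (abs_Re_le_normc p q)).
  rewrite !ger0_norm ?addr_ge0 ?n0//.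
  apply: (le_trans (le_normcD _ _)); rewrite lerD2l.
  by rewrite normcN.
by apply: minkowski_EFin; [exact: measurable_L2_error|exact: measurable_L2_error|lra].
Qed.

Lemma Lfun2B f g : f \in Lfun mu 2%:E -> g \in Lfun mu 2%:E -> (f \- g) \in Lfun mu 2%:E.
Proof.
rewrite !inE => /andP[/[!inE] mf ff] /andP[/[!inE] mg fg].
apply/andP; split; rewrite inE; first exact: measurable_funB.
rewrite /= in mf ff mg fg; rewrite /= /finite_norm in ff fg *.
pose Ng x := - g x.
have mNg : measurable_fun setT Ng by apply: measurableT_comp.
apply: (@le_lt_trans _ _ (Lnorm mu 2%:E (EFin \o f) + Lnorm mu 2%:E (EFin \o Ng))%E).
  by apply: minkowski_EFin => //; lra.
rewrite lte_add_pinfty//.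
apply: le_lt_trans fg; by apply: le_Lnorm2 => x; rewrite /Ng normrN.
Qed.

Variables (s : R) (u : R -> R -> R).
Hypotheses (s32 : 3 / 2 < s) (u_Hs : continuous_Hs s u) (uc : forall t, 0 <= t -> continuous (u t)).

(** For [t'] near [t], the difference [u t' - u t] has norm at most 1 in [H^s], hence
    a sup norm bounded in terms of [s] alone, by [Hs_sup_bound]. *)
Lemma locally_bounded t : 0 <= t -> exists C : R,
  \forall t' \near t, 0 <= t' -> forall y, `|u t' y| <= C.
Proof.
move=> t0; have [uH ucvg] := u_Hs.
exists (\int[mu]_xi (2 * sobolev_bound s (u t) xi) + 2 * (1 + \int[mu]_xi sobolev_weight s xi)).
have /fine_cvgP[fin c] := ucvg t t0.
have lt1 : \forall t' \near within [set t' | 0 <= t'] (nbhs t), fine (Hs_norm s (u t' \- u t)%R) < 1.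
  by move/cvgrPdist_lt : c => /(_ _ (@ltr01 R)); apply: filterS => t'; rewrite sub0r normrN; exact: le_lt_trans (ler_norm _).
have : \forall t' \near within [set t' | 0 <= t'] (nbhs t), (Hs_norm s (u t' \- u t)%R <= 1)%E.
  near=> t'.
  have f1 : Hs_norm s (u t' \- u t) \is a fin_num by near: t'.
  by rewrite -(fineK f1) lee_fin ltW//; near: t'.
rewrite near_withinE; apply: filterS => t' H t'0 y.
have {H} Hn1 := H t'0.
have [lt_ [ht Pt] _] := uH t t0; have [lt'_ [ht' Pt'] _] := uH t' t'0.
have cd : continuous (u t' \- u t) by move=> z; apply: cvgB; exact: uc.
have Hd : Hs s (u t' \- u t).
  split; [exact: Lfun2B| |by rewrite (le_lt_trans Hn1)// ltry].
  by exists (fun xi => ht' xi - ht xi); apply: is_L2_fourierB => //; exact: uc.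
have b1 := Hs_sup_bound s32 (uc t0) (uH t t0) y.
have b2 := Hs_sup_bound s32 cd Hd y.
have mw := measurable_fourier_weighted Hd.
have w1 := Lnorm2_le1 mw Hn1.
have iw := integrable_sobolev_weight s32.
have iq : mu.-integrable setT (EFin \o (fun xi => fourier_weighted s (u t' \- u t) xi ^+ 2)).
  by apply: Lnorm2_integrable => //; rewrite (le_lt_trans Hn1)// ltry.
have isb := integrable_sobolev_bound s32 Hd.
rewrite (RintegralZl _ measurableT isb) (RintegralD measurableT iq iw) in b2.
have -> : u t' y = u t y + (u t' \- u t) y by rewrite /=; ring.
rewrite (le_trans (ler_normD _ _))// lerD//.
apply: (le_trans b2); rewrite ler_wpM2l// lerD2r//.
Unshelve. all: by end_near. Qed.

(** Compactness of [[0, T]], from the local bounds. *)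
Lemma uniformly_bounded T : exists2 B : R, 0 <= B & forall t y, 0 <= t <= T -> `|u t y| <= B.
Proof.
have /compact_near_coveringP/near_covering_withinP := @segment_compact R 0 T.
pose P (B t : R) := forall y, `|u t y| <= B.
move=> /(_ R (pinfty_nbhs R) P _)[].
  move=> t; rewrite /= in_itv/= => /andP[t0 tT].
  have [C HC] := locally_bounded t0.
  exists ([set t' | 0 <= t' -> forall y, `|u t' y| <= C], [set B | C <= B]).
    by split => //=; apply: nbhs_pinfty_ge; exact: num_real.
  move=> [t' B] /= [h CB]; rewrite in_itv/= => /andP[t'0 _] y.
  exact: le_trans (h t'0 y) CB.
move=> M [Mr HM]; exists (`|M| + 1); first by rewrite addr_ge0.
move=> t y tT; apply: (HM (`|M| + 1)); last by rewrite /= in_itv.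
by rewrite (le_lt_trans (ler_norm _))// ltrDl.
Qed.

End time_continuity.

(** * Convolutions with the kernel *)

Section kernel_convolutions.
Context {R : realType}.
Local Notation mu := (@lebesgue_measure R).
Implicit Types (f g h : R -> R) (s t x y : R).
Variables (eta : R).
Hypothesis eta_gt0 : 0 < eta.

Lemma is_derive_K_eta_sub (m x y : R) : 0 < m ->
  is_derive y (1:R) (fun y => K_eta eta (m ^+ 3) (x - y)) (- dK_eta eta m (x - y)).
Proof.
move=> m0.
have h1 := is_derive_K_eta eta_gt0 (x - y) m0.
have h2 : is_derive y (1:R) (fun y : R => x - y) (-1).
  by apply: is_derive_eq; rewrite /GRing.scale/=; ring.
have := @is_derive1_comp _ (K_eta eta (m ^+ 3)) (fun y : R => x - y) _ _ _ h1 h2.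
by rewrite mulrN1.
Qed.

Lemma continuous_K_eta_sub (m x : R) : 0 < m ->
  continuous (fun y => K_eta eta (m ^+ 3) (x - y)).
Proof.
by move=> m0; apply: derivable_continuous => y; have [] := is_derive_K_eta_sub x y m0.
Qed.

Lemma continuous_dK_eta_sub (m x : R) : 0 < m -> continuous (fun y => dK_eta eta m (x - y)).
Proof.
move=> m0 y; apply: (@continuous_comp _ _ _ (fun y : R => x - y)).
  by apply: cvgB; [exact: cvg_cst|exact: cvg_id].
exact: continuous_dK_eta.
Qed.

Lemma cvg_poisson_sub_pinfty (m x : R) : 0 < m ->
  poisson m (x - y) @[y --> +oo] --> (0:R).
Proof.
move=> m0; apply/cvgrPdist_le => /= e e0; near=> y.
rewrite sub0r normrN ger0_norm ?poisson_ge0 ?(ltW m0)//.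
have yx : 1 <= y - x by near: y; apply: filterS (nbhs_pinfty_ge (num_real (1 + x))) => y; lra.
have ye : m / e <= y - x.
  by near: y; apply: filterS (nbhs_pinfty_ge (num_real (m / e + x))) => y; lra.
rewrite /poisson ler_pdivrMr ?poisson_den_gt0//.
move: ye; rewrite ler_pdivrMr// => ye.
have -> : (x - y) ^+ 2 = (y - x) ^+ 2 by ring.
have : (y - x) * e <= (y - x) ^+ 2 * e by rewrite ler_pM2r//; nra.
have : 0 <= m ^+ 2 * e by rewrite mulr_ge0 ?sqr_ge0 ?(ltW e0).
by rewrite mulrDr (mulrC e) (mulrC e); lra.
Unshelve. all: by end_near. Qed.

Lemma cvg_poisson_sub_ninfty (m x : R) : 0 < m ->
  poisson m (x - y) @[y --> -oo] --> (0:R).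
Proof.
move=> m0; apply/cvgNy_compNP.
have := @cvg_poisson_sub_pinfty m (- x) m0.
by apply: cvg_trans; apply: near_eq_cvg; apply: nearW => y /=; rewrite poisson_sym; congr poisson; ring.
Qed.

Lemma integrable_poisson_mul (m x : R) (k : R -> R) g (C B : R) : 0 < m -> 0 <= C ->
  continuous k -> continuous g ->
  (forall y, `|k y| <= C * poisson m (x - y)) -> (forall y, `|g y| <= B) ->
  mu.-integrable setT (EFin \o (fun y => k y * g y)).
Proof.
move=> m0 C0 ck cg kC gB.
apply: (@integrable_le R _ _ (fun y => C * B * poisson m (x - y))) => //.
- by apply: continuous_measurable_fun => y; apply: cvgM; [exact: ck|exact: cg].
- move=> y _; rewrite normrM mulrAC; apply: ler_pM => //.
- by apply: integrable_scale => //; exact: integrable_poisson.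
Qed.

(** Integration by parts: the boundary terms vanish because the kernel does at
    infinity and [g] is bounded. *)
Lemma convolution_derive (m x : R) (g dg : R -> R) (B : R) : 0 < m ->
  (forall y, is_derive y (1:R) g (dg y)) -> continuous dg ->
  (forall y, `|g y| <= B) -> (forall y, `|dg y| <= B) ->
  convolution (K_eta eta (m ^+ 3)) (derive1 g) x = \int[mu]_y (dK_eta eta m (x - y) * g y).
Proof.
move=> m0 g_dg cdg gB dgB.
have [C C0 KC] := K_eta_le eta_gt0 m.
have [C' C'0 dKC] := dK_eta_le eta_gt0 m.
have mm : 0 < m <= m by rewrite m0 lexx.
have cg : continuous g by apply: derivable_continuous => y; have [] := g_dg y.
have i1 : mu.-integrable setT (EFin \o (fun y => K_eta eta (m ^+ 3) (x - y) * dg y)).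
  apply: (@integrable_poisson_mul m x _ _ C B) => //; first exact: continuous_K_eta_sub.
  by move=> y; exact: KC.
have i2 : mu.-integrable setT (EFin \o (fun y => dK_eta eta m (x - y) * g y)).
  apply: (@integrable_poisson_mul m x _ _ (C' * m^-1) B) => //.
  - by rewrite mulr_ge0// invr_ge0 (ltW m0).
  - exact: continuous_dK_eta_sub.
  - by move=> y; exact: (dKC _ _ mm).1.
apply/eqP; rewrite -subr_eq0 /convolution; apply/eqP.
rewrite (_ : \int[mu]_y (K_eta eta (m ^+ 3) (x - y) * derive1 g y) =
   \int[mu]_y (K_eta eta (m ^+ 3) (x - y) * dg y)); last first.
  by apply: eq_Rintegral => y _; rewrite derive1E; have [_ ->] := g_dg y.
rewrite -RintegralB//.
rewrite -[RHS](subrr 0).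
have lim0 (F : set_system R) : Filter F -> poisson m (x - y) @[y --> F] --> (0:R) ->
    K_eta eta (m ^+ 3) (x - y) * g y @[y --> F] --> (0:R).
  move=> FF pl; apply/norm_cvg0P.
  apply: (@squeeze_cvgr _ _ _ _ (fun=> 0) (fun y => C * B * poisson m (x - y))).
  - apply: nearW => y; rewrite normr_ge0/= normrM mulrAC; apply: ler_pM => //; exact: KC.
  - exact: cvg_cst.
  - by rewrite -[X in _ --> X](mulr0 (C * B)); exact: cvgMl_tmp.
apply: (@FTC_R R _ (fun y => K_eta eta (m ^+ 3) (x - y) * g y)).
- move=> y; apply: cvgB; apply: cvgM; [exact: continuous_K_eta_sub|exact: cdg|exact: continuous_dK_eta_sub|exact: cg].
- exact: integrable_sub.
- move=> y; have hk := is_derive_K_eta_sub x y m0.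
  by have hg := g_dg y; apply: is_derive_eq; rewrite /GRing.scale/=; ring.
- by apply: lim0; exact: cvg_poisson_sub_pinfty.
- by apply: lim0; exact: cvg_poisson_sub_ninfty.
Qed.

(** Far from the origin [g] is small and the kernel has mass at most [pi a]; near the
    origin the kernel is small and [g] has mass at most [int h]. *)
Lemma kernel_split (k g h : R -> R) (l x r a b S : R) : 0 < l -> 0 <= a -> 0 <= b ->
  0 <= S -> (forall y, `|k y| <= a * poisson l (x - y)) ->
  (forall y, `|y| < r -> `|k y| <= b) ->
  (forall y, r <= `|y| -> `|g y| <= S) -> (forall y, `|y| < r -> `|g y| <= h y) ->
  (forall y, 0 <= h y) -> mu.-integrable setT (EFin \o h) ->
  `|\int[mu]_y (k y * g y)| <= a * S * pi + b * \int[mu]_y h y.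
Proof.
move=> l0 a0 b0 S0 ka kb gS gh h0 ih.
have ip := integrable_scale (a * S) measurableT (integrable_poisson x l0).
have ibh := integrable_scale b measurableT ih.
rewrite -(integral_poisson x l0) -(RintegralZl (a * S) measurableT (integrable_poisson x l0)).
rewrite -(RintegralZl b measurableT ih) -(RintegralD measurableT ip ibh).
apply: norm_Rintegral_le => //; last exact: integrable_add.
have p0 y := poisson_ge0 (x - y) (ltW l0).
move=> y _; rewrite normrM; have [ry|yr] := leP r `|y|.
  rewrite -[leLHS]addr0 lerD//; last exact: mulr_ge0.
  by rewrite mulrAC; apply: ler_pM => //; exact: gS.
rewrite -[leLHS]add0r lerD//; first exact: (mulr_ge0 (mulr_ge0 a0 S0) (p0 y)).
by apply: ler_pM => //; [exact: kb|exact: gh].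
Qed.

Lemma half_dist_le x y : `|y| < `|x| / 2 -> `|x| / 2 <= `|x - y|.
Proof. by move=> yx; have := lerB_dist x y; lra. Qed.

(** For [|y| < |x| / 2] the point [x - y] is at distance at least [|x| / 2] from 0. *)
Lemma poisson_far_le (m x y : R) : 0 < m -> x != 0 -> `|y| < `|x| / 2 ->
  poisson m (x - y) <= 4 * m * `|x| ^- 2.
Proof.
move=> m0 x0 /half_dist_le xy.
have x_gt0 : 0 < `|x| by rewrite normr_gt0.
have x2 : 0 < `|x| ^+ 2 by rewrite exprn_gt0.
rewrite /poisson -(real_normK (num_real (x - y))) ler_pdivrMr; last first.
  by rewrite ltr_pwDl ?exprn_gt0// sqr_ge0.
rewrite mulrAC ler_pdivlMr// mulrAC [leRHS]mulrC ler_pM2l//.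
have : 0 <= m ^+ 2 by exact: sqr_ge0.
nra.
Qed.

Lemma convolution_K_eta_le (M : R) : exists2 C : R, 0 <= C &
  forall (m x S : R) g h, 0 < m <= M -> x != 0 -> 0 <= S ->
  (forall y, `|x| / 2 <= `|y| -> `|g y| <= S) ->
  (forall y, `|y| < `|x| / 2 -> `|g y| <= h y) ->
  (forall y, 0 <= h y) -> mu.-integrable setT (EFin \o h) ->
  `|convolution (K_eta eta (m ^+ 3)) g x| <= C * (S + `|x| ^- 2 * \int[mu]_y h y).
Proof.
have [C C0 KC] := K_eta_le eta_gt0 M.
exists (C * (pi + 4 * `|M|)); first by rewrite mulr_ge0// addr_ge0 ?pi_ge0// mulr_ge0.
move=> m x S g h /andP[m0 mM] x0 S0 gS gh h0 ih.
have mM' : 0 < m <= M by rewrite m0.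
have nx : 0 < `|x| by rewrite normr_gt0.
have mnM : m <= `|M| by rewrite (le_trans mM)// ler_norm.
have b0 : 0 <= C * (4 * m * `|x| ^- 2).
  by rewrite !mulr_ge0 ?invr_ge0 ?exprn_ge0 ?(ltW m0).
apply: (le_trans (kernel_split (k := fun y => K_eta eta (m ^+ 3) (x - y)) m0 C0 b0 S0 _ _ gS gh h0 ih)).
- by move=> y; exact: KC.
- move=> y yx; apply: (le_trans (KC _ _ mM')); rewrite ler_wpM2l//.
  exact: poisson_far_le.
have I0 : 0 <= \int[mu]_y h y by apply: Rintegral_ge0.
set I := Rintegral _ _ _ in I0 *.
have X0 : 0 <= `|x| ^- 2 by rewrite invr_ge0 exprn_ge0.
set X := _ ^- 2 in X0 *.
rewrite -!mulrA -mulrDr ler_wpM2l//.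
have : m * (X * I) <= `|M| * (X * I) by rewrite ler_wpM2r// mulr_ge0.
have : 0 <= pi * (X * I) by rewrite mulr_ge0 ?pi_ge0// mulr_ge0.
have : 0 <= `|M| * S by rewrite mulr_ge0.
by rewrite mulrDr !mulrDl; lra.
Qed.

Lemma convolution_dK_eta_le (M : R) : exists2 C : R, 0 <= C &
  forall (m x S : R) g h, 0 < m <= M -> x != 0 -> 0 <= S ->
  (forall y, `|x| / 2 <= `|y| -> `|g y| <= S) ->
  (forall y, `|y| < `|x| / 2 -> `|g y| <= h y) ->
  (forall y, 0 <= h y) -> mu.-integrable setT (EFin \o h) ->
  `|\int[mu]_y (dK_eta eta m (x - y) * g y)| <=
    C * (m^-1 * S + m * `|x| ^- 3 * \int[mu]_y h y).
Proof.
have [C C0 dKC] := dK_eta_le eta_gt0 M.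
exists (C * (pi + 8)); first by rewrite mulr_ge0// addr_ge0 ?pi_ge0.
move=> m x S g h /andP[m0 mM] x0 S0 gS gh h0 ih.
have mM' : 0 < m <= M by rewrite m0.
have nx : 0 < `|x| by rewrite normr_gt0.
have x3 : 0 < `|x| ^+ 3 by rewrite exprn_gt0.
have b0 : 0 <= C * (8 * m * `|x| ^- 3).
  by rewrite !mulr_ge0 ?invr_ge0 ?exprn_ge0 ?(ltW m0).
have a0 : 0 <= C * m^-1 by rewrite mulr_ge0 ?invr_ge0 ?(ltW m0).
apply: (le_trans (kernel_split (k := fun y => dK_eta eta m (x - y)) m0 a0 b0 S0 _ _ gS gh h0 ih)).
- by move=> y; exact: (dKC _ _ mM').1.
- move=> y /half_dist_le yx; have [_] := dKC _ (x - y) mM'.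
  have y3 : `|x| ^+ 3 / 8 <= `|x - y| ^+ 3.
    have -> : `|x| ^+ 3 / 8 = (`|x| / 2) ^+ 3 by field.
    by rewrite lerXn2r ?nnegrE// divr_ge0.
  move=> h1; have : `|dK_eta eta m (x - y)| * (`|x| ^+ 3 / 8) <= C * m.
    by apply: le_trans h1; rewrite ler_wpM2l.
  rewrite mulrA ler_pdivrMr// => h2.
  by rewrite 2!mulrA ler_pdivlMr// (le_trans h2)//; rewrite le_eqVlt; apply/orP; left; apply/eqP; ring.
have I0 : 0 <= \int[mu]_y h y by apply: Rintegral_ge0.
set I := Rintegral _ _ _ in I0 *.
have X0 : 0 <= `|x| ^- 3 by rewrite invr_ge0 exprn_ge0.
set X := _ ^- 3 in X0 *.
have m'0 : 0 <= m^-1 by rewrite invr_ge0 ltW.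
rewrite -!mulrA -mulrDr ler_wpM2l//.
have : 0 <= pi * (m * (X * I)) by rewrite mulr_ge0 ?pi_ge0// mulr_ge0 ?(ltW m0)// mulr_ge0.
have : 0 <= m^-1 * S by rewrite mulr_ge0.
have -> : m^-1 * (S * pi) = pi * (m^-1 * S) by ring.
have -> : (pi + 8) * (m^-1 * S + m * (X * I)) = pi * (m^-1 * S) + 8 * (m^-1 * S) +
   pi * (m * (X * I)) + 8 * (m * (X * I)) by ring.
lra.
Qed.

(** The bound is required only before the final time, where the kernel degenerates;
    that point is a null set, and the majorant can be given any value there. *)
Lemma norm_Rintegral_time_le (t : R) (f g : R -> R) : 0 < t ->
  (forall tau, 0 <= tau < t -> `|f tau| <= g tau) ->
  mu.-integrable `[0, t[ (EFin \o g) ->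
  `|\int[mu]_(tau in `[0, t]) f tau| <= \int[mu]_(tau in `[0, t[) g tau.
Proof.
move=> t0 fg ig.
(* the value of the majorant at the final time is chosen to fit [f] *)
pose G tau := if tau < t then g tau else `|f t|.
have GE tau : `[0, t[%classic tau -> G tau = g tau.
  by rewrite /= in_itv/= /G => /andP[_ ->].
have iG : mu.-integrable `[0, t[ (EFin \o G).
  by apply: eq_integrable ig => // tau /set_mem /GE /= ->.
have mG : measurable_fun `[0, t] (EFin \o G).
  apply/measurable_EFinP/measurable_fun_itv_bndo_bndcP/measurable_EFinP.
  exact: measurable_int iG.
have Dt : `[0, t]%classic `\` [set t] = `[0, t[%classic.
  apply/seteqP; split => tau /=; rewrite !in_itv/=.
    by move=> [/andP[-> tt] /eqP]; rewrite lt_neqAle tt => ->.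
  by move=> /andP[-> tt]; split; [exact: ltW|move=> E; rewrite E ltxx in tt].
have Nt : mu [set t] = 0%E by exact: lebesgue_measure_set1.
have iG' : mu.-integrable `[0, t] (EFin \o G).
  have mD : measurable (`[0, t]%classic : set R) by exact: measurable_itv.
  have [_] := @negligible_integrable _ _ R mu _ _ _ (measurable_set1 t) mD mG Nt.
  by rewrite Dt; apply.
apply: (le_trans (norm_Rintegral_le (g := G) _ _ iG')) => //.
  move=> tau; rewrite /= in_itv/= => /andP[tau0 taut]; rewrite /G; case: ltP => tt.
    by apply: fg; rewrite tau0.
  by rewrite (le_anti (introT andP (conj taut tt))).
rewrite le_eqVlt; apply/orP; left; apply/eqP.
have mD : measurable (`[0, t]%classic : set R) by exact: measurable_itv.
rewrite /Rintegral (@negligible_integral _ _ R mu _ _ (EFin \o G) (measurable_set1 t) mD iG' Nt).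
rewrite Dt; congr fine; apply: eq_integral => tau /set_mem h.
by rewrite /= GE.
Qed.

End kernel_convolutions.

(** * The Duhamel term *)

Section nonlinear_term.
Context {R : realType}.
Local Notation mu := (@lebesgue_measure R).
Implicit Types (f g h : R -> R) (t x y tau : R).

(** The case [r = 1] of [time_integral]. *)
Lemma time_const_integral t : 0 < t ->
  mu.-integrable `[0, t[ (EFin \o (fun=> 1)) /\ \int[mu]_(tau in `[0, t[) 1 = t.
Proof.
move=> t0; have [i E] := time_integral t0 (@ltr01 R); rewrite powRr1 ?(ltW t0)// divr1 in E.
have E1 tau : (t - tau) `^ (1 - 1) = 1 by rewrite subrr powRr0.
split; first by apply: eq_integrable i => // tau _ /=; rewrite E1.
by rewrite -[RHS]E; apply: eq_Rintegral => tau _; rewrite E1.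
Qed.

Lemma cube_root_gt0 x : 0 < x -> 0 < x `^ 3^-1.
Proof. exact: powR_gt0. Qed.

Lemma cube_rootK x : 0 < x -> (x `^ 3^-1) ^+ 3 = x.
Proof.
by move=> x0; rewrite -powR_mulrn ?powR_ge0// -powRrM mulVf// powRr1// (ltW x0).
Qed.

(** With [w = L m]: [w <= 1 + w^3 <= exp(w^3)]. In terms of [m^3 = t - tau], this
    makes an exponential weight of rate [L^3] gain a factor [1 / L], while the
    singularity becomes [(t - tau)^(-2/3)], still integrable. *)
Lemma inv_mul_expRN_cube (L m : R) : 0 < L -> 0 < m ->
  m^-1 * expR (- (L * m) ^+ 3) <= L^-1 * m ^- 2.
Proof.
move=> L0 m0; have w0 : 0 < L * m by rewrite mulr_gt0.
have h : L * m <= expR ((L * m) ^+ 3).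
  apply: le_trans (expR_ge1Dx _); set w := L * m in w0 *.
  by have [w1|w1] := leP w 1; nra.
rewrite expRN ler_pdivrMr ?expR_gt0// mulrC.
rewrite [leRHS](_ : _ = expR ((L * m) ^+ 3) * (L^-1 * m ^- 2)); last by ring.
apply: le_trans (ler_wpM2r _ h); last by rewrite mulr_ge0 ?invr_ge0 ?exprn_ge0 ?ltW.
by rewrite le_eqVlt; apply/orP; left; apply/eqP; field; rewrite !gt_eqF.
Qed.

Lemma cube_root_time t tau : tau < t ->
  ((t - tau) `^ 3^-1) ^- 2 = (t - tau) `^ (3^-1 - 1).
Proof.
move=> taut; have tt : 0 < t - tau by rewrite subr_gt0.
rewrite -powR_mulrn ?powR_ge0// -powRrM -powRN; congr (_ `^ _); lra.
Qed.

Variables (eta s : R) (u : R -> R -> R).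
Hypotheses (eta_gt0 : 0 < eta) (s32 : 3 / 2 < s) (u_Hs : continuous_Hs s u)
  (uc : forall t, 0 <= t -> continuous (u t)).

Lemma convolution_derive_sqr (m x t : R) : 0 < m -> 0 <= t ->
  convolution (K_eta eta (m ^+ 3)) (derive1 (fun y => u t y ^+ 2)) x =
  \int[mu]_y (dK_eta eta m (x - y) * u t y ^+ 2).
Proof.
move=> m0 t0; have [uH _] := u_Hs.
have [df [fdf cdf [M dfM]]] := Hs_C1 s32 (uc t0) (uH t t0).
have [B B0 uB] := uniformly_bounded s32 u_Hs uc t.
have uB' y : `|u t y| <= B by apply: uB; rewrite t0 lexx.
have cu := uc t0.
apply: (@convolution_derive R eta eta_gt0 m x _ (fun y => 2 * u t y * df y) (B ^+ 2 + 2 * B * M)) => //.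
- by move=> y; have h := fdf y; apply: is_derive_eq; rewrite /GRing.scale/=; ring.
- move=> y; apply: cvgM; last exact: cdf.
  by apply: cvgMl_tmp; exact: cu.
- move=> y; rewrite normrX.
  have M0 : 0 <= M by apply: le_trans (dfM y).
  have : 0 <= B * M by rewrite mulr_ge0.
  have : `|u t y| ^+ 2 <= B ^+ 2 by rewrite lerXn2r ?nnegrE.
  lra.
- move=> y; rewrite 2!normrM (ger0_norm (ler0n _ 2)) -[leLHS]add0r lerD ?sqr_ge0//.
  by rewrite -2!mulrA ler_wpM2l//; apply: ler_pM.
Qed.

(** [convolution_dK_eta_le] at each time, integrated with [inv_mul_expRN_cube]. The
    weight [exp(L^3 tau)] on the far bound is what the bootstrap for the decay needs:
    its contribution is small when [L] is large. *)
Lemma nonlinear_le (T : R) : 0 < T -> exists2 C : R, 0 <= C &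
  forall (t L x S : R) h, 0 < t <= T -> 0 < L -> x != 0 -> 0 <= S ->
  (forall tau y, 0 <= tau < t -> `|x| / 2 <= `|y| ->
     u tau y ^+ 2 <= S * expR (L ^+ 3 * tau)) ->
  (forall tau y, 0 <= tau < t -> `|y| < `|x| / 2 -> u tau y ^+ 2 <= h y) ->
  (forall y, 0 <= h y) -> mu.-integrable setT (EFin \o h) ->
  `|\int[mu]_(tau in `[0, t]) convolution (K_eta eta (t - tau))
       (derive1 (fun y => u tau y ^+ 2)) x| <=
    C * (L^-1 * expR (L ^+ 3 * t) * S + `|x| ^- 3 * \int[mu]_y h y).
Proof.
move=> T0; pose M := T `^ 3^-1.
have M0 : 0 < M by exact: cube_root_gt0.
have [C C0 HC] := convolution_dK_eta_le eta_gt0 M.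
exists (C * (3 * M + M * T)); first by rewrite mulr_ge0// addr_ge0// mulr_ge0// ltW.
move=> t L x S h /andP[t0 tT] L0 x0 S0 uS uh h0 ih.
have I0 : 0 <= \int[mu]_y h y by apply: Rintegral_ge0.
set I := \int[mu]_y h y in I0 *.
have X0 : 0 <= `|x| ^- 3 by rewrite invr_ge0 exprn_ge0.
set X := `|x| ^- 3 in X0 *.
set e := expR (L ^+ 3 * t).
have e0 : 0 < e by exact: expR_gt0.
have [i1 E1] : mu.-integrable `[0, t[ (EFin \o (fun tau : R => (t - tau) `^ (3^-1 - 1))) /\
    \int[mu]_(tau in `[0, t[) ((t - tau) `^ (3^-1 - 1)) = t `^ 3^-1 / 3^-1.
  by apply: time_integral.
have [i2 E2] := time_const_integral t0.
have mD : measurable (`[0, t[%classic : set R) by exact: measurable_itv.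
have i1' := integrable_scale (C * (L^-1 * e * S)) mD i1.
have i2' := integrable_scale (C * (M * X * I)) mD i2.
have i3 := integrable_add mD i1' i2'.
apply: (le_trans (norm_Rintegral_time_le t0 _ i3)).
  move=> tau /andP[tau0 taut].
  have tt : 0 < t - tau by rewrite subr_gt0.
  pose m := (t - tau) `^ 3^-1.
  have m0 : 0 < m by exact: cube_root_gt0.
  have mM : m <= M.
    apply: ge0_ler_powR; rewrite ?invr_ge0// ?nnegrE; [exact: ltW|exact: ltW|].
    by rewrite (le_trans _ tT)// gerBl.
  have m3 : m ^+ 3 = t - tau by exact: cube_rootK.
  rewrite -m3 convolution_derive_sqr//.
  have mM' : 0 < m <= M by rewrite m0.
  have S0' : 0 <= S * expR (L ^+ 3 * tau) by rewrite mulr_ge0 ?expR_ge0.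
  apply: (le_trans (HC m x _ (fun y => u tau y ^+ 2) h mM' x0 S0' _ _ h0 ih)).
  - by move=> y xy; rewrite ger0_norm ?sqr_ge0//; apply: uS => //; rewrite tau0.
  - by move=> y xy; rewrite ger0_norm ?sqr_ge0//; apply: uh => //; rewrite tau0.
  rewrite -/I -/X mulr1 -!(mulrA C) -mulrDr ler_wpM2l// lerD//; last first.
    by rewrite -!mulrA ler_wpM2r// mulr_ge0.
  have -> : expR (L ^+ 3 * tau) = e * expR (- (L * m) ^+ 3).
    by rewrite /e -expRD; congr expR; rewrite exprMn m3; ring.
  rewrite m3 -(cube_root_time taut) -/m.
  have := inv_mul_expRN_cube L0 m0 => hm.
  have -> : m^-1 * (S * (e * expR (- (L * m) ^+ 3))) = (m^-1 * expR (- (L * m) ^+ 3)) * (S * e) by ring.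
  have -> : L^-1 * e * S * m ^- 2 = (L^-1 * m ^- 2) * (S * e) by ring.
  by rewrite ler_wpM2r// mulr_ge0// ltW.
rewrite (RintegralD _ i1' i2'); last exact: mD.
rewrite (RintegralZl _ _ i1); last exact: mD.
rewrite (RintegralZl _ _ i2); last exact: mD.
rewrite E1 E2.
rewrite invrK.
have tM : t `^ 3^-1 <= M.
  by apply: ge0_ler_powR; rewrite ?invr_ge0// ?nnegrE; exact: ltW.
set a := t `^ 3^-1 in tM *.
have w0 : 0 <= L^-1 * e * S by rewrite !mulr_ge0 ?invr_ge0 ?(ltW L0) ?(ltW e0).
set w := L^-1 * e * S in w0 *.
have v0 : 0 <= X * I by rewrite mulr_ge0.
rewrite -!(mulrA C) -mulrDr ler_wpM2l//.
rewrite -(mulrA M).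
set v := X * I in v0 *.
have h1 : w * a <= w * M by rewrite ler_wpM2l.
have h2 : M * (v * t) <= M * (v * T) by rewrite ler_wpM2l ?(ltW M0)// ler_wpM2l.
have h3 : 0 <= M * T * w by apply: mulr_ge0 w0; exact: mulr_ge0 (ltW M0) (ltW T0).
have h4 : 0 <= M * v by rewrite mulr_ge0 ?(ltW M0).
have -> : (3 * M + M * T) * (w + v) = 3 * (w * M) + M * T * w + 3 * (M * v) + M * (v * T) by ring.
have -> : w * (a * 3) + M * v * t = 3 * (w * a) + M * (v * t) by ring.
clear -h1 h2 h3 h4; lra.
Qed.

End nonlinear_term.

(** * Spatial decay of the solution *)

Section spatial_decay.
Context {R : realType}.
Local Notation mu := (@lebesgue_measure R).
Implicit Types (f g h : R -> R) (t x y tau : R).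
Variables (eta s c : R) (u0 : R -> R) (u : R -> R -> R).
Hypotheses (eta_gt0 : 0 < eta) (s32 : 3 / 2 < s)
  (u_sol : global_solution eta s u0 u)
  (u0c : forall x, `|u0 x| <= c / (1 + x ^+ 2)).

Let u_Hs : continuous_Hs s u. Proof. by have [] := u_sol. Qed.
Let uc : forall t, 0 <= t -> continuous (u t). Proof. by have [] := u_sol. Qed.

Let c0 : 0 <= c.
Proof. by have := le_trans (normr_ge0 _) (u0c 0); rewrite expr0n/= addr0 divr1. Qed.

Lemma integrable_cauchy_scale k : mu.-integrable setT (EFin \o (fun y : R => k / (1 + y ^+ 2))).
Proof. exact: (integrable_scale k measurableT (@integrable_cauchy R)). Qed.

Lemma integral_cauchy_scale k : \int[mu]_y (k / (1 + y ^+ 2)) = k * pi.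
Proof. by rewrite (RintegralZl k measurableT (@integrable_cauchy R)) integral_cauchy. Qed.

Lemma div_1Dsqr_le_far k x y : 0 <= k -> x != 0 -> `|x| / 2 <= `|y| ->
  k / (1 + y ^+ 2) <= 4 * k * `|x| ^- 2.
Proof.
move=> k0 x0 xy; have x2 : 0 < `|x| ^+ 2 by rewrite exprn_gt0 ?normr_gt0.
rewrite ler_pdivrMr ?ltr_pwDl ?sqr_ge0//.
rewrite [leRHS](_ : _ = k * (4 * (1 + y ^+ 2) / `|x| ^+ 2)); last by field; rewrite normr_eq0.
rewrite ler_peMr// ler_pdivlMr// mul1r -(real_normK (num_real y)).
have : 0 <= `|x| by []. nra.
Qed.

(** Both [u0] and the kernel are [O(1 / y^2)]. *)
Lemma linear_decay T : exists2 A : R, 0 <= A & forall t x, 0 < t <= T -> x != 0 ->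
  `|convolution (K_eta eta t) u0 x| <= A * `|x| ^- 2.
Proof.
have [C C0 HC] := convolution_K_eta_le eta_gt0 (T `^ 3^-1).
exists (C * (4 * c + c * pi)).
  by rewrite mulr_ge0// addr_ge0// mulr_ge0 ?pi_ge0.
move=> t x /andP[t0 tT] x0.
have m0 := cube_root_gt0 t0.
have mM : 0 < t `^ 3^-1 <= T `^ 3^-1.
  rewrite m0/=; apply: ge0_ler_powR; rewrite ?invr_ge0// ?nnegrE; [exact: ltW|].
  exact: le_trans (ltW t0) tT.
rewrite -(cube_rootK t0).
apply: (le_trans (HC _ x (4 * c * `|x| ^- 2) u0 (fun y => c / (1 + y ^+ 2)) mM x0 _ _ _ _ _)).
- by rewrite !mulr_ge0 ?invr_ge0 ?exprn_ge0.
- by move=> y xy; apply: (le_trans (u0c y)); exact: div_1Dsqr_le_far.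
- by move=> y _; exact: u0c.
- by move=> y; rewrite divr_ge0// addr_ge0 ?sqr_ge0.
- exact: integrable_cauchy_scale.
by rewrite integral_cauchy_scale le_eqVlt; apply/orP; left; apply/eqP; ring.
Qed.

Lemma solution_le T : 0 < T -> exists2 C : R, 0 <= C &
  forall (t L x S : R) h, 0 < t <= T -> 0 < L -> x != 0 -> 0 <= S ->
  (forall tau y, 0 <= tau < t -> `|x| / 2 <= `|y| ->
     u tau y ^+ 2 <= S * expR (L ^+ 3 * tau)) ->
  (forall tau y, 0 <= tau < t -> `|y| < `|x| / 2 -> u tau y ^+ 2 <= h y) ->
  (forall y, 0 <= h y) -> mu.-integrable setT (EFin \o h) ->
  `|u t x - convolution (K_eta eta t) u0 x| <=
    C * (L^-1 * expR (L ^+ 3 * t) * S + `|x| ^- 3 * \int[mu]_y h y).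
Proof.
move=> T0; have [C C0 HC] := nonlinear_le eta_gt0 s32 u_Hs uc T0.
exists C => // t L x S h tT L0 x0 S0 uS uh h0 ih.
have [_ _ _ ->] := u_sol; last by case/andP : tT.
have -> : forall a b : R, a - b - a = - b by move=> a b; ring.
rewrite normrN normrM ger0_norm ?invr_ge0// -[leRHS]mul1r.
apply: ler_pM; [by rewrite invr_ge0|by []|by rewrite invf_le1// ler1n|exact: HC].
Qed.

(** Induction on [n]. For [|y| >= 2^(n+1)], the values of [u^2] beyond [|y| / 2] are
    at most [B * A exp(L^3 tau) 4^-n], with [B] a bound for [u]; the choice of [L]
    makes their contribution at most half of the new bound. The values closer to
    the origin contribute [|y|^-3 * B^2 |y|] up to a constant, and, like the
    datum, are at most a fixed multiple of [4^-(n+1)]; the choice of [A] makes these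
    at most the other half. *)
Lemma dyadic_decay T : 0 < T -> exists A L : R, [/\ 0 <= A, 0 < L &
  forall n t y, 0 <= t <= T -> 2 ^+ n <= `|y| ->
    `|u t y| <= A * expR (L ^+ 3 * t) * 4 ^- n].
Proof.
move=> T0.
have [B B0 uB] := uniformly_bounded s32 u_Hs uc T.
have [C C0 HC] := solution_le T0.
have [A0 A00 HA] := linear_decay T.
(* [4 * C * B / L <= 1 / 2] absorbs the far contribution, and half of [A] absorbs
   the others *)
pose L := 8 * (C * B) + 1.
have CB0 : 0 <= C * B by rewrite mulr_ge0.
have L0 : 0 < L by rewrite /L; lra.
have CB2 : 0 <= C * B ^+ 2 * pi by rewrite !mulr_ge0 ?sqr_ge0 ?pi_ge0.
pose A := 2 * A0 + 2 * (C * B ^+ 2 * pi) + B + c.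
have c_ge0 := c0.
have A_ge0 : 0 <= A by rewrite /A; lra.
exists A, L; split => //.
have exp1 t : 0 <= t -> 1 <= expR (L ^+ 3 * t).
  move=> t0; rewrite -expR0 ler_expR mulr_ge0// exprn_ge0// ltW//.
elim=> [|n IH] t y tT.
  move=> _; have /andP[t0 _] := tT.
  rewrite expr0 invr1 mulr1 (le_trans (uB _ _ tT))//.
  rewrite -[leLHS]mulr1; apply: ler_pM => //; last exact: exp1.
  rewrite /A; lra.
move=> yn; have /andP[t0 tT'] := tT.
have n2 : 0 < 2 ^+ n.+1 :> R by rewrite exprn_gt0.
have y_gt0 : 0 < `|y| by exact: lt_le_trans yn.
have y0 : y != 0 by rewrite -normr_gt0.
have y2 : 4 ^+ n.+1 <= `|y| ^+ 2.
  have -> : 4 ^+ n.+1 = (2 ^+ n.+1) ^+ 2 :> R.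
    by rewrite -exprM mulnC exprM; congr (_ ^+ _); ring.
  by rewrite lerXn2r ?nnegrE// ltW.
have n4 : 0 < 4 ^+ n.+1 :> R by rewrite exprn_gt0.
have y2' : `|y| ^- 2 <= 4 ^- n.+1 by rewrite lef_pV2 ?posrE// (lt_le_trans n4).
have q0 : 0 <= 4 ^- n.+1 :> R by rewrite invr_ge0 ltW.
have e1 := exp1 t t0.
set e := expR _ in e1 *.
set q := 4 ^- n.+1 in q0 y2' *.
move: t0; rewrite le_eqVlt => /predU1P[t0|t0].
  have -> : u t y = u0 y by rewrite -t0; have [_ _ -> _] := u_sol.
  apply: (le_trans (u0c y)).
  apply: (@le_trans _ _ (c * q)).
    rewrite ler_wpM2l// (le_trans _ y2')// lef_pV2 ?posrE ?exprn_gt0 ?ltr_pwDl ?sqr_ge0//.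
    by rewrite real_normK ?num_real// lerDr.
  rewrite ler_wpM2r// -[leLHS]mulr1; apply: ler_pM => //.
  by rewrite /A; lra.
have tT2 : 0 < t <= T by rewrite t0.
pose r := `|y| / 2.
have r0 : 0 < r by rewrite divr_gt0.
(* an integrable majorant of [B ^+ 2] on [|z| < r], as [2 * r * poisson r z >= 1]
   there *)
pose h z := B ^+ 2 * (2 * r) * poisson r (0 - z).
have ih : mu.-integrable setT (EFin \o h) by exact: integrable_scale (integrable_poisson 0 r0).
have Ih : \int[mu]_z h z = B ^+ 2 * `|y| * pi.
  rewrite /h (RintegralZl _ _ (integrable_poisson 0 r0))// integral_poisson//.
  by rewrite /r; field.
have HN : `|u t y - convolution (K_eta eta t) u0 y| <=
    C * (L^-1 * e * (B * (A * 4 ^- n)) + `|y| ^- 3 * \int[mu]_z h z).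
  apply: HC => //.
  - by rewrite !mulr_ge0// invr_ge0 exprn_ge0.
  - move=> tau z /andP[tau0 taut] yz.
    have tauT : 0 <= tau <= T by rewrite tau0 (le_trans (ltW taut)).
    rewrite -real_normK ?num_real// [leLHS]expr2.
    rewrite [leRHS](_ : _ = B * (A * expR (L ^+ 3 * tau) * 4 ^- n)); last by ring.
    apply: ler_pM; [by []|by []|exact: uB|apply: IH => //].
    by apply: le_trans yz; rewrite ler_pdivlMr// -exprSr.
  - move=> tau z /andP[tau0 taut] zr.
    have tauT : 0 <= tau <= T by rewrite tau0 (le_trans (ltW taut)).
    rewrite -real_normK ?num_real//.
    apply: (@le_trans _ _ (B ^+ 2)); first by rewrite lerXn2r ?nnegrE// uB.
    rewrite /h -mulrA ler_peMr ?sqr_ge0// /poisson sub0r sqrrN mulrA.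
    rewrite ler_pdivlMr ?poisson_den_gt0// mul1r -(real_normK (num_real z)).
    by have := normr_ge0 z; rewrite -/r in zr; nra.
  - move=> z; apply: mulr_ge0; last exact: (poisson_ge0 _ (ltW r0)).
    by apply: mulr_ge0; [exact: sqr_ge0|apply: mulr_ge0; [|exact: ltW]].
have := HA t y tT2 y0.
have -> : u t y = convolution (K_eta eta t) u0 y + (u t y - convolution (K_eta eta t) u0 y) by ring.
move=> Hlin; apply: (le_trans (ler_normD _ _)).
apply: (le_trans (lerD Hlin HN)); rewrite Ih.
have -> : 4 ^- n = 4 * q by rewrite /q exprS; field; rewrite expf_neq0.
have -> : `|y| ^- 3 * (B ^+ 2 * `|y| * pi) = B ^+ 2 * pi * `|y| ^- 2.
  by move: (@pi R) => p; field; rewrite normr_eq0.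
have h1 : A0 * `|y| ^- 2 <= A0 * q by rewrite ler_wpM2l.
have h2 : C * (B ^+ 2 * pi * `|y| ^- 2) <= C * B ^+ 2 * pi * q.
  rewrite [leLHS](_ : _ = C * B ^+ 2 * pi * `|y| ^- 2); last by ring.
  exact: (ler_wpM2l CB2 y2').
have h3 : C * (L^-1 * e * (B * (A * (4 * q)))) <= A * e * q / 2.
  have -> : C * (L^-1 * e * (B * (A * (4 * q)))) = (4 * (C * B) / L) * (A * e * q) by ring.
  rewrite [leRHS]mulrC ler_wpM2r//; first by rewrite !mulr_ge0// (le_trans _ e1).
  by rewrite ler_pdivrMr// /L; lra.
have h4 : A / 2 * q <= A / 2 * (e * q).
  rewrite ler_wpM2l ?divr_ge0// ler_peMl//.
rewrite mulrDr.
apply: (le_trans (lerD h1 (lerD h3 h2))).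
have h5 : (A0 + C * B ^+ 2 * pi) * q <= A / 2 * q by rewrite ler_wpM2r// /A; lra.
have fin (a p A' e' q' : R) : (a + p) * q' <= A' / 2 * q' ->
    A' / 2 * q' <= A' / 2 * (e' * q') ->
    a * q' + (A' * e' * q' / 2 + p * q') <= A' * e' * q'.
  by move=> h7 h8; lra.
exact: fin h5 h4.
Qed.

(** Every [|y| >= 1] lies between two consecutive powers of 2. *)
Lemma uniform_decay T : 0 < T -> exists2 A : R, 0 <= A &
  forall t y, 0 <= t <= T -> `|u t y| <= A / (1 + y ^+ 2).
Proof.
move=> T0.
have [B B0 uB] := uniformly_bounded s32 u_Hs uc T.
have [A [L [A0 L0 H]]] := dyadic_decay T0.
pose E := expR (L ^+ 3 * T).
have E0 : 0 <= E by exact: expR_ge0.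
exists (2 * B + 8 * (A * E)); first by rewrite addr_ge0// mulr_ge0// mulr_ge0.
move=> t y tT; have /andP[t0 tT'] := tT.
have d0 : 0 < 1 + y ^+ 2 by rewrite ltr_pwDl ?sqr_ge0.
have AE : 0 <= A * E by rewrite mulr_ge0.
rewrite ler_pdivlMr//.
have [y1|y1] := ltP `|y| 1.
  have y2 : y ^+ 2 <= 1 by rewrite -real_normK ?num_real// expr_le1// ltW.
  have : `|u t y| * (1 + y ^+ 2) <= B * 2.
    by apply: ler_pM => //; [exact: ltW|exact: uB|lra].
  lra.
have [w1 w2] : (Num.truncn `|y|)%:R <= `|y| /\ `|y| < (Num.truncn `|y|).+1%:R.
  exact/andP/truncn_itv.
have k0 : (0 < Num.truncn `|y|)%N.
  by rewrite -ltnS -(ltr_nat R); exact: le_lt_trans w2.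
have /andP[k1 k2] := trunc_log_bounds (isT : 1 < 2)%N k0.
set n := trunc_log 2 _ in k1 k2.
have [n1 n2] : 2 ^+ n <= `|y| /\ `|y| < 2 ^+ n.+1.
  rewrite -!natrX; split; first by apply: le_trans w1; rewrite ler_nat.
  by apply: (lt_le_trans w2); rewrite ler_nat.
have q0 : 0 < 4 ^+ n :> R by rewrite exprn_gt0.
have y2 : y ^+ 2 <= 4 * 4 ^+ n.
  have -> : 4 * 4 ^+ n = (2 ^+ n.+1) ^+ 2 :> R.
    by rewrite -exprS -exprM mulnC exprM; congr (_ ^+ _); ring.
  by rewrite -real_normK ?num_real// lerXn2r ?nnegrE ?(ltW n2)// exprn_ge0.
have y1' : 1 <= y ^+ 2 by rewrite -real_normK ?num_real// exprn_ege1.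
have : `|u t y| <= A * E * 4 ^- n.
  apply: (le_trans (H n t y tT n1)); rewrite ler_wpM2r ?invr_ge0 ?(ltW q0)// ler_wpM2l//.
  by rewrite /E ler_expR ler_wpM2l// exprn_ge0// ltW.
rewrite ler_pdivlMr// => hu.
have : `|u t y| * (1 + y ^+ 2) <= `|u t y| * (8 * 4 ^+ n).
  rewrite ler_wpM2l//; lra.
lra.
Qed.

End spatial_decay.

(** * The leading term *)

Section leading_term.
Context {R : realType}.
Local Notation mu := (@lebesgue_measure R).
Implicit Types (f g h : R -> R) (t x y tau : R).

Lemma cvg_powRN_pinfty (p : R) : 0 < p -> `|x| `^ (- p) @[x --> +oo] --> (0:R).
Proof.
move=> p0; apply/cvgrPdist_le => /= e e0; near=> x.
have x0 : 0 < x by near: x; apply: nbhs_pinfty_gt; exact: num_real.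
have xe : e^-1 `^ p^-1 <= x by near: x; apply: nbhs_pinfty_ge; exact: num_real.
rewrite sub0r normrN ger0_norm ?powR_ge0// (gtr0_norm x0) powRN.
rewrite -[leRHS]invrK lef_pV2 ?posrE ?invr_gt0 ?powR_gt0//.
have -> : e^-1 = (e^-1 `^ p^-1) `^ p.
  by rewrite -powRrM mulVf ?gt_eqF// powRr1// invr_ge0 ltW.
by apply: ge0_ler_powR; rewrite ?nnegrE ?powR_ge0 ?(ltW p0) ?(ltW x0).
Unshelve. all: by end_near. Qed.

Lemma cvg_powRN_ninfty (p : R) : 0 < p -> `|x| `^ (- p) @[x --> -oo] --> (0:R).
Proof.
move=> p0; apply/cvgNy_compNP; apply: cvg_trans (cvg_powRN_pinfty p0).
by apply: near_eq_cvg; apply: nearW => x /=; rewrite normrN.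
Qed.

Lemma mean_value_le f df (a b k : R) : (forall x, is_derive x (1:R) f (df x)) ->
  (forall z, Num.min a b <= z <= Num.max a b -> `|df z| <= k) ->
  `|f b - f a| <= k * `|b - a|.
Proof.
move=> fdf; wlog ab : a b / a <= b => [H dfk|].
  have [ab|ba] := leP a b; first exact: H.
  rewrite distrC (distrC b); apply: H; first exact: ltW.
  by move=> z; rewrite minC maxC; exact: dfk.
rewrite (min_idPl ab) (max_idPr ab) => dfk.
have cf : {within `[a, b], continuous f}.
  apply: continuous_subspaceT; apply: derivable_continuous => x.
  by have [] := fdf x.
have [z zab ->] := MVT_segment ab (fun x _ => fdf x) cf.
by rewrite normrM ler_wpM2r// dfk//; move: zab; rewrite in_itv.
Qed.

Variables (eta : R).
Hypothesis eta_gt0 : 0 < eta.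

(** The mean value theorem gives [|y| / |x|^3], that is [x^-2 z] with
    [z = |y| / |x| <= 1], and [z <= sqrt z]. The square root leaves a moment
    of order 1/2 of the datum, which is finite for a datum that is [O(1 / y^2)],
    while the first moment may not be. *)
Lemma K_eta_diff_le (M : R) : exists2 C : R, 0 <= C & forall m x y, 0 < m <= M -> x != 0 ->
  `|y| < `|x| / 2 ->
  `|K_eta eta (m ^+ 3) (x - y) - K_eta eta (m ^+ 3) x| <=
    C * m * `|x| ^- 2 * Num.sqrt (`|y| / `|x|).
Proof.
have [C C0 dKC] := dK_eta_le eta_gt0 M.
exists (8 * C) => [|m x y mM x0 yx]; first by rewrite mulr_ge0.
have /andP[m0 _] := mM.
have nx : 0 < `|x| by rewrite normr_gt0.
pose z := `|y| / `|x|.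
have z0 : 0 <= z by rewrite divr_ge0.
have z1 : z <= 1 by rewrite ler_pdivrMr// mul1r; lra.
have zs : z <= Num.sqrt z.
  rewrite -{1}(sqr_sqrtr z0) expr2 ler_piMr ?sqrtr_ge0//.
  by rewrite -sqrtr1 ler_wsqrtr.
apply: (@le_trans _ _ (8 * C * m * `|x| ^- 3 * `|x - y - x|)).
  apply: mean_value_le => [w|w wx]; first exact: is_derive_K_eta.
  have xw : `|x| / 2 <= `|w|.
    have -> : w = x - (x - w) by ring.
    have yw : `|x - w| <= `|y|.
      move: wx; rewrite ge_min le_max => /andP[/orP h1 /orP h2].
      rewrite ler_norml; have := ler_norm y; have := ler_norm (- y); rewrite normrN.
      have := normr_ge0 y.
      by case: h1 => h1; case: h2 => h2 ? ? ?; apply/andP; split; lra.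
    by have := lerB_dist x (x - w); lra.
  have [_ h] := dKC _ w mM.
  have w3 : `|x| ^+ 3 / 8 <= `|w| ^+ 3.
    have -> : `|x| ^+ 3 / 8 = (`|x| / 2) ^+ 3 by field.
    by rewrite lerXn2r ?nnegrE// divr_ge0.
  rewrite ler_pdivlMr ?exprn_gt0//.
  have : `|dK_eta eta m w| * (`|x| ^+ 3 / 8) <= C * m.
    by apply: le_trans h; rewrite ler_wpM2l.
  by rewrite mulrA ler_pdivrMr// => /le_trans; apply; rewrite le_eqVlt; apply/orP; left; apply/eqP; ring.
rewrite addrAC subrr sub0r normrN -/z.
have -> : 8 * C * m * `|x| ^- 3 * `|y| = 8 * C * m * `|x| ^- 2 * z.
  by rewrite /z; field; rewrite normr_eq0.
by rewrite ler_wpM2l// !mulr_ge0 ?(ltW m0)// invr_ge0 exprn_ge0.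
Qed.

Lemma sqrt_weight_le y : Num.sqrt `|y| / (1 + y ^+ 2) <= 2 * (1 + `|y|) `^ (- (3 / 2)).
Proof.
have y0 : 0 <= `|y| by [].
rewrite -(real_normK (num_real y)); move: (`|y| : R) y0 => z y0.
have z1 : 0 < 1 + z by lra.
have -> : - (3 / 2) = 2^-1 - 2 :> R by field.
rewrite powRB ?(gt_eqF z1)//; last by apply/implyP.
rewrite powR12_sqrt ?(ltW z1)// (powR_mulrn 2)// ?(ltW z1)//.
rewrite ler_pdivrMr ?ltr_pwDl ?sqr_ge0//.
apply: (@le_trans _ _ (Num.sqrt (1 + z) * (2 * (1 + z ^+ 2) / (1 + z) ^+ 2))); last first.
  by rewrite le_eqVlt; apply/orP; left; apply/eqP; ring.
rewrite -[leLHS]mulr1; apply: ler_pM; rewrite ?sqrtr_ge0//.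
  by apply: ler_wsqrtr; lra.
by rewrite ler_pdivlMr ?exprn_gt0// mul1r; have := sqr_ge0 (z - 1); nra.
Qed.

(** For [|y| < |x| / 2], [K_eta_diff_le] gains [|x|^(-1/2)] over [x^-2]. For
    [|y| >= |x| / 2], the term [K(x) u0(y)] is a tail of the same moment of order 1/2,
    and in [K(x - y) u0(y)] the datum is [O(|x|^(-2-eps))] while [K] is integrable. *)
Lemma leading_term_le (m c eps : R) (u0 : R -> R) : 0 < m -> 0 < eps ->
  continuous u0 -> (forall x, `|u0 x| <= c / (1 + x ^+ 2)) ->
  (forall x, `|u0 x| <= c / (1 + `|x| `^ (2 + eps))) ->
  exists C : R, forall x, x != 0 ->
    `|convolution (K_eta eta (m ^+ 3)) u0 x - K_eta eta (m ^+ 3) x * \int[mu]_y u0 y| <=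
    C * `|x| ^- 2 * (`|x| `^ (- 2^-1) + `|x| `^ (- eps)).
Proof.
move=> m0 eps0 cu0 u0c u0e.
have mm : 0 < m <= m by rewrite m0 lexx.
have [C C0 KC] := K_eta_le eta_gt0 m.
have [C' C'0 KC'] := K_eta_diff_le m.
have c0 : 0 <= c by have := le_trans (normr_ge0 _) (u0c 0); rewrite expr0n/= addr0 divr1.
have iw := @integrable_tail R (3 / 2) _; rewrite (_ : 1 < 3 / 2 :> R) in iw; last by lra.
have {iw}iw := iw isT.
pose w y : R := (1 + `|y|) `^ (- (3 / 2)).
pose W := \int[mu]_y w y.
have w_ge0 y : 0 <= w y by exact: powR_ge0.
have W0 : 0 <= W by apply: Rintegral_ge0.
have iu0 : mu.-integrable setT (EFin \o u0).
  apply: (@integrable_le R _ _ (fun y => c / (1 + y ^+ 2))) => //.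
    by apply: continuous_measurable_fun.
  exact: (integrable_scale c measurableT (@integrable_cauchy R)).
have u0b y : `|u0 y| <= c.
  apply: (le_trans (u0c y)); rewrite ler_pdivrMr ?ltr_pwDl ?sqr_ge0//.
  by rewrite ler_peMr// lerDl sqr_ge0.
(* [k]: the difference of kernels near 0 and [K(x)] far from 0;
   [k']: [K(x - y)] far from 0 *)
pose k := (C' * m + 2 * (C * m)) * (2 * c).
pose k' := C * (c * 2 `^ (2 + eps)).
have k0 : 0 <= k by rewrite mulr_ge0 ?addr_ge0 ?mulr_ge0 ?(ltW m0).
have k'0 : 0 <= k' by rewrite !mulr_ge0 ?powR_ge0.
exists (k * W + k' * pi) => x x0.
have nx : 0 < `|x| by rewrite normr_gt0.
have iK : mu.-integrable setT (EFin \o (fun y => K_eta eta (m ^+ 3) (x - y) * u0 y)).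
  apply: (@integrable_poisson_mul R m x _ _ C c) => //; first exact: continuous_K_eta_sub.
  by move=> y; exact: KC.
have iK' := integrable_scale (K_eta eta (m ^+ 3) x) measurableT iu0.
rewrite /convolution -(RintegralZl _ measurableT iu0) -(RintegralB measurableT iK iK').
pose X : R := `|x| ^- 2; pose a : R := `|x| `^ (- 2^-1); pose b : R := `|x| `^ (- eps).
rewrite -/X -/a -/b.
have X0 : 0 <= X by rewrite invr_ge0 exprn_ge0.
have a0 : 0 <= a by exact: powR_ge0.
have b0 : 0 <= b by exact: powR_ge0.
have iw' := integrable_scale (k * X * a) measurableT iw.
have ip' := integrable_scale (k' * X * b) measurableT (integrable_poisson x m0).
apply: (@le_trans _ _ (\int[mu]_y (k * X * a * w y + k' * X * b * poisson m (x - y)))); last first.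
  rewrite (RintegralD measurableT iw' ip').
  rewrite (RintegralZl _ measurableT iw) (RintegralZl _ measurableT (integrable_poisson x m0)).
  rewrite integral_poisson// -/W.
  have h1 : 0 <= k * X * b * W by exact: mulr_ge0 (mulr_ge0 (mulr_ge0 k0 X0) b0) W0.
  have h2 : 0 <= k' * X * a * pi by exact: mulr_ge0 (mulr_ge0 (mulr_ge0 k'0 X0) a0) (pi_ge0 R).
  have -> : (k * W + k' * pi) * X * (a + b) = k * X * a * W + k' * X * b * pi + (k * X * b * W + k' * X * a * pi) by ring.
  by rewrite lerDl addr_ge0.
apply: norm_Rintegral_le => //; last exact: integrable_add.
have sq y : Num.sqrt (`|y| / `|x|) = Num.sqrt `|y| * a.
  by rewrite sqrtrM// sqrtrV ?(ltW nx)// /a powRN powR12_sqrt// ltW.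
have wu y : Num.sqrt (`|y| / `|x|) * `|u0 y| <= 2 * c * a * w y.
  rewrite sq mulrAC [leRHS](_ : _ = c * (2 * w y) * a); last by ring.
  rewrite ler_wpM2r//.
  apply: (@le_trans _ _ (c * (Num.sqrt `|y| / (1 + y ^+ 2)))).
    rewrite mulrC [leRHS](_ : _ = c / (1 + y ^+ 2) * Num.sqrt `|y|); last by ring.
    by rewrite ler_wpM2r ?sqrtr_ge0.
  by rewrite ler_wpM2l// sqrt_weight_le.
have p0 y := poisson_ge0 (x - y) (ltW m0).
move=> y _; have [xy|yx] := leP (`|x| / 2) `|y|; last first.
  rewrite -[leLHS]addr0 lerD//; last exact: mulr_ge0 (mulr_ge0 (mulr_ge0 k'0 X0) b0) (p0 y).
  rewrite -mulrBl normrM.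
  apply: (@le_trans _ _ (C' * m * X * (Num.sqrt (`|y| / `|x|) * `|u0 y|))).
    by rewrite mulrA ler_wpM2r//; exact: KC'.
  apply: (@le_trans _ _ (C' * m * X * (2 * c * a * w y))).
    by rewrite ler_wpM2l// !mulr_ge0 ?(ltW m0).
  have -> : k * X * a * w y = C' * m * X * (2 * c * a * w y) + 2 * (C * m) * X * (2 * c * a * w y).
    by rewrite /k; ring.
  by rewrite lerDl !mulr_ge0 ?(ltW m0).
apply: (le_trans (ler_normB _ _)); rewrite addrC lerD//.
  rewrite normrM.
  have K1 : `|K_eta eta (m ^+ 3) x| <= C * m * X.
    apply: (le_trans (KC _ _ mm)); rewrite -mulrA ler_wpM2l// /poisson ler_wpM2l ?(ltW m0)//.
    rewrite /X lef_pV2 ?posrE ?exprn_gt0 ?poisson_den_gt0//.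
    by rewrite real_normK ?num_real// lerDr sqr_ge0.
  have s1 : 1 <= 2 * Num.sqrt (`|y| / `|x|).
    have h : 1 / 4 <= `|y| / `|x|.
      by rewrite ler_pdivlMr//; lra.
    have E : 2 * Num.sqrt (1 / 4) = 1 :> R.
      have -> : 1 / 4 = 2^-1 ^+ 2 :> R by field.
      by rewrite sqrtr_sqr ger0_norm ?invr_ge0//; field.
    by rewrite -[leLHS]E ler_wpM2l// ler_wsqrtr.
  apply: (@le_trans _ _ (C * m * X * `|u0 y|)); first by rewrite ler_wpM2r.
  apply: (@le_trans _ _ (C * m * X * (2 * (2 * c * a * w y)))).
    rewrite ler_wpM2l ?mulr_ge0 ?(ltW m0)//.
    apply: (@le_trans _ _ (2 * (Num.sqrt (`|y| / `|x|) * `|u0 y|))).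
      by rewrite mulrA ler_peMl.
    by rewrite ler_wpM2l.
  have -> : k * X * a * w y = C' * m * X * (2 * c * a * w y) + C * m * X * (2 * (2 * c * a * w y)).
    by rewrite /k; ring.
  by rewrite lerDr !mulr_ge0 ?(ltW m0).
rewrite normrM.
have u1 : `|u0 y| <= c * 2 `^ (2 + eps) * (X * b).
  apply: (le_trans (u0e y)).
  have e2 : 0 <= 2 + eps by lra.
  have y2 : (`|x| / 2) `^ (2 + eps) <= 1 + `|y| `^ (2 + eps).
    apply: (@le_trans _ _ (`|y| `^ (2 + eps))); last by rewrite lerDr.
    by apply: ge0_ler_powR; rewrite ?nnegrE ?divr_ge0.
  have xx : 0 < (`|x| / 2) `^ (2 + eps) by rewrite powR_gt0 ?divr_gt0.
  have -> : c * 2 `^ (2 + eps) * (X * b) = c / (`|x| / 2) `^ (2 + eps).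
    have E : (`|x| / 2) `^ (2 + eps) * 2 `^ (2 + eps) = `|x| ^+ 2 * `|x| `^ eps.
      rewrite -powRM ?divr_ge0// divfK// powRD; last by rewrite normr_eq0 x0 implybT.
      by rewrite powR_mulrn.
    have X2 : 0 < `|x| ^+ 2 by rewrite exprn_gt0.
    have Q2 : 0 < `|x| `^ eps by rewrite powR_gt0.
    have R2 : 0 < 2 `^ (2 + eps) :> R by rewrite powR_gt0.
    rewrite /X /b powRN -invfM -E invfM mulrCA -!mulrA mulfV ?gt_eqF// mulr1.
    exact: mulrC.
  rewrite ler_wpM2l// lef_pV2 ?posrE// (lt_le_trans xx)//.
apply: (@le_trans _ _ (C * poisson m (x - y) * (c * 2 `^ (2 + eps) * (X * b)))).
  by apply: ler_pM => //; exact: KC.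
by rewrite le_eqVlt; apply/orP; left; apply/eqP; rewrite /k'; ring.
Qed.

End leading_term.

(** * The asymptotic development *)

Section asymptotics.
Context {R : realType}.
Local Notation mu := (@lebesgue_measure R).
Implicit Types (f g h : R -> R) (t x y tau : R).

(** The case distinction is [|x| <= 1], where [x^2 <= 1], and [|x| > 1], where
    [x^2 <= |x|^(2+eps)]; the Cauchy density is the majorant that the decay estimates
    propagate. *)
Lemma datum_decay (c eps : R) (u0 : R -> R) : 0 < c -> 0 < eps ->
  (forall x, `|u0 x| <= c / (1 + `|x| `^ (2 + eps))) ->
  forall x, `|u0 x| <= 2 * c / (1 + x ^+ 2).
Proof.
move=> c0 eps0 h x; apply: (le_trans (h x)).
have d1 : 0 < 1 + x ^+ 2 by rewrite ltr_pwDl ?sqr_ge0.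
have d2 : 0 < 1 + `|x| `^ (2 + eps) by rewrite ltr_pwDl ?powR_ge0.
rewrite ler_pdivlMr// mulrAC ler_pdivrMr// (mulrC 2) -mulrA ler_wpM2l ?(ltW c0)//.
rewrite -(real_normK (num_real x)).
have [x1|x1] := leP `|x| 1.
  have : `|x| ^+ 2 <= 1 by rewrite expr_le1.
  have := powR_ge0 `|x| (2 + eps); lra.
have : `|x| ^+ 2 <= `|x| `^ (2 + eps).
  by rewrite -powR_mulrn// ler_powR ?(ltW x1)// lerDl ltW.
have := sqr_ge0 `|x|; lra.
Qed.

Lemma cvg_inv_1Dsqr_pinfty : (1 + y ^+ 2)^-1 @[y --> +oo] --> (0:R).
Proof.
have := cvg_poisson_sub_pinfty 0 (@ltr01 R).
by apply: cvg_trans; apply: near_eq_cvg; apply: nearW => y; rewrite poisson1E.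
Qed.

Lemma cvg_inv_1Dsqr_ninfty : (1 + y ^+ 2)^-1 @[y --> -oo] --> (0:R).
Proof.
have := cvg_poisson_sub_ninfty 0 (@ltr01 R).
by apply: cvg_trans; apply: near_eq_cvg; apply: nearW => y; rewrite poisson1E.
Qed.

(** [f f' = (f^2 / 2)'] and [f] vanishes at infinity. *)
Lemma integral_mul_derive_eq0 f df (A M : R) : continuous f -> continuous df ->
  (forall y, is_derive y (1:R) f (df y)) ->
  (forall y, `|f y| <= A / (1 + y ^+ 2)) -> (forall y, `|df y| <= M) ->
  \int[mu]_y (f y * derive1 f y) = 0.
Proof.
move=> cf cdf fdf fA dfM.
have A0 : 0 <= A by have := le_trans (normr_ge0 _) (fA 0); rewrite expr0n/= addr0 divr1.
have -> : \int[mu]_y (f y * derive1 f y) = \int[mu]_y (f y * df y).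
  by apply: eq_Rintegral => y _; rewrite derive1E; have [_ ->] := fdf y.
rewrite -[RHS](subrr 0).
have lim0 (F : set_system R) : Filter F -> (1 + y ^+ 2)^-1 @[y --> F] --> (0:R) ->
    2^-1 * f y ^+ 2 @[y --> F] --> (0:R).
  move=> FF cF; apply/norm_cvg0P.
  apply: (@squeeze_cvgr _ _ _ _ (fun=> 0) (fun y => A ^+ 2 * (1 + y ^+ 2)^-1)).
  - apply: nearW => y; rewrite normr_ge0/= normrM normrX ger0_norm ?invr_ge0//.
    have d1 : 1 <= 1 + y ^+ 2 by rewrite lerDl sqr_ge0.
    have d0 : 0 < 1 + y ^+ 2 by rewrite (lt_le_trans _ d1).
    apply: (@le_trans _ _ (`|f y| ^+ 2)).
      by rewrite ler_piMl ?sqr_ge0// invf_le1// ler1n.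
    rewrite expr2 (@le_trans _ _ (A * (A / (1 + y ^+ 2))))//; last by rewrite mulrA -expr2.
    apply: ler_pM => //; apply: (le_trans (fA y)).
    by rewrite ler_pdivrMr// ler_peMr.
  - exact: cvg_cst.
  - by rewrite -[X in _ --> X](mulr0 (A ^+ 2)); exact: cvgMl_tmp.
apply: (@FTC_R R _ (fun y => 2^-1 * f y ^+ 2)).
- by move=> y; apply: cvgM; [exact: cf|exact: cdf].
- apply: (@integrable_le R _ _ (fun y => A * M * (1 + y ^+ 2)^-1)) => //.
  + by apply: continuous_measurable_fun => y; apply: cvgM; [exact: cf|exact: cdf].
  + by move=> y _; rewrite normrM mulrAC; apply: ler_pM.
  + exact: (integrable_scale (A * M) measurableT (@integrable_cauchy R)).
- by move=> y; have h := fdf y; apply: is_derive_eq; rewrite /GRing.scale/=; field.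
- by apply: lim0; exact: cvg_inv_1Dsqr_pinfty.
- by apply: lim0; exact: cvg_inv_1Dsqr_ninfty.
Qed.

Lemma momentum_flux_eq0 (eta s c : R) (u0 : R -> R) (u : R -> R -> R) : 0 < eta ->
  3 / 2 < s -> global_solution eta s u0 u -> (forall x, `|u0 x| <= c / (1 + x ^+ 2)) ->
  forall t, 0 <= t -> \int[mu]_y (u t y * derive1 (u t) y) = 0.
Proof.
move=> eta0 s32 u_sol u0c t t0.
have [u_Hs uc _ _] := u_sol; have [uH _] := u_Hs.
have T0 : 0 < t + 1 by lra.
have [A A0 uA] := uniform_decay eta0 s32 u_sol u0c T0.
have [df [fdf cdf [M dfM]]] := Hs_C1 s32 (uc t t0) (uH t t0).
apply: (@integral_mul_derive_eq0 _ df A M) => //; first exact: uc.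
by move=> y; apply: uA; rewrite t0 lerDl ler01.
Qed.

(** [solution_le] with the decay [O(1 / y^2)] of [u]: beyond [|x| / 2] the square is
    [O(|x|^-4)], and [u^2] has finite mass, so that the near part is [O(|x|^-3)]. The
    rate of the exponential weight is set to 1. *)
Lemma nonlinear_decay (eta s c : R) (u0 : R -> R) (u : R -> R -> R) : 0 < eta ->
  3 / 2 < s -> global_solution eta s u0 u -> (forall x, `|u0 x| <= c / (1 + x ^+ 2)) ->
  forall t, 0 < t -> exists C : R, forall x, 1 <= `|x| ->
    `|u t x - convolution (K_eta eta t) u0 x| <= C * `|x| ^- 3.
Proof.
move=> eta0 s32 u_sol u0c t t0.
have [A A0 uA] := uniform_decay eta0 s32 u_sol u0c t0.
have [C C0 HC] := solution_le eta0 s32 u_sol t0.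
exists (C * (expR t * (16 * A ^+ 2) + A ^+ 2 * pi)) => x x1.
have x0 : x != 0 by rewrite -normr_gt0 (lt_le_trans _ x1).
have nx : 0 < `|x| by rewrite normr_gt0.
have tt : 0 < t <= t by rewrite t0 lexx.
have X0 : 0 <= `|x| ^- 3 by rewrite invr_ge0 exprn_ge0.
have A2 : 0 <= A ^+ 2 by exact: sqr_ge0.
have uA2 tau y : 0 <= tau < t -> u tau y ^+ 2 <= (A / (1 + y ^+ 2)) ^+ 2.
  move=> /andP[tau0 taut]; rewrite -real_normK ?num_real//.
  have h : `|u tau y| <= A / (1 + y ^+ 2) by apply: uA; rewrite tau0 ltW.
  by rewrite lerXn2r ?nnegrE// (le_trans _ h).
have S0 : 0 <= 16 * A ^+ 2 * `|x| ^- 3 by rewrite !mulr_ge0.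
apply: (le_trans (HC t 1 x (16 * A ^+ 2 * `|x| ^- 3) (fun y => A ^+ 2 / (1 + y ^+ 2)) tt ltr01 x0 S0 _ _ _ _)).
- move=> tau y tauT xy; apply: (le_trans (uA2 _ _ tauT)).
  have e1 : 1 <= expR (1 ^+ 3 * tau).
    by case/andP : tauT => tau0 _; rewrite expr1n mul1r -[leLHS]expR0 ler_expR.
  apply: (@le_trans _ _ (16 * A ^+ 2 * `|x| ^- 3)); last by rewrite ler_peMr.
  have h : A / (1 + y ^+ 2) <= 4 * A * `|x| ^- 2 by exact: div_1Dsqr_le_far.
  apply: (@le_trans _ _ ((4 * A * `|x| ^- 2) ^+ 2)).
    have h0 : 0 <= A / (1 + y ^+ 2) by rewrite divr_ge0// addr_ge0 ?sqr_ge0.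
    by rewrite lerXn2r ?nnegrE//; exact: le_trans h0 h.
  have -> : (4 * A * `|x| ^- 2) ^+ 2 = 16 * A ^+ 2 * `|x| ^- 3 * `|x|^-1.
    by field; rewrite normr_eq0.
  by rewrite ler_piMr// invf_le1.
- move=> tau y tauT _; apply: (le_trans (uA2 _ _ tauT)).
  have d1 : 1 <= 1 + y ^+ 2 by rewrite lerDl sqr_ge0.
  have d0 : 0 < 1 + y ^+ 2 by rewrite (lt_le_trans _ d1).
  rewrite exprMn ler_wpM2l// expr2 ler_piMl ?invr_ge0 ?(ltW d0)//.
  by rewrite invf_le1.
- by move=> y; rewrite divr_ge0// addr_ge0 ?sqr_ge0.
- exact: integrable_cauchy_scale.
rewrite integral_cauchy_scale expr1n mul1r invr1 mul1r.
by rewrite le_eqVlt; apply/orP; left; apply/eqP; ring.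
Qed.

End asymptotics.

Unset Implicit Arguments.
Set Strict Implicit.
Set Printing Implicit Defensive.

Theorem theorem2 (R : realType) (eta s eps c : R) (u0 : R -> R)
    (u : R -> R -> R)
    (eta_gt0 : 0 < eta) (s_gt : 3 / 2 < s) (s_le : s <= 2)
    (u0_Hs : Hs s u0) (u0_cont : continuous u0)
    (eps_gt0 : 0 < eps) (c_gt0 : 0 < c)
    (u0_decay : forall x : R, `|u0 x| <= c / (1 + `|x| `^ (2 + eps)))
    (du0_decay : forall x : R, `|derive1 u0 x| <= c / (1 + `|x| ^+ 2))
    (u_sol : global_solution eta s u0 u) :
  exists o : R -> R -> R, forall t : R, 0 < t ->
    (forall x : R,
      u t x =
        K_eta eta t x * (\int[@lebesgue_measure R]_(y in setT) u0 y)
        + \int[@lebesgue_measure R]_(tau in `[0, t])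
            (K_eta eta (t - tau) x *
             \int[@lebesgue_measure R]_(y in setT)
               (u tau y * derive1 (u tau) y))
        + o t x) /\
    (o t x / (1 / `|x| ^+ 2) @[x --> +oo] --> 0) /\
    (o t x / (1 / `|x| ^+ 2) @[x --> -oo] --> 0).
Proof.
have u0c := datum_decay c_gt0 eps_gt0 u0_decay.
pose I := \int[@lebesgue_measure R]_(y in setT) u0 y.
pose J t x := \int[@lebesgue_measure R]_(tau in `[0, t]) (K_eta eta (t - tau) x *
             \int[@lebesgue_measure R]_(y in setT) (u tau y * derive1 (u tau) y)).
exists (fun t x => u t x - K_eta eta t x * I - J t x) => t t0.
split; first by move=> x; rewrite -/I -/(J t x); ring.
have J0 x : J t x = 0.
  rewrite /J (_ : Rintegral _ _ _ = \int[@lebesgue_measure R]_(tau in `[0, t]) 0).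
    by rewrite /Rintegral integral0.
  apply: eq_Rintegral => tau /set_mem/=; rewrite in_itv/= => /andP[tau0 _].
  by rewrite (momentum_flux_eq0 eta_gt0 s_gt u_sol u0c tau0) mulr0.
have [C1 HC1] := nonlinear_decay eta_gt0 s_gt u_sol u0c t0.
have u0e x : `|u0 x| <= 2 * c / (1 + `|x| `^ (2 + eps)).
  apply: (le_trans (u0_decay x)); rewrite -mulrA ler_peMl// ?ler1n//.
  by rewrite divr_ge0 ?(ltW c_gt0)// addr_ge0 ?powR_ge0.
have [C2 HC2] := leading_term_le eta_gt0 (cube_root_gt0 t0) eps_gt0 u0_cont u0c u0e.
rewrite (cube_rootK t0) in HC2.
pose o x := (u t x - K_eta eta t x * I - J t x) / (1 / `|x| ^+ 2).
pose G (x : R) : R := C1 * `|x| `^ (-1) + C2 * (`|x| `^ (- 2^-1) + `|x| `^ (- eps)).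
have oG x : 1 <= `|x| -> `|o x| <= G x.
  move=> x1; have nx : 0 < `|x| by rewrite (lt_le_trans _ x1).
  have x0 : x != 0 by rewrite -normr_gt0.
  rewrite /o J0 subr0 div1r invrK normrM normrX normr_id -ler_pdivlMr ?exprn_gt0//.
  have -> : u t x - K_eta eta t x * I = (u t x - convolution (K_eta eta t) u0 x) +
      (convolution (K_eta eta t) u0 x - K_eta eta t x * I) by ring.
  apply: (le_trans (ler_normD _ _)); apply: (le_trans (lerD (HC1 x x1) (HC2 x x0))).
  rewrite /G powR_inv1// mulrDl.
  rewrite le_eqVlt; apply/orP; left; apply/eqP.
  by move: (_ `^ _ + _ `^ _) => z; field; rewrite normr_eq0.
have G0 (F : set_system R) : Filter F ->
    (forall p : R, 0 < p -> `|x| `^ (- p) @[x --> F] --> (0:R)) -> G x @[x --> F] --> (0:R).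
  move=> FF pF; rewrite -[X in _ --> X](_ : C1 * 0 + C2 * (0 + 0) = 0); last by ring.
  apply: cvgD; first by apply: cvgMl_tmp; exact: pF.
  apply: cvgMl_tmp; apply: cvgD; last exact: pF.
  by apply: pF; rewrite invr_gt0.
have o0 (F : set_system R) : Filter F -> (\forall x \near F, 1 <= `|x|) ->
    (forall p : R, 0 < p -> `|x| `^ (- p) @[x --> F] --> (0:R)) -> o x @[x --> F] --> (0:R).
  move=> FF F1 pF; apply/norm_cvg0P.
  apply: (@squeeze_cvgr _ _ _ _ (fun=> 0) G); [|exact: cvg_cst|exact: G0].
  by apply: filterS F1 => x x1; rewrite normr_ge0 oG.
split; apply: o0.
- by apply: filterS (nbhs_pinfty_ge (num_real 1)) => x; have := ler_norm x; lra.
- exact: cvg_powRN_pinfty.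
- by apply: filterS (nbhs_ninfty_le (num_real (-1))) => x; have := ler_norm (- x); rewrite normrN; lra.
- exact: cvg_powRN_ninfty.
Qed.
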